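(* Let $n\in\mathbb{N}$, $n\ge 1$. For a compact set $X\subset\mathbb{R}^n$, there exists a quasisymmetric map $F:\mathbb{R}^{n+1}\to\mathbb{R}^{n+1}$ with $F(\mathcal{C})=X$ if and only if $X$ is uniformly perfect and uniformly disconnected.
   Context: $\mathcal{C}\subset[0,1]\subset\mathbb{R}$ is the standard ternary Cantor set. For each $k\ge 1$, $\mathbb{R}^k$ is identified with $\mathbb{R}^k\times\{0\}\subset\mathbb{R}^{k+1}$; so $\mathcal{C}\subset\mathbb{R}$ is regarded as a subset of the first coordinate axis of $\mathbb{R}^{n+1}$, and $X\subset\mathbb{R}^n$ as a subset of $\mathbb{R}^{n+1}$. All subsets of Euclidean spaces carry the Euclidean metric. A homeomorphism $f:(X,d_X)\to(Y,d_Y)$ between metric spaces is $\eta$-quasisymmetric, where $\eta:[0,\infty)\to[0,\infty)$ is a homeomorphism, if for all $x,a,b\in X$ with $x\neq b$, $$\frac{d_Y(f(x),f(a))}{d_Y(f(x),f(b))}\le \eta\left(\frac{d_X(x,a)}{d_X(x,b)}\right).$$ It is quasisymmetric if it is $\eta$-quasisymmetric for some such $\eta$. A quasisymmetric map $F:\mathbb{R}^{n+1}\to\mathbb{R}^{n+1}$ is in particular a homeomorphism of $\mathbb{R}^{n+1}$ onto itself. A closed non-degenerate (i.e. having more than one point) metric space $X$ is uniformly perfect if there exists a constant $c\ge 1$ such that for all $x\in X$ and all $r\in(0,\operatorname{diam}X)$ there exists a point of $X$ in $B(x,r)\setminus B(x,r/c)$, where $B(x,r)$ is the open ball. A metric space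 $X$ is uniformly disconnected if there is a constant $c\ge 1$ such that for all $x\in X$ and all positive $r<\frac14\operatorname{diam}X$ there exists $E\subset X$ containing $x$ such that $\operatorname{diam}E\le r$ and $\operatorname{dist}(E,X\setminus E)\ge r/c$. *)

(* Defs.v *)
From HB Require Import structures.
From mathcomp Require Import all_boot all_order all_algebra.
From mathcomp Require Import all_classical all_reals.
From mathcomp Require Import ereal topology normedtype.
From mathcomp Require Import ring lra.

Set Implicit Arguments.
Unset Strict Implicit.
Unset Printing Implicit Defensive.

Import Order.TTheory GRing.Theory Num.Theory.
Import numFieldNormedType.Exports.

Local Open Scope classical_set_scope.
Local Open Scope ring_scope.

(* The library metrizes 'rV[R]_n by the sup norm, whereas quasisymmetry needs
   the Euclidean distance, so R^n is an alias of 'rV[R]_n whose metric (and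
   topology) is the Euclidean one. *)
Definition euclidean (R : realType) (n : nat) : Type := 'rV[R]_n.

Section EuclideanMetric.
Context {R : realType} {n : nat}.
Implicit Types x y z : euclidean R n.
Implicit Types u v : 'I_n -> R.

Definition euclidean_dist x y : R :=
  Num.sqrt (\sum_(i < n) ((x : 'rV[R]_n) 0 i - (y : 'rV[R]_n) 0 i) ^+ 2).

Let sum_sqr_ge0 u : 0 <= \sum_i u i ^+ 2.
Proof. by apply: sumr_ge0 => i _; exact: sqr_ge0. Qed.

Let cauchy_schwarz u v :
  (\sum_i u i * v i) ^+ 2 <= (\sum_i u i ^+ 2) * (\sum_i v i ^+ 2).
Proof.
have : 0 <= \sum_i \sum_j (u i * v j - u j * v i) ^+ 2.
  by do 2!(apply: sumr_ge0 => ? _); exact: sqr_ge0.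
have -> : \sum_i \sum_j (u i * v j - u j * v i) ^+ 2 =
  \sum_i \sum_j (u i ^+ 2 * v j ^+ 2) +
  \sum_i \sum_j (v i ^+ 2 * u j ^+ 2) -
  2 * \sum_i \sum_j ((u i * v i) * (u j * v j)).
  rewrite mulr_sumr -big_split -sumrB; apply: eq_bigr => i _.
  rewrite mulr_sumr -big_split -sumrB; apply: eq_bigr => j _ /=; ring.
rewrite -!big_distrlr /= expr2; lra.
Qed.

Let minkowski u v :
  Num.sqrt (\sum_i (u i + v i) ^+ 2) <=
  Num.sqrt (\sum_i u i ^+ 2) + Num.sqrt (\sum_i v i ^+ 2).
Proof.
rewrite -ler_sqr ?nnegrE ?addr_ge0 ?sqrtr_ge0// sqrrD !sqr_sqrtr//.
have -> : \sum_i (u i + v i) ^+ 2 =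
  \sum_i u i ^+ 2 + 2 * (\sum_i u i * v i) + \sum_i v i ^+ 2.
  by rewrite mulr_sumr -!big_split; apply: eq_bigr => i _ /=; ring.
rewrite lerD2r lerD2l mulr_natl lerMn2r/= -sqrtrM//.
apply: le_trans (ler_norm _) _.
by rewrite -sqrtr_sqr ler_sqrt ?mulr_ge0.
Qed.

Let euclidean_distxx x : euclidean_dist x x = 0.
Proof.
rewrite /euclidean_dist big1 ?sqrtr0// => i _.
by rewrite subrr expr0n.
Qed.

Let euclidean_dist_positivity x y : euclidean_dist x y = 0 -> x = y.
Proof.
move/eqP; rewrite sqrtr_eq0 => le0; apply/rowP => i; apply/eqP.
rewrite -subr_eq0 -sqrf_eq0.
have /psumr_eq0P : forall j : 'I_n, true ->
    0 <= ((x : 'rV[R]_n) 0 j - (y : 'rV[R]_n) 0 j) ^+ 2.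
  by move=> j _; exact: sqr_ge0.
by move=> -> //; apply/eqP; rewrite eq_le le0 sum_sqr_ge0.
Qed.

Let euclidean_dist_sym x y : euclidean_dist x y = euclidean_dist y x.
Proof.
by congr Num.sqrt; apply: eq_bigr => i _; rewrite -sqrrN opprB.
Qed.

Let euclidean_dist_triangle y x z :
  euclidean_dist x z <= euclidean_dist x y + euclidean_dist y z.
Proof.
apply: le_trans (minkowski _ _); rewrite le_eqVlt; apply/orP; left.
apply/eqP; congr Num.sqrt; apply: eq_bigr => i _.
by rewrite addrA subrK.
Qed.

HB.instance Definition _ := Choice.copy (euclidean R n) 'rV[R]_n.
HB.instance Definition _ := isMetric.Build R (euclidean R n)
  euclidean_distxx euclidean_dist_positivity
  euclidean_dist_sym euclidean_dist_triangle.

End EuclideanMetric.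

(* Zero padding: for m <= n, the identification of R^m with R^m x {0} in R^n. *)
Definition embed (R : realType) (m n : nat) (x : euclidean R m) :
    euclidean R n :=
  \row_(j < n) oapp ((x : 'rV[R]_m) 0) 0 (insub (j : nat) : option 'I_m).
Arguments embed {R m} n x.

Section TernaryCantor.
Variable R : realType.

Fixpoint cantor_stage (k : nat) : set R :=
  if k is k'.+1 then
    [set x / 3 | x in cantor_stage k'] `|`
    [set (x + 2) / 3 | x in cantor_stage k']
  else `[0, 1].

Definition ternary_cantor : set R := \bigcap_k cantor_stage k.

Definition cantor_line : set (euclidean R 1) :=
  [set (const_mx t : 'rV[R]_1) | t in ternary_cantor].

End TernaryCantor.
Arguments cantor_stage : clear implicits.
Arguments ternary_cantor : clear implicits.
Arguments cantor_line : clear implicits.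

Definition homeomorphism_on (T U : topologicalType) (A : set T) (B : set U)
    (f : T -> U) :=
  exists g : U -> T,
    [/\ set_fun A B f, set_fun B A g,
        {in A, cancel f g}, {in B, cancel g f} &
        {within A, continuous f} /\ {within B, continuous g}].

Section MetricNotions.
Context {R : realType}.

Definition eta_quasisymmetric (M N : metricType R) (eta : R -> R)
    (f : M -> N) :=
  homeomorphism_on [set: M] [set: N] f /\
  forall x a b : M, x != b ->
    mdist (f x) (f a) / mdist (f x) (f b) <= eta (mdist x a / mdist x b).

Definition quasisymmetric (M N : metricType R) (f : M -> N) :=
  exists eta : R -> R,
    homeomorphism_on (`[0, +oo[ : set R) (`[0, +oo[ : set R) eta /\
    eta_quasisymmetric eta f.

Context {M : metricType R}.
Implicit Types A B X : set M.

(* Extended-real valued: +oo on unbounded sets, and -oo (not 0) on set0. *)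
Definition diam A : \bar R :=
  ereal_sup [set (mdist p.1 p.2)%:E | p in A `*` A].

(* Distance between two sets, +oo when one of them is empty. *)
Definition set_dist A B : \bar R :=
  ereal_inf [set (mdist p.1 p.2)%:E | p in A `*` B].

(* A subset X of M is regarded as a metric space with the restricted distance;
   its open balls are the traces X `&` ball x r with x in X. *)
Definition uniformly_perfect X :=
  [/\ closed X,
      exists x y, [/\ X x, X y & x != y] &
      exists2 c : R, 1 <= c &
        forall (x : M) (r : R), X x -> 0 < r -> (r%:E < diam X)%E ->
          X `&` (ball x r `\` ball x (r / c)) !=set0].

Definition uniformly_disconnected X :=
  exists2 c : R, 1 <= c &
    forall (x : M) (r : R), X x -> 0 < r -> (r%:E < (4^-1)%:E * diam X)%E ->
      exists E : set M,
        [/\ E `<=` X, E x, (diam E <= r%:E)%E &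
            ((r / c)%:E <= set_dist E (X `\` E))%E].

End MetricNotions.

(* Main.v *)
Require Import Defs.
From mathcomp Require Import all_boot all_order all_algebra.
From mathcomp Require Import all_classical all_reals.
From mathcomp Require Import ereal topology normedtype.
From mathcomp Require Import realfun derive.
From mathcomp Require Import ring lra.

Set Implicit Arguments.
Unset Strict Implicit.
Unset Printing Implicit Defensive.

Import Order.TTheory GRing.Theory Num.Theory.
Import numFieldNormedType.Exports.

Local Open Scope classical_set_scope.
Local Open Scope ring_scope.


(** Both conditions only compare distances inside the set, so they pass from one
    set to another along a quasisymmetric map ([chain_bounded_transfer],
    [perfect_transfer]), and the Cantor set satisfies them by self-similarity
    ([cantor_chain_bounded], [cantor_perfect]).  Uniform disconnectedness is used
    in the following form: a chain of points with steps shorter than [r / c] stays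
    within distance [r] of its starting point.  This is the easy implication.

    Conversely, let [X] satisfy both conditions.  The chains with steps shorter
    than a constant times [lam ^+ k] cut [X] into pieces of level [k], which have
    diameter at most, and mutual distance at least, constants times [lam ^+ k].
    Every piece splits into at least two and at most boundedly many pieces of the
    next level.  A prefix code turns this tree of pieces into the tree of basic
    intervals of the Cantor set; this gives a bijection [f] from [X] onto the
    Cantor set such that the distance of [f x] and [f y] is comparable to
    [3 ^- l], where [l] is the length of the common code ([piece_coding]).

    It remains to extend the inverse of [f] to the whole space, and this takes
    three kinds of power quasisymmetric maps.

    - The pieces of [X] need not lie in disjoint balls.  One additional coordinate
      separates them: near pieces of the same level get different colours, and
      the height of a point is the sum over all levels of its colour times the
      scale of the level.  The height is a Lipschitz function on [X], so a shear
      moves [X] onto its graph, and there the pieces of every level sit in balls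
      that are far apart ([centre_sep]).

    - Given such a tree of balls, each ball can be shrunk radially, level after
      level, by factors that are prescribed up to an upper bound.  The infinite
      composition is power quasisymmetric ([ball_tree_contraction]), because at
      each point and scale it is, up to a bounded factor, a similarity.  So the
      pieces of [X] can be given prescribed sizes ([weighted_embedding]), as long
      as these decrease fast enough along the tree.  For a large exponent [alpha]
      the pieces of [X] are given the sizes [3 ^- (alpha * l)], and the cylinders
      of the Cantor set the [alpha]-th powers of their own; the bijection between
      the two images is then bi-Lipschitz.  As the contractions are strong, the
      image of [X] moreover projects bi-Lipschitzly to the first [n]
      coordinates, and the image of the Cantor set, which is put on the last
      axis beforehand, to the last coordinate.

    - Two compact sets with this property are exchanged by two shears, as in
      Klee's trick: the first one changes the first [n] coordinates by a
      Lipschitz function of the last one, the second one changes the last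
      coordinate by a Lipschitz function of the others ([power_qs_shear]).

    Power quasisymmetry means that distance ratios are distorted at most by
    a fixed power or root.  This class is closed under composition and
    inversion, and its members are quasisymmetric
    ([power_qs_quasisymmetric]). *)

(** * Power distortion of distance ratios *)

Section PowerDistortion.
Variable R : realType.
Implicit Types (t u v C : R) (K : nat).

(** Up to the constant, [u] is at most the larger one of [t ^+ K] and the [K]-th
    root of [t].  Inverting both ratios exchanges the two alternatives. *)
Definition power_distortion C K t u := u <= C * t ^+ K \/ u ^+ K <= C * t.

Lemma power_distortion_inv C K t u : 0 < t -> 0 < u ->
  power_distortion C K t u -> power_distortion C K u^-1 t^-1.
Proof.
move=> t0 u0 [h|h]; [right|left].
- by rewrite exprVn ler_pdivlMr// mulrC ler_pdivrMr ?exprn_gt0.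
- by rewrite exprVn ler_pdivlMr ?exprn_gt0// mulrC ler_pdivrMr.
Qed.

Lemma power_distortion_ge1 C K t u : 0 <= u -> 1 <= C -> (0 < K)%N -> 1 <= t ->
  power_distortion C K t u -> u <= C * t ^+ K.
Proof.
move=> u0 C1 K0 t1 [//|h].
have tK : t <= t ^+ K by apply: ler_eXnr.
have [u1|u1] := leP u 1.
- by apply: (le_trans u1); rewrite -[leLHS]mulr1 ler_pM// (le_trans t1).
- apply: (@le_trans _ _ (u ^+ K)); first by apply: ler_eXnr => //; apply: ltW.
  by apply: (le_trans h); rewrite ler_wpM2l//; apply: le_trans C1.
Qed.

Lemma power_distortion_le1 C K t u : 0 <= t -> 0 <= u -> 1 <= C -> (0 < K)%N ->
  t <= 1 -> power_distortion C K t u -> u ^+ K <= C ^+ K * t.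
Proof.
move=> t0 u0 C1 K0 t1 [h|h].
- apply: (@le_trans _ _ ((C * t ^+ K) ^+ K)); first by apply: lerXn2r; rewrite ?nnegrE// (le_trans _ h).
  rewrite exprMn ler_wpM2l ?exprn_ge0//; first by apply: le_trans C1.
  by rewrite -exprM; apply: ler_iXnr => //; rewrite muln_gt0 K0.
- by apply: (le_trans h); rewrite ler_wpM2r//; apply: ler_eXnr.
Qed.

Lemma power_distortion_mono C K K' t u : 0 <= t -> 0 <= u -> 1 <= C ->
  (0 < K)%N -> (K <= K')%N ->
  power_distortion C K t u -> power_distortion (C ^+ K') K' t u.
Proof.
move=> t0 u0 C1 K0 KK h; have C0 : 0 <= C by apply: le_trans C1.
have K'0 : (0 < K')%N by apply: leq_trans KK.
have [t1|/ltW t1] := leP 1 t.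
- left; apply: (le_trans (power_distortion_ge1 u0 C1 K0 t1 h)).
  by rewrite ler_pM ?exprn_ge0 ?ler_eXnr// ler_weXn2l.
- right; have {}h := power_distortion_le1 t0 u0 C1 K0 t1 h.
  rewrite -(subnK KK) !exprD -mulrA; apply: ler_pM; rewrite ?exprn_ge0//.
  have uC : u <= C.
    rewrite -(@ler_pXn2r _ K)// ?nnegrE//; apply: (le_trans h).
    by rewrite ler_piMr// exprn_ge0.
  by apply: lerXn2r; rewrite ?nnegrE.
Qed.

Lemma power_distortion_trans C K C' K' t u v :
  0 <= t -> 0 <= u -> 0 <= v -> 1 <= C -> 1 <= C' -> (0 < K)%N -> (0 < K')%N ->
  power_distortion C K t u -> power_distortion C' K' u v ->
  power_distortion ((C * C') ^+ (K * K' * K')) (K * K') t v.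
Proof.
move=> t0 u0 v0 C1 C'1 K0 K'0 tu uv.
have C0 : 0 <= C by apply: le_trans C1.
have C'0 : 0 <= C' by apply: le_trans C'1.
have KK : (0 < K * K')%N by rewrite muln_gt0 K0.
have KKK : (0 < K * K' * K')%N by rewrite muln_gt0 KK.
have E1 k : (0 < k)%N -> (k <= K * K' * K')%N ->
    C ^+ k * C' <= (C * C') ^+ (K * K' * K').
  by move=> k0 kK; rewrite exprMn ler_pM ?exprn_ge0 ?ler_weXn2l ?ler_eXnr.
have [t1|/ltW t1] := leP 1 t.
- left; have {}tu := power_distortion_ge1 u0 C1 K0 t1 tu.
  have tKK : 1 <= t ^+ (K * K') by apply: exprn_ege1.
  have [u1|/ltW u1] := leP 1 u.
  + apply: (le_trans (power_distortion_ge1 v0 C'1 K'0 u1 uv)).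
    apply: (@le_trans _ _ (C' * (C * t ^+ K) ^+ K')).
      by rewrite ler_wpM2l// lerXn2r// ?nnegrE// (le_trans _ tu).
    rewrite exprMn mulrA -exprM ler_wpM2r ?exprn_ge0// mulrC E1//.
    by rewrite -{1}(mul1n K') leq_mul2r KK orbT.
  + have {}uv := power_distortion_le1 u0 v0 C'1 K'0 u1 uv.
    have vC : v <= C'.
      rewrite -(@ler_pXn2r _ K')// ?nnegrE//; apply: (le_trans uv).
      by rewrite ler_piMr// exprn_ge0.
    apply: (le_trans vC); rewrite -[leLHS]mulr1 ler_pM//.
    apply: le_trans (E1 (K * K' * K')%N KKK (leqnn _)).
    by rewrite ler_peMl// exprn_ege1.
- right; have {}tu := power_distortion_le1 t0 u0 C1 K0 t1 tu.
  have [u1|/ltW u1] := leP 1 u.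
  + have {}uv := power_distortion_ge1 v0 C'1 K'0 u1 uv.
    apply: (@le_trans _ _ ((C' * u ^+ K') ^+ (K * K'))).
      by rewrite lerXn2r// ?nnegrE// mulr_ge0 ?exprn_ge0.
    rewrite exprMn -exprM (_ : (K' * (K * K') = K * (K' * K'))%N); last by rewrite mulnCA.
    rewrite (exprM u); apply: (@le_trans _ _ (C' ^+ (K * K') * (C ^+ K * t) ^+ (K' * K'))).
      by rewrite ler_wpM2l ?exprn_ge0// lerXn2r// ?nnegrE// ?mulr_ge0 ?exprn_ge0.
    rewrite !exprMn mulrA -exprM mulnA ler_pM ?mulr_ge0 ?exprn_ge0//.
      rewrite mulrC ler_pM ?exprn_ge0//.
      by rewrite ler_weXn2l// leq_pmulr.
    by apply: ler_iXnr => //; rewrite muln_gt0 K'0.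
  + have {}uv := power_distortion_le1 u0 v0 C'1 K'0 u1 uv.
    rewrite mulnC exprM; apply: (@le_trans _ _ ((C' ^+ K' * u) ^+ K)).
      by rewrite lerXn2r// ?nnegrE ?exprn_ge0// mulr_ge0 ?exprn_ge0.
    rewrite exprMn -exprM; apply: (@le_trans _ _ (C' ^+ (K' * K) * (C ^+ K * t))).
      by rewrite ler_wpM2l ?exprn_ge0.
    rewrite mulrA ler_wpM2r// mulrC exprMn ler_pM ?exprn_ge0//.
      by apply: ler_weXn2l => //; rewrite -mulnA mulnCA leq_pmulr// muln_gt0 K'0.
    by apply: ler_weXn2l => //; rewrite leq_pmulr.
Qed.

End PowerDistortion.

(** * The Euclidean norm *)

Section EuclideanNorm.
Context {R : realType} {d : nat}.
Implicit Types (u v w : 'rV[R]_d) (a : R).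

Definition enorm u : R := Num.sqrt (\sum_i u 0 i ^+ 2).

Lemma euclidean_distE (x y : euclidean R d) :
  euclidean_dist x y = enorm ((x : 'rV[R]_d) - (y : 'rV[R]_d)).
Proof. by congr Num.sqrt; apply: eq_bigr => i _; rewrite !mxE. Qed.

Lemma mdist_enorm (x y : euclidean R d) :
  mdist x y = enorm ((x : 'rV[R]_d) - (y : 'rV[R]_d)).
Proof. exact: euclidean_distE. Qed.

Lemma enorm_ge0 u : 0 <= enorm u.
Proof. exact: sqrtr_ge0. Qed.

Lemma sum_sqr_ge0 u : 0 <= \sum_i u 0 i ^+ 2.
Proof. by apply: sumr_ge0 => i _; exact: sqr_ge0. Qed.

Lemma sqr_enorm u : enorm u ^+ 2 = \sum_i u 0 i ^+ 2.
Proof. by rewrite sqr_sqrtr// sum_sqr_ge0. Qed.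

Lemma enorm0 : enorm 0 = 0.
Proof. by rewrite /enorm big1 ?sqrtr0// => i _; rewrite mxE expr0n. Qed.

Lemma enormN u : enorm (- u) = enorm u.
Proof. by congr Num.sqrt; apply: eq_bigr => i _; rewrite mxE sqrrN. Qed.

Lemma enormB u v : enorm (u - v) = enorm (v - u).
Proof. by rewrite -enormN opprB. Qed.

Lemma enormZ a u : enorm (a *: u) = `|a| * enorm u.
Proof.
rewrite /enorm -sqrtr_sqr -sqrtrM ?sqr_ge0//; congr Num.sqrt.
by rewrite mulr_sumr; apply: eq_bigr => i _; rewrite mxE exprMn.
Qed.

Lemma enormZ_ge0 a u : 0 <= a -> enorm (a *: u) = a * enorm u.
Proof. by move=> a0; rewrite enormZ ger0_norm. Qed.

Lemma enormD u v : enorm (u + v) <= enorm u + enorm v.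
Proof.
have := metric_triangle (u : euclidean R d) (0 : 'rV[R]_d) (- v : 'rV[R]_d).
by rewrite !mdist_enorm/= !opprK subr0 add0r.
Qed.

Lemma enorm_le_via w u v : enorm (u - v) <= enorm (u - w) + enorm (w - v).
Proof. by rewrite (le_trans _ (enormD _ _))// addrA subrK. Qed.

Lemma enorm_le_via2 u v u' v' :
  enorm (u - v) <= enorm (u' - u) + enorm (u' - v') + enorm (v' - v).
Proof.
have := enorm_le_via u' u v; have := enorm_le_via v' u' v.
by rewrite (enormB u u'); lra.
Qed.

Lemma enorm_ge_sub u v : enorm u - enorm v <= enorm (u - v).
Proof. by rewrite lerBlDr (le_trans _ (enormD _ _))// subrK. Qed.

Lemma enorm_eq0 u : (enorm u == 0) = (u == 0).
Proof.
apply/eqP/eqP => [|->]; last exact: enorm0.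
move=> u0; have := @mdist_positivity _ (euclidean R d) u (0 : 'rV[R]_d).
by rewrite mdist_enorm subr0 => /(_ u0).
Qed.

Lemma enorm_gt0 u : (0 < enorm u) = (u != 0).
Proof. by rewrite lt_def enorm_ge0 andbT enorm_eq0. Qed.

Lemma enorm_coord u i : `|u 0 i| <= enorm u.
Proof.
rewrite -sqrtr_sqr ler_wsqrtr// (bigD1 i)//= lerDl.
by apply: sumr_ge0 => j _; exact: sqr_ge0.
Qed.

Lemma enorm_le_sum u : enorm u <= \sum_i `|u 0 i|.
Proof.
rewrite -(@ler_pXn2r _ 2)// ?nnegrE ?enorm_ge0 ?sumr_ge0// sqr_enorm.
rewrite expr2 mulr_suml; apply: ler_sum => i _.
rewrite -real_normK ?num_real// expr2 ler_wpM2l// (bigD1 i)//= lerDl.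
exact: sumr_ge0.
Qed.

Lemma enorm_le_const u a : (forall i, `|u 0 i| <= a) -> enorm u <= d%:R * a.
Proof.
move=> ua; rewrite (le_trans (enorm_le_sum u))//.
rewrite (le_trans (ler_sum _ (fun i _ => ua i)))//.
by rewrite sumr_const card_ord mulr_natl.
Qed.

Definition coord_proj (p : pred 'I_d) u : 'rV[R]_d :=
  \row_i (if p i then u 0 i else 0).

Lemma coord_projB p u v : coord_proj p (u - v) = coord_proj p u - coord_proj p v.
Proof. by apply/rowP => i; rewrite !mxE; case: ifP => _; rewrite ?mxE ?subrr. Qed.

Lemma coord_projD p u v : coord_proj p (u + v) = coord_proj p u + coord_proj p v.
Proof. by apply/rowP => i; rewrite !mxE; case: ifP => _; rewrite ?mxE ?addr0. Qed.

Lemma coord_projZ p a u : coord_proj p (a *: u) = a *: coord_proj p u.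
Proof. by apply/rowP => i; rewrite !mxE; case: ifP => _; rewrite ?mxE ?mulr0. Qed.

Lemma enorm_coord_proj p u : enorm (coord_proj p u) <= enorm u.
Proof.
rewrite ler_wsqrtr//; apply: ler_sum => i _; rewrite mxE.
by case: ifP => _//; rewrite expr0n sqr_ge0.
Qed.

End EuclideanNorm.

Section Geometric.
Variable R : realType.
Implicit Types a b C e l : R.

Lemma geometric_small C e l : 0 <= l -> l <= 2^-1 -> 0 < e ->
  exists N : nat, forall m, (N <= m)%N -> C * l ^+ m <= e.
Proof.
move=> l0 l2 e0; have Ce0 : 0 <= `|C| / e by rewrite divr_ge0// ltW.
exists (Num.bound (`|C| / e)) => m Nm.
have le_m : `|C| / e <= 2 ^+ m.
  apply: (le_trans (ltW (archi_boundP Ce0))).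
  rewrite -natrX ler_nat (leq_trans Nm)// ltnW// ltn_expl//.
apply: (@le_trans _ _ (`|C| * 2^-1 ^+ m)).
  rewrite (le_trans (ler_norm _))// normrM ler_wpM2l// normrX ger0_norm//.
  by rewrite lerXn2r ?nnegrE// invr_ge0.
by rewrite exprVn ler_pdivrMr ?exprn_gt0// mulrC -ler_pdivrMr.
Qed.

(** Inequalities pass to limits with a geometric rate of convergence. *)
Lemma ler_addgeo a b C l (N : nat) : 0 <= l -> l <= 2^-1 ->
  (forall m, (N <= m)%N -> a <= b + C * l ^+ m) -> a <= b.
Proof.
move=> l0 l2 h; apply/ler_addgt0Pr => e e0.
have [M hM] := geometric_small C l0 l2 e0.
rewrite (le_trans (h (maxn N M) (leq_maxl _ _)))// lerD2l.
by rewrite hM// leq_maxr.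
Qed.

End Geometric.

(** * Power quasisymmetric maps *)

Section PowerQuasisymmetric.
Context {R : realType} {d : nat}.
Local Notation E := 'rV[R]_d.
Implicit Types (F G : E -> E) (p q a b : E).

Definition dist_ratio p a b : R := enorm (p - a) / enorm (p - b).

Definition power_qs G := [/\ bijective G &
  exists C K, [/\ 1 <= C, (0 < K)%N & forall p a b, p != b ->
    power_distortion C K (dist_ratio p a b) (dist_ratio (G p) (G a) (G b))]].

Lemma dist_ratio_ge0 p a b : 0 <= dist_ratio p a b.
Proof. by rewrite divr_ge0 ?enorm_ge0. Qed.

Lemma dist_ratio_gt0 p a b : p != a -> p != b -> 0 < dist_ratio p a b.
Proof. by move=> pa pb; rewrite divr_gt0// enorm_gt0 subr_eq0. Qed.

Lemma dist_ratioV p a b : (dist_ratio p a b)^-1 = dist_ratio p b a.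
Proof. by rewrite invf_div. Qed.

Lemma dist_ratio0 p b : dist_ratio p p b = 0.
Proof. by rewrite /dist_ratio subrr enorm0 mul0r. Qed.

(** Exchanging [a] and [b] inverts the ratios on both sides. *)
Lemma power_qs_inv G G' : cancel G G' -> cancel G' G -> power_qs G -> power_qs G'.
Proof.
move=> GK G'K [_ [C [K [C1 K0 h]]]]; split; first by exists G.
exists C, K; split => // p a b pb.
have [->|pa] := eqVneq p a.
  rewrite !dist_ratio0; left; rewrite mulr_ge0 ?exprn_ge0//.
  by apply: le_trans C1.
have G'inj := can_inj G'K.
have hne : G' p != G' a by rewrite (inj_eq G'inj).
have hne' : G' p != G' b by rewrite (inj_eq G'inj).
have := h _ (G' b) _ hne; rewrite !G'K => /power_distortion_inv.
by rewrite !dist_ratioV; apply; apply: dist_ratio_gt0.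
Qed.

Lemma power_qs_comp F G : power_qs F -> power_qs G -> power_qs (F \o G).
Proof.
move=> [bF [C' [K' [C'1 K'0 h']]]] [bG [C [K [C1 K0 h]]]].
split; first exact: bij_comp.
exists ((C * C') ^+ (K * K' * K')), (K * K')%N; split.
- by rewrite exprn_ege1// mulr_ege1.
- by rewrite muln_gt0 K0.
- move=> p a b pb; apply: (power_distortion_trans _ _ _ C1 C'1 K0 K'0 (h _ _ _ pb)).
  + exact: dist_ratio_ge0.
  + exact: dist_ratio_ge0.
  + exact: dist_ratio_ge0.
  + by apply: h'; rewrite (bij_eq bG).
Qed.

Lemma power_qs_bilip c L G : 0 < c -> bijective G ->
  (forall p q, c * enorm (p - q) <= enorm (G p - G q)) ->
  (forall p q, enorm (G p - G q) <= L * enorm (p - q)) -> power_qs G.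
Proof.
move=> c0 bG lo hi; split => //.
exists (Num.max 1 (L / c)), 1%N; split => //; first by rewrite le_max lexx.
move=> p a b pb; left; rewrite expr1.
have pb0 : 0 < enorm (p - b) by rewrite enorm_gt0 subr_eq0.
have L0 : 0 < L.
  have := le_trans (lo p b) (hi p b).
  by rewrite ler_pM2r//; apply: lt_le_trans.
apply: (@le_trans _ _ (L / c * dist_ratio p a b)); last first.
  by rewrite ler_wpM2r ?dist_ratio_ge0// le_max lexx orbT.
rewrite /dist_ratio ler_pdivrMr; last by rewrite (lt_le_trans _ (lo _ _)) ?mulr_gt0.
apply: (le_trans (hi p a)).
have -> : L / c * (enorm (p - a) / enorm (p - b)) * enorm (G p - G b) =
  L * enorm (p - a) * (enorm (G p - G b) / (c * enorm (p - b))).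
  by field; rewrite !gt_eqF.
rewrite ler_peMr ?mulr_ge0 ?enorm_ge0 ?(ltW L0)//.
by rewrite ler_pdivlMr ?mulr_gt0// mul1r; exact: lo.
Qed.

End PowerQuasisymmetric.

(** ** A gauge that is a homeomorphism of the half-line *)

Section Gauge.
Variable R : realType.
Implicit Types (C t y : R) (j : nat).

Lemma iter_sqrt_ge0 j t : 0 <= t -> 0 <= iter j Num.sqrt t.
Proof. by elim: j => //= j IH t0; exact: sqrtr_ge0. Qed.

Lemma iter_sqrtK j t : 0 <= t -> (iter j Num.sqrt t) ^+ (2 ^ j) = t.
Proof.
elim: j t => [|j IH] t t0 //.
by rewrite /= expnS exprM sqr_sqrtr ?iter_sqrt_ge0// IH.
Qed.

Lemma iter_sqrtXK j t : 0 <= t -> iter j Num.sqrt (t ^+ (2 ^ j)) = t.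
Proof.
elim: j t => [|j IH] t t0 //.
by rewrite iterSr expnSr exprM sqrtr_sqr ger0_norm ?exprn_ge0// IH.
Qed.

Lemma ler_iter_sqrt j : {homo iter j (@Num.sqrt R) : s t / s <= t}.
Proof. by elim: j => //= j IH s t st; rewrite ler_wsqrtr// IH. Qed.

Lemma continuous_iter_sqrt j : continuous (iter j (@Num.sqrt R)).
Proof.
elim: j => [|j IH] t /=; first exact: cvg_id.
by apply: continuous_comp; [exact: IH | exact: sqrt_continuous].
Qed.

(** The maximum of two increasing bijections of the half-line has as inverse the
    minimum of their inverses.  The exponents are powers of two, so that the roots
    are iterated square roots. *)
Definition gauge C j t := Num.max (C * t ^+ (2 ^ j)) (iter j Num.sqrt (C * t)).
Definition gauge_inv C j y := Num.min (iter j Num.sqrt (y / C)) (y ^+ (2 ^ j) / C).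

Lemma gauge_ge C j t u : 0 <= t -> 0 <= u -> 0 <= C ->
  power_distortion C (2 ^ j) t u -> u <= gauge C j t.
Proof.
move=> t0 u0 C0; rewrite /gauge le_max => -[->//|h].
by rewrite -(@iter_sqrtXK j u)// (ler_iter_sqrt j h) orbT.
Qed.

Lemma gauge_homeo C j : 0 < C ->
  homeomorphism_on (`[0, +oo[ : set R) (`[0, +oo[ : set R) (gauge C j).
Proof.
move=> C0; have C0' := ltW C0.
have mCK x : C * x / C = x by rewrite mulrC mulKf ?gt_eqF.
have dCK x : C * (x / C) = x by rewrite mulrC divfK ?gt_eqF.
have g0 t : 0 <= t -> 0 <= gauge C j t.
  by move=> t0; rewrite /gauge le_max mulr_ge0 ?exprn_ge0.
have h0 t : 0 <= t -> 0 <= gauge_inv C j t.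
  by move=> t0; rewrite /gauge_inv le_min iter_sqrt_ge0 ?divr_ge0 ?exprn_ge0.
exists (gauge_inv C j); split.
- by move=> t /=; rewrite !in_itv/= !andbT; exact: g0.
- by move=> t /=; rewrite !in_itv/= !andbT; exact: h0.
- move=> t; rewrite inE/= in_itv/= andbT => t0.
  rewrite /gauge /gauge_inv.
  have a0 : 0 <= C * t ^+ (2 ^ j) by rewrite mulr_ge0 ?exprn_ge0.
  have b0 : 0 <= iter j Num.sqrt (C * t) by rewrite iter_sqrt_ge0 ?mulr_ge0.
  apply/eqP; rewrite eq_le ge_min le_min; apply/andP; split; last first.
    apply/andP; split.
      rewrite -{1}(iter_sqrtXK j t0); apply: ler_iter_sqrt.
      by rewrite ler_pdivlMr// mulrC le_max lexx.
    rewrite ler_pdivlMr// mulrC -{1}(@iter_sqrtK j (C * t)) ?mulr_ge0//.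
    by apply: lerXn2r; rewrite ?nnegrE ?le_max ?b0 ?orbT ?lexx ?orbT.
  case: (leP (C * t ^+ (2 ^ j)) (iter j Num.sqrt (C * t))) => ab.
    by rewrite iter_sqrtK ?mulr_ge0// mCK lexx orbT.
  by rewrite mCK iter_sqrtXK// lexx.
- move=> y; rewrite inE/= in_itv/= andbT => y0.
  rewrite /gauge /gauge_inv.
  have a0 : 0 <= iter j Num.sqrt (y / C) by rewrite iter_sqrt_ge0 ?divr_ge0.
  have b0 : 0 <= y ^+ (2 ^ j) / C by rewrite divr_ge0 ?exprn_ge0.
  apply/eqP; rewrite eq_le ge_max le_max; apply/andP; split.
    apply/andP; split.
      rewrite mulrC -ler_pdivlMr// -[leRHS](@iter_sqrtK j (y / C)) ?divr_ge0//.
      by apply: lerXn2r; rewrite ?nnegrE ?le_min ?a0 ?b0 ?ge_min ?lexx.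
    rewrite -[leRHS](iter_sqrtXK j y0); apply: ler_iter_sqrt.
    by rewrite mulrC -ler_pdivlMr// ge_min lexx orbT.
  case: (leP (iter j Num.sqrt (y / C)) (y ^+ (2 ^ j) / C)) => ab.
    by rewrite iter_sqrtK ?divr_ge0// dCK lexx.
  by rewrite dCK iter_sqrtXK// lexx orbT.
- have cX : continuous (fun t : R => t ^+ (2 ^ j)) by move=> t; exact: exprn_continuous.
  split; apply: continuous_subspaceT => t.
  + apply: (@continuous_max _ _ (fun t => C * t ^+ (2 ^ j))
      (fun t => iter j Num.sqrt (C * t))).
      by apply: cvgM; [exact: cvg_cst | exact: cX].
    apply: continuous_comp; last exact: continuous_iter_sqrt.
    by apply: cvgM; [exact: cvg_cst | exact: cvg_id].
  + apply: (@continuous_min _ _ (fun y => iter j Num.sqrt (y / C))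
      (fun y => y ^+ (2 ^ j) / C)).
      apply: continuous_comp; last exact: continuous_iter_sqrt.
      by apply: cvgM; [exact: cvg_id | exact: cvg_cst].
    by apply: cvgM; [exact: cX | exact: cvg_cst].
Qed.

End Gauge.

(** * Shears that move a set along a coordinate subspace *)

Section McShane.
Variables (R : realType) (U : Type) (D : U -> U -> R).
Hypothesis Dxx : forall u, D u u = 0.
Hypothesis Dsym : forall u v, D u v = D v u.
Hypothesis Dtri : forall u v w, D u w <= D u v + D v w.

(** McShane extension: the lower envelope of the cones of slope [L] over the
    prescribed values. *)
Lemma lipschitz_extension (T : Type) (t0 : T) (x : T -> U) (f : T -> R) (L : R) :
  0 <= L -> (forall s t, `|f s - f t| <= L * D (x s) (x t)) ->
  exists2 g : U -> R, forall u v, `|g u - g v| <= L * D u v &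
    forall t, g (x t) = f t.
Proof.
move=> L0 fL; pose A u := range (fun t => f t + L * D u (x t)).
have A0 u : A u !=set0 by exists (f t0 + L * D u (x t0)); exists t0.
have lbA u : has_lbound (A u).
  exists (f t0 - L * D u (x t0)) => _ [t _ <-].
  have h1 : f t0 - f t <= L * D (x t0) (x t) by rewrite (le_trans _ (fL _ _))// ler_norm.
  have h2 : L * D (x t0) (x t) <= L * (D u (x t0) + D u (x t)).
    by rewrite ler_wpM2l// (le_trans (Dtri _ u _))// lerD2r Dsym.
  by rewrite mulrDr in h2; lra.
have infA u : has_inf (A u) by split.
have half u v : inf (A u) - inf (A v) <= L * D u v.
  rewrite lerBlDr -lerBlDl; apply: lb_le_inf => // _ [t _ <-].
  have h1 : inf (A u) <= f t + L * D u (x t) by apply: ge_inf => //; exists t.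
  have h2 : L * D u (x t) <= L * (D u v + D v (x t)) by rewrite ler_wpM2l.
  by rewrite mulrDr in h2; lra.
exists (fun u => inf (A u)) => [u v|t].
  rewrite ler_norml half andbT lerNl opprB Dsym; exact: half.
apply/eqP; rewrite eq_le; apply/andP; split.
  by apply: ge_inf => //; exists t => //; rewrite Dxx mulr0 addr0.
apply: lb_le_inf => // _ [s _ <-]; have := fL t s.
by move/(le_trans (ler_norm _)); lra.
Qed.

End McShane.

Section Shear.
Context {R : realType} {d : nat}.
Local Notation E := 'rV[R]_d.

(** A Lipschitz map [g] that only depends on the coordinates in [I] and only
    moves the others makes [id + g] invertible, with inverse [id - g]. *)
Lemma power_qs_shear (T : Type) (t0 : T) (a b : T -> E) (I : pred 'I_d) (L : R) :
  (forall t, coord_proj I (a t) = coord_proj I (b t)) ->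
  (forall s t, enorm ((b s - a s) - (b t - a t)) <=
               L * enorm (coord_proj I (a s - a t))) ->
  exists2 G : E -> E, power_qs G & forall t, G (a t) = b t.
Proof.
move=> abI abL.
wlog L0 : L abL / 0 <= L.
  move=> /(_ (Num.max 0 L)); apply; last by rewrite le_max lexx.
  move=> s t; rewrite (le_trans (abL s t))// ler_wpM2r ?enorm_ge0//.
  by rewrite le_max lexx orbT.
pose D (u v : E) := enorm (coord_proj I (u - v)).
have Dxx u : D u u = 0 by rewrite /D coord_projB subrr enorm0.
have Dsym u v : D u v = D v u by rewrite /D !coord_projB enormB.
have Dtri u v w : D u w <= D u v + D v w.
  by rewrite /D !coord_projB; exact: enorm_le_via.
have /choice[gg ggP] : forall i : 'I_d, exists g : E -> R,
    (forall u v, `|g u - g v| <= L * D u v) /\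
    (forall t, g (a t) = (b t - a t) 0 i).
  move=> i; have [|g g1 g2] := lipschitz_extension Dxx Dsym Dtri t0
    (x := a) (f := fun t => (b t - a t) 0 i) L0; last by exists g.
  move=> s t; rewrite (le_trans _ (abL s t))//.
  by rewrite (le_trans _ (enorm_coord _ i))// !mxE.
pose g (u : E) : E := \row_i (if I i then 0 else gg i u).
have gL u v : enorm (g u - g v) <= d%:R * L * D u v.
  rewrite -mulrA; apply: enorm_le_const => i; rewrite !mxE.
  have [g1 _] := ggP i; case: ifP => _ //.
  by rewrite subrr normr0 mulr_ge0 ?enorm_ge0.
have ga t : g (a t) = b t - a t.
  apply/rowP => i; rewrite mxE; have [_ g2] := ggP i.
  case: ifP => Ii; last by rewrite g2.
  by have /rowP/(_ i) := abI t; rewrite !mxE Ii => ->; rewrite subrr.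
have gI v : coord_proj I (g v) = 0.
  by apply/rowP => i; rewrite !mxE; case: (I i).
have gD u v : g (u + g v) = g u.
  apply/eqP; rewrite -subr_eq0 -enorm_eq0 eq_le enorm_ge0 andbT.
  by rewrite (le_trans (gL _ _))// /D addrAC subrr add0r gI enorm0 mulr0.
have gB u v : g (u - g v) = g u by rewrite -{2}(subrK (g v) u) gD.
pose M := 1 + d%:R * L.
have M0 : 0 < M by rewrite ltr_pwDl// mulr_ge0.
have DM u v : d%:R * L * D u v <= d%:R * L * enorm (u - v).
  by rewrite ler_wpM2l ?mulr_ge0// enorm_coord_proj.
have hi u v : enorm (u + g u - (v + g v)) <= M * enorm (u - v).
  rewrite opprD addrACA (le_trans (enormD _ _))// mulrDl mul1r lerD2l.
  by rewrite (le_trans (gL _ _)).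
have hi' u v : enorm (u - g u - (v - g v)) <= M * enorm (u - v).
  rewrite [- (v - _)]opprD addrACA (le_trans (enormD _ _))// mulrDl mul1r lerD2l.
  by rewrite -opprD enormN (le_trans (gL _ _)).
have GK : cancel (fun u => u + g u) (fun u => u - g u).
  by move=> u /=; rewrite gD addrK.
have GK' : cancel (fun u => u - g u) (fun u => u + g u).
  by move=> u /=; rewrite gB subrK.
exists (fun u => u + g u); last by move=> t; rewrite ga addrC subrK.
apply: (@power_qs_bilip _ _ M^-1 M); rewrite ?invr_gt0//.
- by exists (fun u => u - g u).
- move=> p q; rewrite mulrC ler_pdivrMr// mulrC.
  by have := hi' (p + g p) (q + g q); rewrite !gD !addrK.
Qed.

End Shear.

(** * Contracting disjoint balls *)

Section RadialContraction.
Context {R : realType} {d : nat}.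
Local Notation E := 'rV[R]_d.
Variables (r : R).
Hypothesis r0 : 0 < r.
Implicit Types (c p q : E) (s t k : R).

(** At distance [s] from the centre the scaling factor is [k] up to the radius
    [r] and [1] beyond the radius [2 * r]. *)
Definition radial_factor k s : R :=
  k + (1 - k) * Num.max 0 (Num.min 1 (s / r - 1)).

Definition radial k c p : E := c + radial_factor k (enorm (p - c)) *: (p - c).

Lemma radial_factor_in k s : s <= r -> radial_factor k s = k.
Proof.
move=> sr; rewrite /radial_factor max_l ?mulr0 ?addr0// ge_min.
by rewrite subr_le0 ler_pdivrMr// mul1r sr orbT.
Qed.

Lemma radial_factor_out k s : 2 * r <= s -> radial_factor k s = 1.
Proof.
move=> sr; rewrite /radial_factor min_l; last by rewrite lerBrDr ler_pdivlMr.
by rewrite max_r// mulr1 addrC subrK.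
Qed.

Lemma radial_factor_homo k : k <= 1 -> {homo radial_factor k : s t / s <= t}.
Proof.
move=> k1 s t st; rewrite lerD2l ler_wpM2l ?subr_ge0//.
rewrite ge_max !le_max lexx/= le_min !ge_min lexx /=; apply/orP; right.
by rewrite lerD2r ler_wpM2r ?invr_ge0 ?(ltW r0)// orbT.
Qed.

Lemma radial_factor_ge k s : k <= 1 -> k <= radial_factor k s.
Proof.
by move=> k1; rewrite lerDl mulr_ge0 ?subr_ge0// le_max lexx.
Qed.

Lemma radial_factor_le1 k s : k <= 1 -> radial_factor k s <= 1.
Proof.
move=> k1; rewrite -lerBrDl -[leRHS]mulr1 ler_wpM2l ?subr_ge0//.
by rewrite ge_max ler01 ge_min lexx.
Qed.

Lemma radial_factor_lip k s t : 0 <= k -> k <= 1 ->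
  `|radial_factor k s - radial_factor k t| <= `|s - t| / r.
Proof.
move=> k0 k1; rewrite /radial_factor.
have -> : `|s - t| / r = `|s / r - t / r|.
  by rewrite -mulrBl normrM (ger0_norm (x := r^-1)) ?invr_ge0 ?ltW.
move: (s / r) (t / r) => x y.
rewrite opprD addrACA subrr add0r -mulrBr normrM ger0_norm ?subr_ge0//.
apply: (@le_trans _ _ `|Num.max 0 (Num.min 1 (x - 1)) - Num.max 0 (Num.min 1 (y - 1))|).
  by rewrite ler_piMl// lerBlDr lerDl.
wlog xy : x y / x <= y.
  have [xy|/ltW yx] := leP x y; first exact.
  by move=> /(_ _ _ yx); rewrite distrC (distrC y).
rewrite (ler0_norm (x := x - y)) ?subr_le0// opprB.
have e01 : Num.max 0 1 = 1 :> R by rewrite max_r.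
case: (leP 1 (x - 1)) => h1; case: (leP 1 (y - 1)) => h2; rewrite ?e01;
  case: (leP 0 (x - 1)) => h3; case: (leP 0 (y - 1)) => h4;
  rewrite ler_norml; apply/andP; split; lra.
Qed.

Lemma radial_in k c p : enorm (p - c) <= r -> radial k c p = c + k *: (p - c).
Proof. by move=> pr; rewrite /radial radial_factor_in. Qed.

Lemma radial_out k c p : 2 * r <= enorm (p - c) -> radial k c p = p.
Proof. by move=> pr; rewrite /radial radial_factor_out// scale1r addrC subrK. Qed.

Lemma radial_contract k c p : 0 <= k -> k <= 1 ->
  enorm (radial k c p - c) <= enorm (p - c).
Proof.
move=> k0 k1; rewrite /radial addrC addKr enormZ ger0_norm; last first.
  exact: le_trans (radial_factor_ge _ k1).
by rewrite ler_piMl ?enorm_ge0// radial_factor_le1.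
Qed.

(** Since the factor increases with the distance to the centre, the farther
    point [p] contributes a term making an acute angle with [p - q]. *)
Lemma radial_lower k c p q : 0 <= k -> k <= 1 ->
  k * enorm (p - q) <= enorm (radial k c p - radial k c q).
Proof.
move=> k0 k1.
wlog pq : p q / enorm (q - c) <= enorm (p - c).
  move=> h; have [?|/ltW ?] := leP (enorm (q - c)) (enorm (p - c)); first exact: h.
  by rewrite enormB (enormB (radial _ _ _)); exact: h.
rewrite /radial; have -> : p - q = (p - c) - (q - c) by rewrite opprB addrA subrK.
move: (p - c) (q - c) pq => u v uv {p q}.
set f := radial_factor k (enorm u); set g := radial_factor k (enorm v).
rewrite opprD addrACA subrr add0r.
have gf : g <= f by exact: radial_factor_homo.
have kg : k <= g by exact: radial_factor_ge.
have g0 : 0 <= g by exact: le_trans kg.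
apply: (@le_trans _ _ (g * enorm (u - v))); first by rewrite ler_wpM2r ?enorm_ge0.
rewrite -(@ler_pXn2r _ 2)// ?nnegrE ?mulr_ge0 ?enorm_ge0// exprMn !sqr_enorm.
have uv2 : \sum_i v 0 i ^+ 2 <= \sum_i u 0 i ^+ 2.
  by rewrite -!sqr_enorm lerXn2r ?nnegrE ?enorm_ge0.
have acute : 0 <= \sum_i (u 0 i - v 0 i) * u 0 i.
  have : 0 <= \sum_i ((u 0 i - v 0 i) ^+ 2).
    by apply: sumr_ge0 => i _; exact: sqr_ge0.
  have -> : \sum_i (u 0 i - v 0 i) ^+ 2 =
    2 * (\sum_i (u 0 i - v 0 i) * u 0 i) + (\sum_i v 0 i ^+ 2 - \sum_i u 0 i ^+ 2).
    by rewrite mulr_sumr -sumrB -big_split; apply: eq_bigr => i _ /=; ring.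
  by move: uv2; lra.
have : \sum_i (f *: u - g *: v) 0 i ^+ 2 = g ^+ 2 * (\sum_i (u - v) 0 i ^+ 2) +
   2 * g * (f - g) * (\sum_i (u 0 i - v 0 i) * u 0 i) +
   (f - g) ^+ 2 * \sum_i u 0 i ^+ 2.
  rewrite !mulr_sumr -!big_split; apply: eq_bigr => i _ /=; rewrite !mxE; ring.
move=> ->; rewrite -addrA lerDl addr_ge0// mulr_ge0 ?sqr_ge0 ?sum_sqr_ge0//.
by rewrite !mulr_ge0// subr_ge0.
Qed.

(** The change of the factor only matters for points at distance at most
    [2 * r] from the centre, where it is controlled by its slope [1 / r]. *)
Lemma radial_upper k c p q : 0 <= k -> k <= 1 ->
  enorm (radial k c p - radial k c q) <= 3 * enorm (p - q).
Proof.
move=> k0 k1.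
wlog pq : p q / enorm (p - c) <= enorm (q - c).
  move=> h; have [?|/ltW ?] := leP (enorm (p - c)) (enorm (q - c)); first exact: h.
  by rewrite enormB (enormB p); exact: h.
rewrite /radial; have -> : p - q = (p - c) - (q - c) by rewrite opprB addrA subrK.
move: (p - c) (q - c) pq => u v uv {p q}.
set f := radial_factor k (enorm u); set g := radial_factor k (enorm v).
rewrite opprD addrACA subrr add0r.
have -> : f *: u - g *: v = g *: (u - v) + (f - g) *: u.
  by apply/rowP => i; rewrite !mxE; ring.
rewrite (le_trans (enormD _ _))// !enormZ.
have -> : 3 * enorm (u - v) = 1 * enorm (u - v) + 2 * enorm (u - v) by ring.
apply: lerD.
  rewrite ler_wpM2r ?enorm_ge0// ger0_norm ?radial_factor_le1//.
  exact: le_trans (radial_factor_ge _ k1).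
have [ur|ur] := leP (2 * r) (enorm u).
  rewrite /f /g !radial_factor_out// ?(le_trans ur)// subrr normr0 mul0r.
  by rewrite mulr_ge0 ?enorm_ge0.
have fg : `|f - g| <= enorm (u - v) / r.
  rewrite (le_trans (radial_factor_lip _ _ k0 k1))// ler_wpM2r ?invr_ge0 ?(ltW r0)//.
  by rewrite ler_norml enorm_ge_sub lerNl opprB enormB enorm_ge_sub.
apply: (@le_trans _ _ (enorm (u - v) / r * (2 * r))).
  by rewrite ler_pM ?enorm_ge0// ltW.
by have -> : enorm (u - v) / r * (2 * r) = 2 * enorm (u - v) by field; rewrite gt_eqF.
Qed.

(** On each ray this is the intermediate value theorem. *)
Lemma radial_surj k c q : 0 <= k -> k <= 1 -> enorm (q - c) <= 2 * r ->
  exists2 p, enorm (p - c) <= 2 * r & radial k c p = q.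
Proof.
move=> k0 k1 qr.
have [qc|qc] := eqVneq (enorm (q - c)) 0.
  have {}qc : q = c by apply/eqP; rewrite -subr_eq0 -enorm_eq0 qc.
  exists c; first by rewrite subrr enorm0 mulr_ge0// ltW.
  by rewrite /radial subrr scaler0 addr0 qc.
have qc0 : 0 < enorm (q - c) by rewrite lt_def qc enorm_ge0.
have cf : continuous (fun s => s * radial_factor k s).
  move=> s; apply: cvgM; first exact: cvg_id.
  apply: cvgD; first exact: cvg_cst.
  apply: cvgM; first exact: cvg_cst.
  apply: (@continuous_max _ _ (fun=> 0) (fun s => Num.min 1 (s / r - 1))).
    exact: cvg_cst.
  apply: (@continuous_min _ _ (fun=> 1) (fun s => s / r - 1)); first exact: cvg_cst.
  apply: cvgB; last exact: cvg_cst.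
  by apply: cvgM; [exact: cvg_id | exact: cvg_cst].
have [|||s sI sE] := @IVT R (fun s => s * radial_factor k s) 0 (2 * r) (enorm (q - c)).
- by rewrite mulr_ge0// ltW.
- exact: continuous_subspaceT.
- rewrite mul0r radial_factor_out// mulr1 min_l ?max_r ?enorm_ge0//.
  + by rewrite mulr_ge0// ltW.
  + by rewrite mulr_ge0// ltW.
move: sI; rewrite in_itv/= => /andP[s0 sr].
have nE : enorm ((s / enorm (q - c)) *: (q - c)) = s.
  by rewrite enormZ_ge0 ?divr_ge0 ?enorm_ge0// divfK.
exists (c + (s / enorm (q - c)) *: (q - c)).
  by rewrite addrC addKr nE.
rewrite /radial [c + _ - c]addrC addKr nE scalerA mulrA [_ * s]mulrC sE.
by rewrite divff// scale1r addrC subrK.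
Qed.

End RadialContraction.

Section Contraction.
Context {R : realType} {d : nat}.
Local Notation E := 'rV[R]_d.
Variables (T : Type) (b : T -> E) (r : R) (kap : T -> R) (kap0 : R).
Hypothesis r0 : 0 < r.
Hypothesis kap0_gt0 : 0 < kap0.
Hypothesis kap0_le : kap0 <= 2^-1.
Hypothesis kap_ge : forall t, kap0 <= kap t.
Hypothesis kap_le : forall t, kap t <= 2^-1.
Hypothesis kapE : forall s t, b s = b t -> kap s = kap t.
Hypothesis sep : forall s t, b s <> b t -> 20 * r <= enorm (b s - b t).
Implicit Types (p q : E) (t : T).

Let kge0 t : 0 <= kap t. Proof. by rewrite (le_trans _ (kap_ge t))// ltW. Qed.
Let kle1 t : kap t <= 1. Proof. by have := kap_le t; lra. Qed.

Lemma same_ball s t p : enorm (p - b s) <= 4 * r -> enorm (p - b t) <= 4 * r ->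
  b s = b t.
Proof.
move=> ps pt; apply: contrapT => /sep.
have := enorm_le_via p (b s) (b t); rewrite (enormB _ p); move: r0; lra.
Qed.

(** The balls of radius [2 * r] are disjoint unless they coincide, so that the
    choice of [t] does not matter. *)
Definition contraction p : E :=
  if pselect (exists t, enorm (p - b t) < 2 * r) is left h
  then let t := projT1 (cid h) in radial r (kap t) (b t) p else p.

Lemma contraction_in t p : enorm (p - b t) <= 2 * r ->
  contraction p = radial r (kap t) (b t) p.
Proof.
move=> pt; rewrite /contraction; case: pselect => [h|h].
  case: (cid h) => s /= ps.
  have e : b s = b t by apply: (@same_ball _ _ p); move: r0; lra.
  by rewrite e (kapE e).
rewrite radial_out//; rewrite leNgt; apply/negP => ?; apply: h; by exists t.
Qed.

Lemma contraction_out p : (forall t, 2 * r <= enorm (p - b t)) -> contraction p = p.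
Proof.
move=> h; rewrite /contraction; case: pselect => // h'; exfalso.
by case: h' => t; rewrite ltNge h.
Qed.

Lemma contraction_ball t p (s : R) : s <= 2 * r -> enorm (p - b t) <= s ->
  enorm (contraction p - b t) <= s.
Proof.
move=> sr ps; rewrite (@contraction_in t) ?(le_trans ps)//.
by rewrite (le_trans (radial_contract _ _ _ _ _)).
Qed.

Lemma contraction_dist p : enorm (contraction p - p) <= 4 * r.
Proof.
have [[t pt]|h] := pselect (exists t, enorm (p - b t) <= 2 * r).
  have := contraction_ball (lexx _) pt.
  have := enorm_le_via (b t) (contraction p) p; rewrite (enormB (b t)); lra.
rewrite contraction_out ?subrr ?enorm0 ?mulr_ge0// ?ltW// => t.
by rewrite leNgt; apply/negP => /ltW pt; apply: h; exists t.
Qed.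

(** Two points moved by the same radial map are covered by its estimates.  Two
    points in different balls are moved by less than half of their distance. *)
Lemma contraction_bilip p q :
  kap0 * enorm (p - q) <= enorm (contraction p - contraction q) <= 3 * enorm (p - q).
Proof.
have radial_case t : contraction p = radial r (kap t) (b t) p ->
    contraction q = radial r (kap t) (b t) q ->
    kap0 * enorm (p - q) <= enorm (contraction p - contraction q) <= 3 * enorm (p - q).
  move=> -> ->; rewrite radial_upper// andbT.
  by rewrite (le_trans _ (radial_lower _ _ _ _ _ _))// ler_wpM2r// enorm_ge0.
have [[s ps]|hp] := pselect (exists t, enorm (p - b t) <= 2 * r).
  have [[t qt]|hq] := pselect (exists t, enorm (q - b t) <= 2 * r).
    have [e|ne] := pselect (b s = b t).
      by apply: (@radial_case s); apply: contraction_in => //; rewrite e.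
    have := sep ne => st.
    have pq16 : 16 * r <= enorm (p - q).
      have := enorm_le_via p (b s) (b t); rewrite (enormB (b s) p).
      have := enorm_le_via q p (b t); lra.
    have p4 := contraction_dist p; have q4 := contraction_dist q.
    have hi : enorm (contraction p - contraction q) <= enorm (p - q) + 8 * r.
      have := enorm_le_via p (contraction p) (contraction q).
      have := enorm_le_via q p (contraction q); rewrite (enormB q); lra.
    have lo : enorm (p - q) <= enorm (contraction p - contraction q) + 8 * r.
      have := enorm_le_via (contraction p) p q.
      have := enorm_le_via (contraction q) (contraction p) q.
      by rewrite (enormB p (contraction p)); lra.
    have : kap0 * enorm (p - q) <= 2^-1 * enorm (p - q).
      by rewrite ler_wpM2r ?enorm_ge0.
    by move=> h; apply/andP; split; move: r0; lra.
  apply: (@radial_case s); first exact: contraction_in.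
  rewrite (radial_out r0); last first.
    by rewrite leNgt; apply/negP => /ltW ?; apply: hq; exists s.
  apply: contraction_out => t.
  by rewrite leNgt; apply/negP => /ltW ?; apply: hq; exists t.
have pE : contraction p = p.
  apply: contraction_out => t.
  by rewrite leNgt; apply/negP => /ltW ?; apply: hp; exists t.
have [[t qt]|hq] := pselect (exists t, enorm (q - b t) <= 2 * r).
  apply: (@radial_case t); last exact: contraction_in.
  rewrite (radial_out r0)//.
  by rewrite leNgt; apply/negP => /ltW ?; apply: hp; exists t.
rewrite pE contraction_out; last first.
  by move=> t; rewrite leNgt; apply/negP => /ltW ?; apply: hq; exists t.
rewrite ler_peMl ?enorm_ge0 ?ler1n// andbT.
by rewrite ler_piMl ?enorm_ge0//; move: kap0_le; lra.
Qed.

Lemma contraction_surj q : exists p, contraction p = q.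
Proof.
have [[t qt]|hq] := pselect (exists t, enorm (q - b t) <= 2 * r).
  have [p pt <-] := radial_surj r0 (kge0 t) (kle1 t) qt.
  by exists p; exact: contraction_in.
exists q; apply: contraction_out => t.
by rewrite leNgt; apply/negP => /ltW ?; apply: hq; exists t.
Qed.

End Contraction.

(** * Nested contractions along a tree of balls *)

Section GeometricLimit.
Variable R : realType.

Lemma nested_intervals (lo hi : nat -> R) :
  (forall m, lo m <= lo m.+1) -> (forall m, hi m.+1 <= hi m) ->
  (forall m, lo m <= hi m) -> exists w, forall m, lo m <= w <= hi m.
Proof.
move=> loS hiS lohi.
have lo_homo : {homo lo : m n / (m <= n)%N >-> m <= n}.
  by apply: homo_leq => // x y z; exact: le_trans.
have hi_homo : {homo hi : m n / (m <= n)%N >-> n <= m}.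
  apply: (@homo_leq _ _ (fun a b => b <= a)) => // x y z xy yz.
  exact: le_trans xy.
have lo_hi m n : lo m <= hi n.
  apply: (le_trans (lo_homo _ _ (leq_maxl m n))).
  exact: (le_trans (lohi _) (hi_homo _ _ (leq_maxr m n))).
have supA : has_sup (range lo).
  by split; [exists (lo 0%N); exists 0%N | exists (hi 0%N) => _ [m _ <-]].
exists (sup (range lo)) => m; apply/andP; split.
  by apply: ub_le_sup; [case: supA | exists m].
by apply: ge_sup => [|_ [k _ <-]//]; case: supA.
Qed.

Lemma geometric_limit (v : nat -> R) (C l : R) :
  0 <= C -> 0 <= l -> l <= 2^-1 ->
  (forall m, `|v m.+1 - v m| <= C * l ^+ m) ->
  exists w, forall m, `|v m - w| <= 2 * C * l ^+ m.
Proof.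
move=> C0 l0 l2 hv.
have Cl m : 0 <= C * l ^+ m by rewrite mulr_ge0 ?exprn_ge0.
have ClS m : C * l ^+ m.+1 <= 2^-1 * (C * l ^+ m).
  by rewrite exprS mulrCA ler_wpM2r.
have step m : v m - C * l ^+ m <= v m.+1 <= v m + C * l ^+ m.
  by rewrite -ler_distl.
have [|||w hw] := @nested_intervals (fun m => v m - 2 * (C * l ^+ m))
    (fun m => v m + 2 * (C * l ^+ m)).
- by move=> m; have /andP[] := step m; have := ClS m; have := Cl m; lra.
- by move=> m; have /andP[] := step m; have := ClS m; have := Cl m; lra.
- by move=> m; have := Cl m; lra.
exists w => m; have /andP[] := hw m; rewrite -mulrA ler_norml => ? ?.
by apply/andP; split; lra.
Qed.

Lemma geometric_limit_rV (d : nat) (u : nat -> 'rV[R]_d) (C l : R) :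
  0 <= C -> 0 <= l -> l <= 2^-1 ->
  (forall m, enorm (u m.+1 - u m) <= C * l ^+ m) ->
  exists w, forall m, enorm (u m - w) <= d%:R * (2 * C) * l ^+ m.
Proof.
move=> C0 l0 l2 hu.
have /choice[w hw] : forall i : 'I_d, exists w, forall m,
    `|u m 0 i - w| <= 2 * C * l ^+ m.
  move=> i; apply: geometric_limit => // m.
  by rewrite (le_trans _ (hu m))// (le_trans _ (enorm_coord _ i))// !mxE.
exists (\row_i w i) => m; rewrite -mulrA; apply: enorm_le_const => i.
by rewrite !mxE; exact: hw.
Qed.

End GeometricLimit.

Section BallTree.
Context {R : realType} {d : nat}.
Local Notation E := 'rV[R]_d.
Variables (T : Type) (t0 : T) (c : nat -> T -> E) (rho lam : R).
Variables (kap : nat -> T -> R) (kap0 : R).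
Implicit Types (p q : E) (i j k m : nat) (x y : T).

Definition radius k := rho * lam ^+ k.
Local Notation r := radius.

Hypothesis rho0 : 0 < rho.
Hypothesis lam0 : 0 < lam.
Hypothesis lam_le : lam <= 32^-1.
Hypothesis kap0_gt0 : 0 < kap0.
Hypothesis kap0_le : kap0 <= 2^-1.
Hypothesis kap_ge : forall k x, kap0 <= kap k x.
Hypothesis kap_le : forall k x, kap k x <= 2^-1.
Hypothesis kapE : forall k x y, c k x = c k y -> kap k x = kap k y.
Hypothesis sep : forall k x y, c k x <> c k y -> 20 * r k <= enorm (c k x - c k y).
Hypothesis nest : forall k x y, c k.+1 x = c k.+1 y -> c k x = c k y.
Hypothesis close : forall k x, enorm (c k.+1 x - c k x) <= r k / 4.

Lemma radius_gt0 k : 0 < r k.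
Proof. by rewrite mulr_gt0// exprn_gt0. Qed.

Lemma radiusS k : r k.+1 <= r k / 32.
Proof.
rewrite /radius exprS mulrCA mulrC ler_wpM2l//.
by rewrite (ltW (radius_gt0 _)).
Qed.

Local Notation level k := (contraction (c k) (r k) (kap k)).

Let level_ball k x p s : s <= 2 * r k -> enorm (p - c k x) <= s ->
  enorm (level k p - c k x) <= s.
Proof.
exact: (contraction_ball (radius_gt0 k) kap0_gt0 (kap_ge k) (kap_le k)
  (@kapE k) (@sep k)).
Qed.

Let level_dist k p : enorm (level k p - p) <= 4 * r k.
Proof.
exact: (contraction_dist (radius_gt0 k) kap0_gt0 (kap_ge k) (kap_le k)
  (@kapE k) (@sep k)).
Qed.

Let level_surj k q : exists p, level k p = q.
Proof.
exact: (contraction_surj (radius_gt0 k) kap0_gt0 (kap_ge k) (kap_le k)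
  (@kapE k) (@sep k)).
Qed.

Let level_in k x p : enorm (p - c k x) <= r k ->
  level k p = c k x + kap k x *: (p - c k x).
Proof.
move=> px; rewrite (contraction_in (radius_gt0 k) (@kapE k) (@sep k) (t := x)).
  by rewrite (radial_in (radius_gt0 k)).
by move: (radius_gt0 k); lra.
Qed.

(** The [m] contractions of the levels from [i] on, the deepest one first: when
    a level is applied, its balls have not been moved by the coarser ones. *)
Fixpoint levels i m p : E := if m is m'.+1 then level i (levels i.+1 m' p) else p.

Lemma levels_cat i m k p : levels i (m + k) p = levels i m (levels (i + m) k p).
Proof.
by elim: m i => [|m IH] i; rewrite ?addn0// addSn /= IH addSnnS.
Qed.

Let same k x y p : enorm (p - c k x) <= 4 * r k -> enorm (p - c k y) <= 4 * r k ->
  c k x = c k y.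
Proof. exact: (same_ball (radius_gt0 k) (@sep k)). Qed.

Lemma child_half k x p : enorm (p - c k.+1 x) <= 2 * r k.+1 ->
  enorm (p - c k x) <= r k / 2.
Proof.
move=> px; have := enorm_le_via (c k.+1 x) p (c k x).
have := close k x; have := radiusS k; have := radius_gt0 k; lra.
Qed.

Lemma levels_fix i m p : (forall x, 2 * r i <= enorm (p - c i x)) ->
  levels i m p = p.
Proof.
elim: m i => [//|m IH] i h /=; rewrite IH; first exact: contraction_out.
move=> x; rewrite leNgt; apply/negP => /ltW /child_half.
by have := h x; have := radius_gt0 i; lra.
Qed.

Lemma ball_dichotomy k p :
  (exists x, enorm (p - c k x) <= 2 * r k) \/ (forall x, 2 * r k <= enorm (p - c k x)).
Proof.
have [?|h] := pselect (exists x, enorm (p - c k x) <= 2 * r k); [by left|right].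
by move=> x; rewrite leNgt; apply/negP => /ltW ?; apply: h; exists x.
Qed.

Lemma levels_stay i m p x s : r i <= s -> s <= 2 * r i -> enorm (p - c i x) <= s ->
  enorm (levels i m p - c i x) <= s /\ enorm (levels i.+1 m p - c i x) <= s.
Proof.
have ri := radius_gt0.
have next i' m' p' x' s' : r i' <= s' -> s' <= 2 * r i' ->
    (forall y, enorm (p' - c i'.+1 y) <= 2 * r i'.+1 ->
       enorm (levels i'.+1 m' p' - c i'.+1 y) <= 2 * r i'.+1) ->
    enorm (p' - c i' x') <= s' -> enorm (levels i'.+1 m' p' - c i' x') <= s'.
  move=> rs s2 h px; case: (ball_dichotomy i'.+1 p') => [[y py]|out]; last first.
    by rewrite levels_fix.
  have h1 := child_half py; have h2 := child_half (h _ py).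
  have -> : c i' x' = c i' y by apply: (@same _ _ _ p'); move: (ri i'); lra.
  by move: (ri i'); lra.
suff stay : forall m i p x s, r i <= s -> s <= 2 * r i -> enorm (p - c i x) <= s ->
    enorm (levels i m p - c i x) <= s.
  move=> rs s2 px; split; first exact: stay.
  apply: next => // y; apply: stay => //; move: (ri i.+1); lra.
elim=> [//|{}m IH] {}i {}p {}x {}s rs s2 px /=.
apply: level_ball => //.
by apply: next => // y; apply: IH => //; move: (ri i.+1); lra.
Qed.

(** Only the balls of level [i + 1] are moved by the deeper levels.  If [p] lies
    in one of them, then it is deep inside a ball of level [i], whereas [q] lies
    outside of that ball. *)
Lemma levels_near i m p q :
  (forall x, ~ (enorm (p - c i x) <= r i /\ enorm (q - c i x) <= r i)) ->
  enorm (levels i.+1 m p - p) <= enorm (p - q) / 4.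
Proof.
move=> h; have ri := radius_gt0.
case: (ball_dichotomy i.+1 p) => [[x px]|out]; last first.
  by rewrite levels_fix// subrr enorm0 divr_ge0 ?enorm_ge0.
have [||px' _] := @levels_stay i.+1 m p x (2 * r i.+1) _ _ px; [|by []|].
  by move: (ri i.+1); lra.
have phalf := child_half px.
have qfar : r i < enorm (q - c i x).
  rewrite ltNge; apply/negP => qx; apply: (h x); split => //; move: (ri i); lra.
have := enorm_le_via p q (c i x); rewrite (enormB q p).
have := enorm_le_via (c i.+1 x) (levels i.+1 m p) p; rewrite (enormB (c i.+1 x) p).
by have := radiusS i; move: (ri i); lra.
Qed.

(** Up to a small perturbation the two points are only moved by level [i]. *)
Lemma levels_bilip i m p q :
  (forall x, ~ (enorm (p - c i x) <= r i /\ enorm (q - c i x) <= r i)) ->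
  kap0 / 2 * enorm (p - q) <= enorm (levels i m p - levels i m q)
    <= 9 / 2 * enorm (p - q).
Proof.
move=> h; have pq0 := enorm_ge0 (p - q); case: m => [|m] /=.
  have : kap0 * enorm (p - q) <= 2^-1 * enorm (p - q) by rewrite ler_wpM2r.
  by move=> ?; apply/andP; split; lra.
have pn := @levels_near i m p q h.
have qn : enorm (levels i.+1 m q - q) <= enorm (p - q) / 4.
  by rewrite (enormB p q); apply: levels_near => x [? ?]; apply: (h x).
have := contraction_bilip (radius_gt0 i) kap0_gt0 kap0_le (kap_ge i) (kap_le i)
  (@kapE i) (@sep i) (levels i.+1 m p) (levels i.+1 m q).
move: (levels i.+1 m p) (levels i.+1 m q) pn qn => p1 q1 pn qn /andP[lo hi].
have h1 : enorm (p1 - q1) <= 3 / 2 * enorm (p - q).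
  have := enorm_le_via p p1 q1; have := enorm_le_via q p q1.
  rewrite (enormB q q1); lra.
have h2 : kap0 * (enorm (p - q) / 2) <= kap0 * enorm (p1 - q1).
  rewrite ler_pM2l//; have := enorm_le_via p1 p q; have := enorm_le_via q1 p1 q.
  rewrite (enormB p p1); lra.
by apply/andP; split; lra.
Qed.

(** The ball of level [j - 1] around the centre of [x]; at level [0] there is
    no constraint, so that any two points lie in a common ball. *)
Definition in_ball j x p : Prop :=
  if j is j'.+1 then enorm (p - c j' x) <= r j' else True.

Definition scaling j x : R := \prod_(i < j) kap i x.

Lemma in_ball_pred j x p : in_ball j.+1 x p -> in_ball j x p.
Proof.
case: j => [//|j] /= h; have ri := radius_gt0.
have /child_half : enorm (p - c j.+1 x) <= 2 * r j.+1 by move: (ri j.+1); lra.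
by move: (ri j); lra.
Qed.

Lemma in_ball_le i j x p : (i <= j)%N -> in_ball j x p -> in_ball i x p.
Proof.
move=> /subnK <-; elim: (j - i)%N => [//|k IH].
by rewrite addSn => /in_ball_pred.
Qed.

Lemma nest_le i j x y : (i <= j)%N -> c j x = c j y -> c i x = c i y.
Proof.
move=> /subnK <-; elim: (j - i)%N => [//|k IH].
by rewrite addSn => /nest.
Qed.

Lemma scalingE j x y : (forall k, j = k.+1 -> c k x = c k y) ->
  scaling j x = scaling j y.
Proof.
move=> h; apply: eq_bigr => i _; apply: kapE; case: j i h => [[]//|j] i h.
by apply: nest_le (h _ erefl); rewrite -ltnS.
Qed.

Lemma in_ball_scalingE j x y p : in_ball j x p -> in_ball j y p ->
  scaling j x = scaling j y.
Proof.
move=> px py; apply: scalingE => k jk; move: px py; rewrite jk /= => px py.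
by apply: (@same _ _ _ p); move: (radius_gt0 k); lra.
Qed.

Lemma scaling_gt0 j x : 0 < scaling j x.
Proof. by apply: prodr_gt0 => i _; apply: lt_le_trans (kap_ge _ _). Qed.

Lemma scalingS j x : scaling j.+1 x = scaling j x * kap j x.
Proof. by rewrite /scaling big_ord_recr. Qed.

Lemma scaling_le i j x : (i <= j)%N -> scaling j x <= scaling i x.
Proof.
move=> /subnK <-; elim: (j - i)%N => [//|k IH]; rewrite addSn.
rewrite scalingS (le_trans _ IH)// ler_piMr//.
  exact: ltW (scaling_gt0 _ _).
by have := kap_le (k + i) x; lra.
Qed.

Lemma scaling_ge i k x : scaling i x * kap0 ^+ k <= scaling (i + k) x.
Proof.
elim: k => [|k IH]; first by rewrite addn0 mulr1.
rewrite addnS scalingS exprSr mulrA.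
have s0 := ltW (scaling_gt0 i x); have k0 := ltW kap0_gt0.
by rewrite ler_pM// mulr_ge0 ?exprn_ge0.
Qed.

(** On a ball of level [j - 1] the first [j] contractions act as a single
    similarity. *)
Lemma levels_similar j m x p q : in_ball j x p -> in_ball j x q ->
  levels 0 (j + m) p - levels 0 (j + m) q = scaling j x *: (levels j m p - levels j m q).
Proof.
move=> px qx; rewrite /scaling -(big_mkord predT (kap^~ x)).
suff gen : forall k i, in_ball (i + k) x p -> in_ball (i + k) x q ->
    levels i (k + m) p - levels i (k + m) q =
    (\prod_(i <= l < i + k) kap l x) *: (levels (i + k) m p - levels (i + k) m q).
  by rewrite gen ?add0n.
elim=> [|k IH] i; first by rewrite !addn0 big_geq// scale1r.
move=> px' qx'; have ik : (i < i + k.+1)%N by rewrite addnS ltnS leq_addr.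
rewrite (big_ltn ik).
have ri := radius_gt0 i.
have ball' p' : in_ball (i + k.+1) x p' -> enorm (levels i.+1 (k + m) p' - c i x) <= r i.
  move=> /(in_ball_le ik) /= h.
  by have [||_] := @levels_stay i (k + m) p' x (r i) _ _ h => //; lra.
rewrite addSn /= !(@level_in _ x) ?ball'// opprD addrACA subrr add0r -scalerBr opprB addrA subrK.
by have := IH i.+1; rewrite addSnnS => ->//; rewrite scalerA.
Qed.

(** The first level at which the two points do not share a ball. *)
Definition split_at j x p q :=
  [/\ in_ball j x p, in_ball j x q &
      forall y, ~ (in_ball j.+1 y p /\ in_ball j.+1 y q)].

Lemma radius_small e : 0 < e -> exists N, forall k, (N <= k)%N -> r k <= e.
Proof. by move=> e0; apply: geometric_small => //; [exact: ltW | move: lam_le; lra]. Qed.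

Lemma split_exists p q : p != q -> exists j x, split_at j x p q.
Proof.
move=> pq; have e0 : 0 < enorm (p - q) / 3.
  by rewrite divr_gt0// enorm_gt0 subr_eq0.
pose P j := `[< forall y, ~ (in_ball j.+1 y p /\ in_ball j.+1 y q) >].
have exP : exists j, P j.
  have [N hN] := radius_small e0; exists N; apply/asboolP => y [/= py qy].
  have := hN N (leqnn _); have := enorm_le_via (c N y) p q.
  by rewrite (enormB (c N y) q); move: e0; lra.
exists (ex_minn exP); case: ex_minnP => j /asboolP hj hmin.
case: j hj hmin => [|j] hj hmin; first by exists t0.
have /asboolPn/existsNP[y /contrapT[py qy]] : ~~ P j.
  by apply/negP => /hmin; rewrite ltnn.
by exists y.
Qed.

Lemma levels_cauchy p : exists w, forall m,
  enorm (levels 0 m p - w) <= d%:R * (2 * (4 * rho)) * lam ^+ m.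
Proof.
apply: geometric_limit_rV; [move: rho0; lra|exact: ltW|move: lam_le; lra|] => m.
have -> : levels 0 m.+1 p = levels 0 m (level m p).
  by have := levels_cat 0 m 1 p; rewrite addn1 add0n.
have -> : 4 * rho * lam ^+ m = 4 * r m by rewrite /radius mulrA.
have ri := radius_gt0.
case: (ball_dichotomy m p) => [[x px]|out]; last first.
  by rewrite contraction_out// subrr enorm0 mulr_ge0// ltW.
have sub p' : enorm (p' - c m x) <= 2 * r m -> in_ball m x p'.
  by case: m {px} => [//|m] /child_half /=; move: (ri m); lra.
have := levels_similar 0 (sub _ (level_ball (lexx _) px)) (sub _ px).
rewrite !addn0 => ->; rewrite enormZ_ge0 ?(ltW (scaling_gt0 _ _))//=.
apply: le_trans (level_dist m p); rewrite ler_piMl ?enorm_ge0//.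
by have := scaling_le x (leq0n m); rewrite {2}/scaling big_ord0.
Qed.

(** ** The limit map *)

Section Limit.
Variable S : E -> E.
Let A : R := d%:R * (2 * (4 * rho)).
Hypothesis SP : forall p m, enorm (levels 0 m p - S p) <= A * lam ^+ m.

Let lam2 : lam <= 2^-1. Proof. by move: lam_le; lra. Qed.

Let lim_upper p q (b : R) N :
  (forall m, (N <= m)%N -> enorm (levels 0 m p - levels 0 m q) <= b) ->
  enorm (S p - S q) <= b.
Proof.
move=> h; apply: (@ler_addgeo _ _ _ (2 * A) lam N (ltW lam0) lam2) => m Nm.
have := enorm_le_via (levels 0 m p) (S p) (S q).
have := enorm_le_via (levels 0 m q) (levels 0 m p) (S q).
rewrite (enormB (S p) (levels 0 m p)) -mulrA.
by have := SP p m; have := SP q m; have := h _ Nm; lra.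
Qed.

Let lim_lower I p q (b : R) N :
  (forall m, (N <= m)%N -> b <= enorm (coord_proj I (levels 0 m p - levels 0 m q))) ->
  b <= enorm (coord_proj I (S p - S q)).
Proof.
move=> h; apply: (@ler_addgeo _ _ _ (2 * A) lam N (ltW lam0) lam2) => m Nm.
apply: (le_trans (h _ Nm)).
have -> : levels 0 m p - levels 0 m q =
  (S p - S q) + ((levels 0 m p - S p) - (levels 0 m q - S q)).
  by apply/rowP => i; rewrite !mxE; ring.
rewrite coord_projD (le_trans (enormD _ _))// lerD2l.
rewrite (le_trans (enorm_coord_proj _ _))// (le_trans (enormD _ _))// enormN.
by rewrite -mulrA; have := SP p m; have := SP q m; lra.
Qed.

Let coord_projT u : coord_proj predT u = u :> E.
Proof. by apply/rowP => i; rewrite mxE. Qed.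

Lemma limit_bilip j x p q : split_at j x p q ->
  scaling j x * (kap0 / 2) * enorm (p - q) <= enorm (S p - S q)
    <= scaling j x * (9 / 2) * enorm (p - q).
Proof.
move=> [px qx h]; have s0 := ltW (scaling_gt0 j x).
have key m : scaling j x * (kap0 / 2) * enorm (p - q) <=
    enorm (levels 0 (j + m) p - levels 0 (j + m) q)
    <= scaling j x * (9 / 2) * enorm (p - q).
  rewrite (levels_similar m px qx) enormZ_ge0// -!mulrA.
  have /andP[lo hi] := @levels_bilip j m p q h.
  by apply/andP; split; rewrite ler_wpM2l// mulrA.
apply/andP; split.
  rewrite -[S p - S q]coord_projT; apply: (@lim_lower _ _ _ _ j) => m jm.
  by rewrite coord_projT -(subnKC jm); have /andP[] := key (m - j)%N.
apply: (@lim_upper _ _ _ j) => m jm.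
by rewrite -(subnKC jm); have /andP[] := key (m - j)%N.
Qed.

Lemma limit_lipschitz p q : enorm (S p - S q) <= 9 / 2 * enorm (p - q).
Proof.
have [->|/split_exists[j [x h]]] := eqVneq p q.
  by rewrite !subrr enorm0 mulr0.
have /andP[_ h1] := limit_bilip h; apply: (le_trans h1).
rewrite ler_wpM2r ?enorm_ge0// ler_piMl//.
by have := scaling_le x (leq0n j); rewrite {2}/scaling big_ord0.
Qed.

Lemma limit_injective : injective S.
Proof.
move=> p q pq; have [//|ne] := eqVneq p q.
have [j [x h]] := split_exists ne; have /andP[lo _] := limit_bilip h.
move: ne; rewrite -subr_eq0 -enorm_gt0 => e.
by move: lo; rewrite pq subrr enorm0 leNgt !mulr_gt0// ?scaling_gt0// invr_gt0.
Qed.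

Lemma levels_surj i m q : exists p, levels i m p = q.
Proof.
elim: m i q => [|m IH] i q; first by exists q.
by have [p1 <-] := level_surj i q; have [p <-] := IH i.+1 p1; exists p.
Qed.

(** Points that leave the balls at a finite level are reached by a finite
    composition; the other ones are limits of points of [S (a T)]. *)
Lemma limit_surjective (a : T -> E) :
  (forall k x, enorm (a x - c k x) <= r k) ->
  (forall q, (forall e, 0 < e -> exists x, enorm (S (a x) - q) < e) ->
             exists x, S (a x) = q) ->
  forall q, exists p, S p = q.
Proof.
move=> ac closed_image q.
have /choice[p pP] m := levels_surj 0 m q.
have [[m out]|hin] := pselect (exists m, forall x, 2 * r m <= enorm (p m - c m x)).
  exists (p m); apply/eqP; rewrite -subr_eq0 -enorm_eq0 eq_le enorm_ge0 andbT.
  apply: (@ler_addgeo _ _ _ A lam m (ltW lam0) lam2) => k mk; rewrite add0r.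
  have := SP (p m) k; rewrite -(subnKC mk) levels_cat add0n (levels_fix _ out) pP.
  by rewrite enormB.
have [x <-] : exists x, S (a x) = q; last by exists (a x).
apply: closed_image => e e0.
have [N hN] := geometric_small (A + 27 * rho) (ltW lam0) lam2 (divr_gt0 e0 (ltr0Sn R 1)).
have [x px] : exists x, enorm (p N - c N x) <= 2 * r N.
  by case: (ball_dichotomy N (p N)) => // out; exfalso; apply: hin; exists N.
exists x; have := SP (p N) N; rewrite pP => h1.
have h2 := limit_lipschitz (a x) (p N).
have := enorm_le_via (c N x) (a x) (p N); rewrite (enormB (c N x)) => h3.
have := enorm_le_via (S (p N)) (S (a x)) q; rewrite (enormB (S (p N)) q) => h4.
have h5 := ac N x; have rN := radius_gt0 N.
have := hN N (leqnn _); rewrite mulrDl -[27 * rho * _]mulrA -/(radius N) => h6.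
by lra.
Qed.

Let ratio_bound (Mb sg sg' al be Aa Bb : R) : 0 < Mb -> 0 < sg' -> 0 <= al -> 0 < be ->
  Aa <= sg * (9 / 2) * al -> sg' * (kap0 / 2) * be <= Bb -> sg <= Mb * sg' ->
  Aa / Bb <= Mb * (9 / kap0) * (al / be).
Proof.
move=> M0 s0 al0 be0 hA hB hs.
have B0 : 0 < Bb by rewrite (lt_le_trans _ hB)// !mulr_gt0// invr_gt0.
rewrite ler_pdivrMr//; apply: (le_trans hA).
apply: (@le_trans _ _ (Mb * sg' * (9 / 2) * al)).
  by rewrite ler_wpM2r// ler_wpM2r//; lra.
have -> : Mb * sg' * (9 / 2) * al =
  Mb * (9 / kap0) * (al / be) * (sg' * (kap0 / 2) * be).
  by field; rewrite !gt_eqF.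
by rewrite ler_wpM2l// !mulr_ge0 ?invr_ge0// ltW.
Qed.

(** Around [p] the map scales distances by the factor of the level at which the
    other point splits from [p].  If [b] splits later than [a], then the factor
    for [b] is smaller by a power of [kap0], whereas the distance to [b] is
    smaller by the same power of [lam]; this gives the exponent [L]. *)
Lemma limit_power_qs : bijective S -> power_qs S.
Proof.
move=> bS; split => //.
have [L hL] := geometric_small 1 (ltW lam0) lam2 kap0_gt0.
have {hL} hL : lam ^+ L <= kap0 by have := hL L (leqnn _); rewrite mul1r.
pose C0 : R := 9 / kap0 ^+ 2 * 4 ^+ L.
have k2 : 1 <= 1 / kap0 by rewrite ler_pdivlMr// mul1r; move: kap0_le; lra.
have C0E : 9 / kap0 / kap0 <= C0.
  rewrite /C0 expr2 invfM mulrA ler_peMr//; last by rewrite exprn_ege1//; lra.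
  by rewrite !mulr_ge0// invr_ge0 ltW.
have C01 : 9 / kap0 <= C0.
  rewrite (le_trans _ C0E)// -[leLHS]mulr1 ler_wpM2l//.
    by rewrite mulr_ge0// invr_ge0 ltW.
  by rewrite -[kap0^-1]mul1r.
have C1 : 1 <= C0 by rewrite (le_trans k2)// (le_trans _ C01)// ler_pM2r ?invr_gt0//; lra.
have C0K : C0 <= C0 ^+ L.+1 by apply: ler_eXnr.
have C00 : 0 <= C0 by lra.
exists (C0 ^+ L.+1), L.+1; split => //; first exact: exprn_ege1.
move=> p a b pb; rewrite /dist_ratio.
set t := enorm (p - a) / _; set u := enorm (S p - S a) / _.
have u0 : 0 <= u by rewrite divr_ge0 ?enorm_ge0.
have tge0 : 0 <= t by rewrite divr_ge0 ?enorm_ge0.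
suff : u <= C0 * t \/ u <= C0 * t ^+ L.+1.
  case=> h; last by left; rewrite (le_trans h)// ler_wpM2r ?exprn_ge0.
  by apply: (@power_distortion_mono _ C0 1) => //; left.
have [pa|pa] := eqVneq p a.
  by left; rewrite /u pa subrr enorm0 mul0r mulr_ge0.
have b0 : 0 < enorm (p - b) by rewrite enorm_gt0 subr_eq0.
have a0 : 0 < enorm (p - a) by rewrite enorm_gt0 subr_eq0.
have [j [x sa]] := split_exists pa; have [i [y sb]] := split_exists pb.
have /andP[_ hA] := limit_bilip sa; have /andP[hB _] := limit_bilip sb.
have sy := scaling_gt0 i y.
have [pjx _ aout] := sa; have [piy biy _] := sb.
have [ij|ji] := leqP i j.
  left; apply: (@le_trans _ _ (1 * (9 / kap0) * t)).
    apply: (ratio_bound ltr01 sy (ltW a0) b0 hA hB); rewrite mul1r.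
    have -> : scaling i y = scaling i x.
      by apply: (in_ball_scalingE piy); apply: in_ball_le pjx.
    exact: scaling_le.
  by rewrite mul1r ler_wpM2r.
have sjE : scaling j x = scaling j y.
  by apply: (in_ball_scalingE pjx); apply: in_ball_le piy; exact: ltnW.
pose k := (i - j.+1)%N; have iE : i = (j + k.+1)%N by rewrite addnS -addSn subnKC.
have hs : scaling j x <= (kap0 ^+ k.+1)^-1 * scaling i y.
  by rewrite mulrC ler_pdivlMr ?exprn_gt0// sjE iE; exact: scaling_ge.
have kk0 : 0 < (kap0 ^+ k.+1)^-1 by rewrite invr_gt0 exprn_gt0.
have uk := ratio_bound kk0 sy (ltW a0) b0 hA hB hs.
have [k0|k0] := eqVneq k 0%N.
  left; apply: (le_trans uk); rewrite k0 expr1 ler_wpM2r// mulrC.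
  exact: le_trans C0E.
right; apply: (le_trans uk).
have p_half : enorm (p - c j y) <= r j / 2.
  apply: child_half; have : in_ball j.+2 y p.
    by apply: in_ball_le piy; rewrite iE addnS -addn1 -addSn leq_add2l lt0n.
  by move=> /=; have := radius_gt0 j.+1; lra.
have a_far : r j / 2 <= enorm (p - a).
  have : r j < enorm (a - c j y).
    rewrite ltNge; apply/negP => ay; apply: (aout y); split => //=.
    by have := radius_gt0 j; lra.
  by have := enorm_le_via p a (c j y); rewrite (enormB a p); lra.
have b_near : enorm (p - b) <= 2 * (r j * lam ^+ k).
  have -> : r j * lam ^+ k = r (j + k) by rewrite /radius exprD mulrA.
  move: piy biy; rewrite iE addnS /= => h1 h2.
  by have := enorm_le_via (c (j + k) y) p b; rewrite (enormB (c _ y) b); lra.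
have tk : (lam ^+ k)^-1 <= 4 * t.
  rewrite /t mulrA ler_pdivlMr// mulrC ler_pdivrMr ?exprn_gt0//.
  apply: (le_trans b_near); rewrite mulrA ler_wpM2r ?exprn_ge0 ?(ltW lam0)//; lra.
have kapk : (kap0 ^+ k)^-1 <= (4 * t) ^+ L.
  apply: (@le_trans _ _ ((lam ^+ k)^-1 ^+ L)).
    rewrite exprVn lef_pV2 ?posrE ?exprn_gt0// -exprM mulnC exprM.
    by rewrite lerXn2r// ?nnegrE ?exprn_ge0 ?ltW.
  have t4 : 0 <= 4 * t by apply: mulr_ge0.
  by rewrite lerXn2r// ?nnegrE ?invr_ge0 ?exprn_ge0// ltW.
have -> : C0 * t ^+ L.+1 = (4 * t) ^+ L * (kap0^-1 * (9 / kap0)) * t.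
  have fieldE (k0' z w s : R) : k0' != 0 ->
    9 / k0' ^+ 2 * z * (s * w) = z * w * (k0'^-1 * (9 / k0')) * s.
    by move=> ?; field.
  by rewrite /C0 [(4 * t) ^+ L]exprMn [t ^+ _]exprS fieldE// gt_eqF.
have -> : kap0 ^- k.+1 * (9 / kap0) = kap0 ^- k * (kap0^-1 * (9 / kap0)).
  by rewrite exprSr invfM !mulrA.
by rewrite ler_wpM2r// ler_wpM2r// !mulr_ge0// invr_ge0 ltW.
Qed.

(** The images of two points lying in different balls of level [j] are
    separated in every coordinate projection that separates the centres, since
    level [j] squeezes each ball to a small part of the distance of the
    centres. *)
Lemma limit_separation (I : pred 'I_d) (delta : R) j x y p q :
  in_ball j x p -> in_ball j x q ->
  enorm (p - c j x) <= r j -> enorm (q - c j y) <= r j ->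
  kap j x <= delta / 4 -> kap j y <= delta / 4 ->
  delta * r j <= enorm (coord_proj I (c j x - c j y)) ->
  scaling j x * (delta / 2 * r j) <= enorm (coord_proj I (S p - S q)).
Proof.
move=> px qx pj qj kx ky sepI; have rj := radius_gt0 j.
apply: (@lim_lower _ _ _ _ j.+1) => m jm.
have [k ->] : exists k, m = (j + k.+1)%N by exists (m - j.+1)%N; rewrite addnS -addSn subnKC.
rewrite (levels_similar k.+1 px qx) coord_projZ enormZ_ge0 ?(ltW (scaling_gt0 _ _))//.
rewrite ler_wpM2l ?(ltW (scaling_gt0 _ _))//=.
have squeeze z p' : enorm (p' - c j z) <= r j -> kap j z <= delta / 4 ->
    enorm (level j (levels j.+1 k p') - c j z) <= delta / 4 * r j.
  move=> pz kz; have [||_ st] := @levels_stay j k p' z (r j) _ _ pz => //; first lra.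
  have kz0 : 0 <= kap j z by rewrite (le_trans _ (kap_ge j z))// ltW.
  rewrite (level_in st) addrC addKr enormZ_ge0//.
  by rewrite ler_pM ?enorm_ge0.
have hp := squeeze x p pj kx; have hq := squeeze y q qj ky.
move: (level j (levels j.+1 k p)) (level j (levels j.+1 k q)) hp hq => p1 q1 hp hq.
have : enorm (coord_proj I (c j x - c j y)) <=
    enorm (coord_proj I (p1 - q1)) + (enorm (p1 - c j x) + enorm (q1 - c j y)).
  have -> : c j x - c j y = (p1 - q1) + ((q1 - c j y) - (p1 - c j x)).
    by apply/rowP => i; rewrite !mxE; ring.
  rewrite coord_projD (le_trans (enormD _ _))// lerD2l.
  rewrite (le_trans (enorm_coord_proj _ _))// (le_trans (enormD _ _))// enormN.
  by rewrite addrC.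
lra.
Qed.

End Limit.

(** The points [a x] are the ends of the tree.  Two of them that split at level
    [j] have images at distance comparable to [scaling j x * r j]. *)
Theorem ball_tree_contraction (a : T -> E) :
  (forall k x, enorm (a x - c k x) <= r k) ->
  (forall (S : E -> E) L, (forall p q, enorm (S p - S q) <= L * enorm (p - q)) ->
     forall q, (forall e, 0 < e -> exists x, enorm (S (a x) - q) < e) ->
     exists x, S (a x) = q) ->
  exists2 S : E -> E, power_qs S &
    forall j x y, (forall k, j = k.+1 -> c k x = c k y) -> c j x <> c j y ->
      enorm (S (a x) - S (a y)) <= scaling j x * (9 / 2) * enorm (a x - a y) /\
      forall (I : pred 'I_d) (delta : R), kap j x <= delta / 4 -> kap j y <= delta / 4 ->
        delta * r j <= enorm (coord_proj I (c j x - c j y)) ->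
        scaling j x * (delta / 2 * r j) <= enorm (coord_proj I (S (a x) - S (a y))).
Proof.
move=> ac closed_image; have /choice[S SP] := levels_cauchy.
have bS : bijective S.
  have /choice[S' S'K] := limit_surjective SP ac
    (closed_image S _ (limit_lipschitz SP)).
  exists S' => // p; exact: (limit_injective SP (S'K _)).
exists S; first exact: limit_power_qs.
move=> j x y jk cxy.
have px : in_ball j x (a x) by case: (j) => //= k; exact: ac.
have py : in_ball j x (a y).
  by case: j jk {cxy px} => //= k /(_ _ erefl) ->; exact: ac.
split; last by move=> I delta; apply: limit_separation => //; exact: ac.
have /(limit_bilip SP)/andP[] // : split_at j x (a x) (a y).
split => // z [/= h1 h2]; apply: cxy.
have rj := radius_gt0 j; have h3 := ac j x; have h4 := ac j y.
have e z' : enorm (a z' - c j z) <= r j -> c j z' = c j z.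
  by move=> h; apply: (@same _ _ _ (a z')); have := ac j z'; lra.
by rewrite (e _ h1) (e _ h2).
Qed.

End BallTree.

(** * Chains and uniform disconnectedness *)

Section Chain.
Variables (R : realType) (T : Type) (D : T -> T -> R).
Implicit Types (e : R) (x y z : T).

(** Connectedness by finitely many steps shorter than [e], expressed as
    membership in every step-closed set that contains the starting point. *)
Definition chain e x y := forall A : T -> Prop,
  A x -> (forall u v, A u -> D u v < e -> A v) -> A y.

Definition chain_bounded (c : R) :=
  forall r x y, 0 < r -> chain (r / c) x y -> D x y <= r.

Lemma chain_refl e x : chain e x x.
Proof. by []. Qed.

Lemma chain_trans e y x z : chain e x y -> chain e y z -> chain e x z.
Proof. by move=> xy yz A Ax h; apply: yz => //; exact: xy. Qed.

Lemma chain_step e x y : D x y < e -> chain e x y.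
Proof. by move=> xy A Ax h; exact: h xy. Qed.

Lemma chain_sym e x y : (forall u v, D u v = D v u) -> chain e x y -> chain e y x.
Proof.
move=> Dsym xy; apply: (xy (chain e ^~ x)) => [|u v ux uv]; first exact: chain_refl.
by apply: chain_trans ux; apply: chain_step; rewrite Dsym.
Qed.

Lemma chain_mono e e' x y : e <= e' -> chain e x y -> chain e' x y.
Proof.
move=> ee xy A Ax h; apply: (xy A Ax) => u v Au uv.
exact: (h u v Au (lt_le_trans uv ee)).
Qed.

End Chain.

Definition perfect_dist (R : realType) (T : Type) (D : T -> T -> R) (c : R) :=
  forall x r, 0 < r -> (exists y, r <= D x y) ->
    exists z, r / c <= D x z /\ D x z < r.

Lemma chain_bounded_map (R : realType) (T T' : Type) (D : T -> T -> R)
    (D' : T' -> T' -> R) (g : T -> T') (c : R) :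
  (forall x y, D x y = D' (g x) (g y)) -> chain_bounded D' c -> chain_bounded D c.
Proof.
move=> DE D'c r x y r0 xy; rewrite DE; apply: D'c => //.
apply: (xy (fun z => chain D' (r / c) (g x) (g z))); first exact: chain_refl.
by move=> u v xu; rewrite DE => uv; apply: chain_trans xu _; exact: chain_step.
Qed.

(** * Separating the pieces of a set by one additional coordinate *)

Section Pieces.
Context {R : realType} {d : nat}.
Local Notation E := 'rV[R]_d.
Variables (T : Type) (t0 : T) (a : T -> E) (I : pred 'I_d) (j0 : 'I_d).
Hypothesis Ij0 : I j0 = false.
Hypothesis aI : forall x, coord_proj I (a x) = a x.
Let D x y := enorm (a x - a y).
Variables (c rho lam : R).
Hypothesis c1 : 1 <= c.
Hypothesis rho0 : 0 < rho.
Hypothesis lam0 : 0 < lam.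
Hypothesis Dc : chain_bounded D c.
Implicit Types (k m : nat) (x y : T).
Local Notation r := (radius rho lam).

Definition gap k : R := r k / (8 * c).
Definition piece k x y := chain D (gap k) x y.

Let c0 : 0 < c. Proof. by rewrite (lt_le_trans _ c1). Qed.
Let Dsym x y : D x y = D y x. Proof. exact: enormB. Qed.
Let r_gt0 k : 0 < r k. Proof. exact: radius_gt0. Qed.

Lemma gap_gt0 k : 0 < gap k.
Proof. by rewrite divr_gt0// mulr_gt0. Qed.

Lemma gap_le k : gap k <= r k / 8.
Proof.
rewrite /gap invfM mulrA ler_piMr ?invf_le1//.
by rewrite divr_ge0// ltW.
Qed.

Lemma piece_dist k x y : piece k x y -> D x y <= r k / 8.
Proof.
move=> h; apply: Dc; first by rewrite divr_gt0.
by apply: chain_mono h; rewrite /gap invfM mulrA.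
Qed.

Lemma piece_sym k x y : piece k x y -> piece k y x.
Proof. exact: chain_sym. Qed.

Lemma not_piece k x y : ~ piece k x y -> gap k <= D x y.
Proof. by move=> h; rewrite leNgt; apply/negP => xy; apply: h; exact: chain_step. Qed.

(** The choice depends on the set only, so that all points of a piece have the
    same representative. *)
Definition some_point (P : T -> Prop) : T :=
  if pselect (exists x, P x) is left h then projT1 (cid h) else t0.

Definition repr k x : T := some_point (piece k x).

Lemma reprP k x : piece k x (repr k x).
Proof.
rewrite /repr /some_point; case: pselect => [h|h]; first by case: (cid h).
by exfalso; apply: h; exists x; exact: chain_refl.
Qed.

Lemma repr_eq k x y : piece k x y -> repr k x = repr k y.
Proof.
move=> xy; congr some_point; apply/funext => z; apply/propext; split => h.
  by apply: chain_trans h; exact: piece_sym.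
exact: chain_trans h.
Qed.

Local Notation b := (fun k x => a (repr k x)).

Lemma repr_close k x : enorm (a x - b k x) <= r k / 8.
Proof. by have := piece_dist (@reprP k x). Qed.

Lemma repr_gap k x y : ~ piece k x y -> gap k <= enorm (b k x - b k y).
Proof.
move=> h; have [h'|/not_piece//] := pselect (piece k (repr k x) (repr k y)).
exfalso; apply: h; apply: chain_trans (@reprP k x) _; apply: chain_trans h' _.
by apply: piece_sym; exact: reprP.
Qed.

(** Points of different pieces of level [k] have representatives in different
    cells of a cubical grid of this mesh. *)
Definition mesh k : R := gap k / (2 * d%:R).

Definition cell k x (i : 'I_d) : int := Num.floor (b k x 0 i / mesh k).

(** The cell up to translations of the grid by multiples of [m.+1]. *)
Definition colour m k x : {ffun 'I_d -> 'I_m.+1} :=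
  [ffun i => inord `|(cell k x i %% m.+1)%Z|%N].

Let d0 : 0 < d%:R :> R.
Proof. by rewrite ltr0n; case: (d) j0 => [[]|]. Qed.

Lemma mesh_gt0 k : 0 < mesh k.
Proof. by rewrite divr_gt0 ?gap_gt0// mulr_gt0. Qed.

(** Cells at distance at most [m] meshes that agree modulo [m.+1] are equal. *)
Lemma colour_piece m k x y : colour m k x = colour m k y ->
  enorm (b k x - b k y) <= m%:R * mesh k -> piece k x y.
Proof.
move=> ceq near; apply: contrapT => /repr_gap; have g0 := mesh_gt0 k.
apply/negP; rewrite -ltNge.
suff : enorm (b k x - b k y) <= d%:R * mesh k.
  move/le_lt_trans; apply.
  have -> : d%:R * mesh k = gap k / 2 by rewrite /mesh; field; rewrite gt_eqF.
  by have := gap_gt0 k; lra.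
apply: enorm_le_const => i; rewrite !mxE.
have near_i : `|b k x 0 i / mesh k - b k y 0 i / mesh k| <= m%:R.
  rewrite -mulrBl normrM [X in _ * X]ger0_norm ?invr_ge0 ?(ltW g0)//.
  rewrite ler_pdivrMr// (le_trans _ near)// (le_trans _ (enorm_coord _ i))//.
  by rewrite !mxE.
have cell_eq : cell k x i = cell k y i.
  have /ffunP/(_ i) := ceq; rewrite !ffunE => /(congr1 (@nat_of_ord _)).
  have lt_mod z : (`|(cell k z i %% m.+1)%Z|%N < m.+1)%N.
    by rewrite -ltz_nat gez0_abs ?modz_ge0// ltz_pmod.
  rewrite !inordK// => /(congr1 Posz); rewrite !gez0_abs ?modz_ge0// => /eqP.
  rewrite eqz_mod_dvd => dv.
  have /andP[x1 x2] := floor_itv (b k x 0 i / mesh k).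
  have /andP[y1 y2] := floor_itv (b k y 0 i / mesh k).
  have /andP[n1 n2] : - m%:R <= b k x 0 i / mesh k - b k y 0 i / mesh k <= m%:R.
    by rewrite -ler_norml.
  have mE : (m.+1%:Z)%:~R = m%:R + 1 :> R by rewrite natr1.
  move: x1 x2 y1 y2; rewrite -!/(cell k _ i) !intrD => x1 x2 y1 y2.
  have h1 : cell k x i - cell k y i < m.+1%:Z.
    by rewrite -(ltr_int R) mE intrB; lra.
  have h2 : cell k y i - cell k x i < m.+1%:Z.
    by rewrite -(ltr_int R) mE intrB; lra.
  have [//|ne] := eqVneq (cell k x i) (cell k y i).
  have := dvdn_leq _ dv; rewrite absz_gt0 subr_eq0 ne => /(_ isT).
  by rewrite leqNgt -ltz_nat abszE ltr_norml ltrNl opprB h1 h2.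
have /andP[x1 x2] := floor_itv (b k x 0 i / mesh k).
have /andP[y1 y2] := floor_itv (b k y 0 i / mesh k).
move: x1 x2 y1 y2; rewrite -!/(cell k _ i) cell_eq !intrD => x1 x2 y1 y2.
suff : `|b k x 0 i / mesh k - b k y 0 i / mesh k| <= 1.
  rewrite -mulrBl normrM [X in _ * X]ger0_norm ?invr_ge0 ?(ltW g0)//.
  by rewrite ler_pdivrMr// mul1r.
by rewrite ler_norml; apply/andP; split; lra.
Qed.

Lemma colour_eq m k x y : piece k x y -> colour m k x = colour m k y.
Proof.
by move=> /repr_eq xy; apply/ffunP => i; rewrite !ffunE /cell xy.
Qed.

(** The modulus is such that pieces of the same colour are either equal or at
    distance at least [20 * r k]. *)
Definition modulus : nat := Num.bound (320 * c * d%:R).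
Definition colours : nat := #|{ffun 'I_d -> 'I_modulus.+1}|.

Lemma modulus_mesh k : 20 * r k <= modulus%:R * mesh k.
Proof.
have p320 : 0 < 320 :> R by rewrite ltr0n.
have cd0 := (mulr_gt0 (mulr_gt0 p320 c0) d0); rewrite -/ (mulr_gt0 (mulr_gt0 p320 c0) d0).
have := ltW (archi_boundP (ltW cd0)); rewrite -/modulus => h.
apply: (@le_trans _ _ (320 * c * d%:R * mesh k)); last first.
  by apply: ler_wpM2r h; apply: ltW; exact: mesh_gt0.
rewrite le_eqVlt; apply/orP; left; apply/eqP; rewrite /mesh /gap; field.
by rewrite !gt_eqF.
Qed.

Hypothesis lam_small : lam <= (960 * colours%:R)^-1.

Let colours0 : 1 <= colours%:R :> R.
Proof. by rewrite ler1n; apply/card_gt0P; exists [ffun=> ord0]. Qed.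

Let lamC : 960 * colours%:R * lam <= 1.
Proof.
have p960 : 0 < 960 :> R by rewrite ltr0n.
have C0 : 0 < 960 * colours%:R :> R.
  exact: (mulr_gt0 p960 (lt_le_trans ltr01 colours0)).
by rewrite mulrC -ler_pdivlMr// mul1r.
Qed.

Lemma ratio_le32 : lam <= 32^-1.
Proof.
apply: (le_trans lam_small); have := colours0 => C1.
by rewrite lef_pV2 ?posrE; lra.
Qed.

Let rS k : r k.+1 <= r k / 32.
Proof. exact: (radiusS rho0 lam0 ratio_le32). Qed.

Definition colour_index k x : nat := enum_rank (colour modulus k x).

Lemma colour_index_lt k x : (colour_index k x)%:R <= colours%:R :> R.
Proof. by rewrite ler_nat ltnW// ltn_ord. Qed.

(** Pieces of one level that are close to each other have different colours;
    their heights are then far apart at the scale of the level. *)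
Definition height k x : R := \sum_(i < k.+1) 30 * r i * (colour_index i x)%:R.

Lemma heightS k x : height k.+1 x = height k x + 30 * r k.+1 * (colour_index k.+1 x)%:R.
Proof. by rewrite /height big_ord_recr. Qed.

Lemma heightS_dist k x : `|height k.+1 x - height k x| <= rho / 32 * lam ^+ k.
Proof.
have r30 : 0 <= 30 * r k.+1 by rewrite mulr_ge0// ltW// r_gt0.
rewrite heightS addrC addKr ger0_norm; last exact: mulr_ge0.
apply: (@le_trans _ _ (30 * r k.+1 * colours%:R)).
  by rewrite ler_wpM2l ?colour_index_lt.
have -> : 30 * r k.+1 * colours%:R = (960 * colours%:R * lam) * (rho / 32 * lam ^+ k).
  by rewrite /radius exprS; field.
by rewrite ler_piMl ?lamC// mulr_ge0 ?divr_ge0 ?exprn_ge0// ltW.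
Qed.

Lemma piece_pred k x y : piece k.+1 x y -> piece k x y.
Proof.
apply: chain_mono; rewrite /gap ler_wpM2r//; first by rewrite invr_ge0 mulr_ge0// ltW.
by have := rS k; have := r_gt0 k; lra.
Qed.

Lemma piece_le i k x y : (i <= k)%N -> piece k x y -> piece i x y.
Proof.
move=> /subnK <-; elim: (k - i)%N => [//|l IH].
by rewrite addSn => /piece_pred.
Qed.

Lemma colour_index_eq k x y : piece k x y -> colour_index k x = colour_index k y.
Proof. by move=> xy; rewrite /colour_index (@colour_eq _ _ x y). Qed.

Lemma height_eq k x y : piece k x y -> height k x = height k y.
Proof.
move=> xy; apply: eq_bigr => i _; rewrite (@colour_index_eq _ x y)//.
by apply: piece_le xy; rewrite -ltnS.
Qed.

Lemma height_split k x y : (forall i, k = i.+1 -> piece i x y) ->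
  height k x - height k y =
  30 * r k * ((colour_index k x)%:R - (colour_index k y)%:R).
Proof.
case: k => [_|k same]; first by rewrite /height !big_ord_recr !big_ord0 /= !add0r mulrBr.
by rewrite !heightS (height_eq (same _ erefl)); ring.
Qed.

Lemma first_split x y :
  (forall k, piece k x y) \/
  exists k, (forall i, k = i.+1 -> piece i x y) /\ ~ piece k x y.
Proof.
have [?|/existsNP nall] := pselect (forall k, piece k x y); [by left|right].
have exP : exists k, `[< ~ piece k x y >].
  by case: nall => k /asboolP; exists k.
exists (ex_minn exP); case: ex_minnP => k /asboolP npk kmin; split => // i ki.
apply: contrapT => /asboolP/kmin; by rewrite ki ltnn.
Qed.

Definition vertical : E := delta_mx 0 j0.

Lemma vertical_proj : coord_proj I vertical = 0.
Proof.
apply/rowP => i; rewrite !mxE eqxx /=; case: eqP => [->|_]; first by rewrite Ij0.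
by case: (I i).
Qed.

Lemma enorm_vertical : enorm vertical = 1.
Proof.
rewrite /enorm (bigD1 j0)//= big1 => [|i /negbTE ij]; rewrite !mxE ?ij ?eqxx ?andbF ?expr0n//.
by rewrite expr1n addr0 sqrtr1.
Qed.

Lemma enorm_vertical_ge u z s : u = coord_proj I u -> z = coord_proj I z ->
  `|s| <= enorm (u - z + s *: vertical).
Proof.
move=> uI zI; apply: le_trans (enorm_coord _ j0).
by rewrite !mxE !eqxx mulr1 uI zI !mxE Ij0 subrr add0r.
Qed.

Definition centre k x : E := b k x + height k x *: vertical.

Lemma centre_proj k x y : coord_proj I (centre k x - centre k y) = b k x - b k y.
Proof.
have bI z : coord_proj I (a z) = a z by exact: aI.
rewrite /centre opprD addrACA coord_projD coord_projB !bI -scalerBl coord_projZ.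
by rewrite vertical_proj scaler0 addr0.
Qed.

Lemma centre_eq k x y : piece k x y -> centre k x = centre k y.
Proof. by move=> xy; rewrite /centre (repr_eq xy) (height_eq xy). Qed.

Lemma centre_inj k x y : centre k x = centre k y -> piece k x y.
Proof.
move=> xy; have [//|/repr_gap] := pselect (piece k x y).
rewrite -(centre_proj k x y) xy subrr.
have -> : coord_proj I (0 : E) = 0 by apply/rowP => i; rewrite !mxE; case: (I i).
by rewrite enorm0 leNgt gap_gt0.
Qed.

Lemma centre_close k x : enorm (centre k.+1 x - centre k x) <= r k / 4.
Proof.
rewrite /centre opprD addrACA -scalerBl (le_trans (enormD _ _))//.
rewrite enormZ enorm_vertical mulr1.
have := heightS_dist k x; have -> : rho / 32 * lam ^+ k = r k / 32 by rewrite /radius; field.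
have h1 := repr_close k x; have h2 := repr_close k.+1 x.
have := enorm_le_via (a x) (b k.+1 x) (b k x); rewrite (enormB (b k.+1 x) (a x)).
by have := rS k; have := r_gt0 k; lra.
Qed.

(** At the first level where the pieces differ they have the same height up to
    the contribution of this level, so that either the representatives are far
    apart or the heights are.  This persists at the deeper levels because the
    centres move little. *)
Lemma centre_sep k x y : centre k x <> centre k y ->
  20 * r k <= enorm (centre k x - centre k y).
Proof.
have level_sep l : (forall i, l = i.+1 -> piece i x y) -> ~ piece l x y ->
    20 * r l <= enorm (centre l x - centre l y).
  move=> same npc.
  have [far|near] := leP (20 * r l) (enorm (b l x - b l y)).
    by rewrite (le_trans far)// -centre_proj enorm_coord_proj.
  have ne : colour_index l x != colour_index l y.
    apply/eqP => /ord_inj/enum_rank_inj/colour_piece h; apply: npc; apply: h.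
    by rewrite (le_trans (ltW near))// modulus_mesh.
  have hE := height_split same.
  rewrite /centre opprD addrACA -scalerBl.
  apply: le_trans (enorm_vertical_ge _ (esym (aI _)) (esym (aI _))).
  have ge1 : 1 <= `|(colour_index l x)%:R - (colour_index l y)%:R| :> R.
    by rewrite !pmulrn -intrB -intr_norm ler1z -gtz0_ge1 normr_gt0 subr_eq0 eqz_nat.
  have r30 : 0 <= 30 * r l by rewrite mulr_ge0// ltW// r_gt0.
  rewrite hE normrM ger0_norm//; have := ler_wpM2l r30 ge1; rewrite mulr1.
  by have := r_gt0 l; lra.
elim: k => [|k IH] ne.
  by apply: level_sep => // h; apply: ne; exact: centre_eq.
have [e|/IH far] := pselect (centre k x = centre k y).
  apply: level_sep => [i [<-]|h]; first exact: centre_inj.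
  by apply: ne; exact: centre_eq.
have cx := centre_close k x; have cy := centre_close k y.
move: far cx cy (enorm_le_via2 (centre k x) (centre k y) (centre k.+1 x) (centre k.+1 y)).
move: (centre k x) (centre k y) (centre k.+1 x) (centre k.+1 y) => u v u' v'.
by have := rS k; have := r_gt0 k; lra.
Qed.

Lemma height_limit : exists phi : T -> R,
  forall x k, `|height k x - phi x| <= r k / 16.
Proof.
suff /choice[phi h] x : exists w, forall k, `|height k x - w| <= r k / 16 by exists phi.
have [||||w hw] := @geometric_limit R (height ^~ x) (rho / 32) lam.
- by rewrite divr_ge0// ltW.
- exact: ltW.
- by move: ratio_le32; lra.
- by move=> k; exact: heightS_dist.
exists w => k; rewrite (le_trans (hw k))// /radius le_eqVlt; apply/orP; left.
by apply/eqP; field.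
Qed.

Definition height_slope : R := 8 * c * (30 * colours%:R + 1).

Lemma height_slope_ge0 : 0 <= height_slope.
Proof.
exact: (mulr_ge0 (mulr_ge0 (ler0n R 8) (ltW c0))
  (addr_ge0 (mulr_ge0 (ler0n R 30) (ler0n R colours)) ler01)).
Qed.

(** Points that first differ at level [k] have distance at least [gap k], and
    heights that differ by at most a multiple of [r k]. *)
Lemma height_limit_lipschitz (phi : T -> R) :
  (forall x k, `|height k x - phi x| <= r k / 16) ->
  forall x y, `|phi x - phi y| <= height_slope * D x y.
Proof.
move=> hphi x y.
have phi_le k : `|phi x - phi y| <= `|height k x - height k y| + r k / 8.
  have -> : phi x - phi y = (height k x - height k y) +
      ((height k y - phi y) - (height k x - phi x)) by ring.
  rewrite (le_trans (ler_normD _ _))// lerD2l (le_trans (ler_normB _ _))//.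
  by have := hphi x k; have := hphi y k; lra.
have L0 := height_slope_ge0.
have [all_pieces|[k [same npc]]] := first_split x y.
  apply: (@le_trans _ _ 0); last by rewrite mulr_ge0// enorm_ge0.
  have lam2 : lam <= 2^-1 by move: ratio_le32; lra.
  apply: (@ler_addgeo _ _ _ (rho / 8) lam 0 (ltW lam0) lam2) => k _.
  have := phi_le k; rewrite (height_eq (all_pieces k)) subrr normr0 !add0r /radius.
  by rewrite mulrAC.
apply: (le_trans (phi_le k)); rewrite (height_split same).
have D_ge : r k <= 8 * c * D x y.
  have := not_piece npc; rewrite /gap ler_pdivrMr ?mulr_gt0//.
  by rewrite mulrC.
apply: (@le_trans _ _ ((30 * colours%:R + 1) * r k)); last first.
  have M0 := addr_ge0 (mulr_ge0 (ler0n R 30) (ler0n R colours)) ler01.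
  rewrite /height_slope (_ : _ * _ * D x y = (30 * colours%:R + 1) * (8 * c * D x y)).
    exact: ler_wpM2l M0 _ _ D_ge.
  by ring.
have r30 : 0 <= 30 * r k by rewrite mulr_ge0// ltW// r_gt0.
rewrite normrM (ger0_norm r30).
have : `|(colour_index k x)%:R - (colour_index k y)%:R| <= colours%:R :> R.
  have := colour_index_lt k x; have := colour_index_lt k y.
  have := ler0n R (colour_index k x); have := ler0n R (colour_index k y).
  by rewrite ler_norml; move=> *; apply/andP; split; lra.
by move/(ler_wpM2l r30); have := r_gt0 k; lra.
Qed.

Section Weights.
Variables (B kap0 : R) (tau : nat -> T -> R).
Hypothesis DB : forall x y, D x y <= B.
Hypothesis closed_image : forall (z : T -> E) L,
  (forall x y, enorm (z x - z y) <= L * D x y) ->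
  forall q, (forall e, 0 < e -> exists x, enorm (z x - q) < e) -> exists x, z x = q.
Hypothesis kap0_gt0 : 0 < kap0.
Hypothesis tau0 : forall x, tau 0%N x = 1.
Hypothesis tau_ge : forall k x, kap0 * lam * tau k x <= tau k.+1 x.
Hypothesis tau_le : forall k x, tau k.+1 x <= (32 * c)^-1 * lam * tau k x.
Hypothesis tau_eq : forall k x y, piece k x y -> tau k.+1 x = tau k.+1 y.

Lemma tau_gt0 k x : 0 < tau k x.
Proof.
elim: k => [|k IH]; first by rewrite tau0.
by rewrite (lt_le_trans _ (tau_ge _ _))// !mulr_gt0.
Qed.

(** The image of [a] under the shear by the height is contracted with the factors
    that turn the radius [r k] into a multiple of [tau k].  The bound on [tau]
    makes the contraction so strong that the images remain separated after the
    projection to the coordinates in [I]. *)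
Lemma weighted_embedding : exists2 G : E -> E, power_qs G &
  exists c' C' : R, [/\ 0 < c', 0 < C' & forall k x y,
    (forall i, k = i.+1 -> piece i x y) -> ~ piece k x y ->
    c' * tau k x <= enorm (coord_proj I (G (a x) - G (a y))) /\
    enorm (G (a x) - G (a y)) <= C' * tau k x].
Proof.
have [phi hphi] := height_limit; have phi_lip := height_limit_lipschitz hphi.
have L0 := height_slope_ge0; move: height_slope L0 phi_lip => L L0 phi_lip.
pose y x := a x + phi x *: vertical.
have yB s t : y s - y t = (a s - a t) + (phi s - phi t) *: vertical.
  by rewrite /y opprD addrACA -scalerBl.
have y_lip s t : enorm (y s - y t) <= (1 + L) * D s t.
  rewrite yB (le_trans (enormD _ _))// mulrDl mul1r lerD2l.
  by rewrite enormZ enorm_vertical mulr1; exact: phi_lip.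
have y_close k x : enorm (y x - centre k x) <= r k / 2.
  have -> : y x - centre k x = (a x - b k x) + (phi x - height k x) *: vertical.
    by rewrite /y /centre opprD addrACA -scalerBl.
  rewrite (le_trans (enormD _ _))// enormZ enorm_vertical mulr1 distrC.
  by have := repr_close k x; have := hphi x k; have := r_gt0 k; lra.
have [||H Hqs Hy] := @power_qs_shear R d T t0 a y I L.
- move=> x; rewrite /y coord_projD coord_projZ vertical_proj scaler0 addr0.
  by [].
- move=> s t; have yaE z : y z - a z = phi z *: vertical by rewrite /y addrC addKr.
  rewrite !yaE -scalerBl enormZ enorm_vertical mulr1.
  by rewrite coord_projB !aI; exact: phi_lip.
pose kap k x := tau k.+1 x / (tau k x * lam).
have tl0 k x : 0 < tau k x * lam by rewrite mulr_gt0// tau_gt0.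
have kap_ge k x : kap0 <= kap k x.
  by rewrite ler_pdivlMr// (mulrC (tau k x)) mulrA.
have kap_le k x : kap k x <= (32 * c)^-1.
  by rewrite ler_pdivrMr// (mulrC (tau k x)) mulrA.
have sq2 : (32 * c)^-1 <= 2^-1 :> R.
  by rewrite lef_pV2 ?posrE; move: c1; lra.
have kapE k x z : centre k x = centre k z -> kap k x = kap k z.
  move=> /centre_inj xz; rewrite /kap (tau_eq xz); congr (_ / (_ * _)).
  by case: k xz => [_|k /piece_pred/tau_eq//]; rewrite !tau0.
have nest k x z : centre k.+1 x = centre k.+1 z -> centre k x = centre k z.
  by move=> /centre_inj/piece_pred; exact: centre_eq.
have kap0_le : kap0 <= 2^-1.
  exact: le_trans (le_trans (kap_ge 0%N t0) (kap_le 0%N t0)) sq2.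
have y_ball k x : enorm (y x - centre k x) <= r k.
  by have := y_close k x; have := r_gt0 k; lra.
have y_closed (S : E -> E) M : (forall p q, enorm (S p - S q) <= M * enorm (p - q)) ->
    forall q, (forall e, 0 < e -> exists x, enorm (S (y x) - q) < e) ->
    exists x, S (y x) = q.
  move=> SM; apply: (closed_image (L := `|M| * (1 + L))) => s t.
  rewrite (le_trans (SM _ _))// (le_trans (ler_wpM2r (enorm_ge0 _) (ler_norm M)))//.
  by rewrite -mulrA ler_wpM2l.
have [S Sqs SP] := ball_tree_contraction t0 rho0 lam0 ratio_le32 kap0_gt0 kap0_le kap_ge
  (fun k x => le_trans (kap_le k x) sq2) kapE centre_sep nest centre_close
  y_ball y_closed.
have scalE k x : scaling kap k x * lam ^+ k = tau k x.
  elim: k => [|k IH]; first by rewrite /scaling big_ord0 expr0 mulr1 tau0.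
  rewrite scalingS exprSr mulrACA IH /kap.
  by field; rewrite !gt_eqF// tau_gt0.
have B0 : 0 <= B by rewrite (le_trans _ (DB t0 t0))// enorm_ge0.
have L1 : 0 <= (1 + L) * B by rewrite mulr_ge0// addr_ge0.
exists (S \o H); first exact: power_qs_comp.
exists (rho / (16 * c)), (9 / 2 * ((1 + L) * B + rho / lam)); split.
- by rewrite divr_gt0// mulr_gt0.
- by rewrite mulr_gt0// ltr_wpDl// divr_gt0.
move=> k x x' same npc; rewrite /= !Hy.
have [hi lo] := SP k x x' (fun i ki => centre_eq (same i ki))
  (fun h => npc (centre_inj h)).
have delta4 : (8 * c)^-1 / 4 = (32 * c)^-1 by field; rewrite gt_eqF.
split.
- have : (8 * c)^-1 * r k <= enorm (coord_proj I (centre k x - centre k x')).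
    by rewrite centre_proj mulrC; exact: repr_gap.
  have := lo I (8 * c)^-1; rewrite delta4 => /(_ (kap_le _ _) (kap_le _ _)) h /h.
  apply: le_trans; rewrite -scalE /radius le_eqVlt; apply/orP; left; apply/eqP.
  by field; rewrite gt_eqF.
- apply: (le_trans hi); case: k same {npc hi lo} => [_|k same].
    rewrite /scaling big_ord0 mul1r tau0 mulr1 ler_wpM2l//.
    rewrite (le_trans (y_lip _ _))// (@le_trans _ _ ((1 + L) * B))//.
      by rewrite ler_wpM2l// addr_ge0.
    by rewrite lerDl divr_ge0// ltW.
  have near : enorm (y x - y x') <= r k.
    have h1 := y_close k x; have h2 := y_close k x'.
    rewrite -(centre_eq (same _ erefl)) in h2.
    rewrite (le_trans (enorm_le_via (centre k x) _ _))// (enormB (centre k x)).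
    by rewrite (le_trans (lerD h1 h2))// -splitr.
  have sc0 : 0 <= scaling kap k.+1 x.
    by rewrite ltW// (scaling_gt0 kap0_gt0 kap_ge).
  apply: (@le_trans _ _ (scaling kap k.+1 x * (9 / 2) * r k)).
    by rewrite ler_wpM2l// mulr_ge0.
  rewrite -scalE; apply: (@le_trans _ _
      (9 / 2 * (rho / lam) * (scaling kap k.+1 x * lam ^+ k.+1))).
    rewrite /radius le_eqVlt; apply/orP; left; apply/eqP; rewrite exprS; field.
    by rewrite gt_eqF.
  rewrite ler_wpM2r//; first by rewrite mulr_ge0// exprn_ge0// ltW.
  by rewrite ler_wpM2l// lerDr.
Qed.

End Weights.

End Pieces.

(** * The ternary Cantor set *)

Section Cantor.
Variable R : realType.
Local Notation stage := (cantor_stage R).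
Local Notation C := (ternary_cantor R).
Implicit Types (x y t u v : R) (k l m : nat).

Lemma stage0 x : stage 0 x <-> 0 <= x <= 1.
Proof. by rewrite /= in_itv. Qed.

Lemma stageS k x : stage k.+1 x <->
  exists2 u, stage k u & x = u / 3 \/ x = (u + 2) / 3.
Proof.
split=> [[] [u uk <-]|[u uk [] ->]].
- by exists u => //; left.
- by exists u => //; right.
- by left; exists u.
- by right; exists u.
Qed.

Lemma stage_itv k x : stage k x -> 0 <= x <= 1.
Proof.
elim: k x => [|k IH] x; first by move/stage0.
by move=> /stageS[u /IH/andP[u0 u1] [] ->]; apply/andP; split; lra.
Qed.

Lemma stage_pred k x : stage k.+1 x -> stage k x.
Proof.
elim: k x => [|k IH] x; first by move=> /stage_itv/stage0.
move=> /stageS[u /IH uk h]; apply/stageS; by exists u.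
Qed.

Lemma stage_le k l x : (k <= l)%N -> stage l x -> stage k x.
Proof.
move=> /subnK <-; elim: (l - k)%N => [//|m IH].
by rewrite addSn => /stage_pred.
Qed.

Lemma cantor_itv x : C x -> 0 <= x <= 1.
Proof. by move=> /(_ 0%N I) /stage0. Qed.

Lemma cantor_diff x y : C x -> C y -> `|x - y| <= 1.
Proof.
move=> /cantor_itv/andP[? ?] /cantor_itv/andP[? ?].
by rewrite ler_norml; apply/andP; split; lra.
Qed.

Lemma cantor0 : C 0.
Proof.
move=> k _; elim: k => [|k IH]; first by apply/stage0; rewrite lexx ler01.
by apply/stageS; exists 0 => //; left; rewrite mul0r.
Qed.

Lemma cantor1 : C 1.
Proof.
move=> k _; elim: k => [|k IH]; first by apply/stage0; rewrite ler01 lexx.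
by apply/stageS; exists 1 => //; right; field.
Qed.

Lemma cantor_left u : C u -> C (u / 3).
Proof.
move=> Cu [|k] _; first by have /andP[??] := cantor_itv Cu; apply/stage0; apply/andP; split; lra.
by apply/stageS; exists u; [exact: Cu | left].
Qed.

Lemma cantor_right u : C u -> C ((u + 2) / 3).
Proof.
move=> Cu [|k] _; first by have /andP[??] := cantor_itv Cu; apply/stage0; apply/andP; split; lra.
by apply/stageS; exists u; [exact: Cu | right].
Qed.

(** The side of [1 / 2] on which [x] lies decides the branch at all stages at
    once. *)
Lemma cantor_cases x : C x -> exists2 u, C u & x = u / 3 \/ x = (u + 2) / 3.
Proof.
move=> Cx; have [x2|x2] := ltP x 2^-1.
- exists (3 * x); last by left; field.
  move=> k _; have /stageS[u uk [xE|xE]] := Cx k.+1 I.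
    by have -> : 3 * x = u by rewrite xE; field.
  by have /andP[??] := stage_itv uk; exfalso; lra.
- exists (3 * x - 2); last by right; field.
  move=> k _; have /stageS[u uk [xE|xE]] := Cx k.+1 I.
    by have /andP[??] := stage_itv uk; exfalso; lra.
  by have -> : 3 * x - 2 = u by rewrite xE; field.
Qed.

Definition cantor_point := {t : R | C t}.

Definition cantor_dist (s t : cantor_point) : R := `|sval s - sval t|.

(** Steps shorter than [3^-l] never leave a basic interval of length [3^-l],
    by self-similarity. *)
Lemma cantor_chain l (s t : cantor_point) :
  chain cantor_dist (3^-1 ^+ l) s t -> cantor_dist s t <= 3^-1 ^+ l.
Proof.
elim: l s t => [|l IH] [s Cs] [t Ct].
  by move=> _; rewrite /cantor_dist expr0; exact: cantor_diff.
have [u Cu su] := cantor_cases Cs.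
have [b [b01 suE]] : exists b : R, (b = 0 \/ b = 2) /\ s = (u + b) / 3.
  by case: su => ->; [exists 0 | exists 2]; split; rewrite ?addr0; auto.
pose A (z : cantor_point) := exists2 v : cantor_point,
  chain cantor_dist (3^-1 ^+ l) (exist _ u Cu) v & sval z = (sval v + b) / 3.
have l1 : 3^-1 ^+ l <= 1 :> R by rewrite exprn_ile1 ?invr_ge0// invf_le1// ler1n.
move=> /(_ A) [].
- by exists (exist _ u Cu); [exact: chain_refl|].
- move=> [z Cz] [w Cw] [[v Cv] uv /= zE]; rewrite /cantor_dist /= exprS => zw.
  have [v' Cv' wE] := cantor_cases Cw.
  have wE' : w = (v' + b) / 3.
    have /andP[??] := cantor_itv Cv; have /andP[??] := cantor_itv Cv'.
    move: zw; rewrite zE ltr_norml => /andP[h1 h2].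
    by case: b01 wE h1 h2 => -> [] -> h1 h2 //; rewrite ?addr0//; exfalso; lra.
  exists (exist _ v' Cv') => //; apply: chain_trans uv _; apply: chain_step.
  rewrite /cantor_dist /=; move: zw; rewrite zE wE'.
  have -> : (v + b) / 3 - (v' + b) / 3 = 3^-1 * (v - v') by field.
  by rewrite normrM ger0_norm ?invr_ge0// ltr_pM2l// invr_gt0.
- move=> [v Cv] /IH uv /= tE; move: uv; rewrite /cantor_dist /= suE tE => uv.
  have -> : (u + b) / 3 - (v + b) / 3 = 3^-1 * (u - v) by field.
  by rewrite normrM ger0_norm ?invr_ge0// exprS ler_wpM2l// invr_ge0.
Qed.

Lemma third_power e : 0 < e -> e <= 1 ->
  exists l, 3^-1 ^+ l.+1 < e /\ e <= 3^-1 ^+ l :> R.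
Proof.
move=> e0 e1; have exP : exists l, (3^-1 : R) ^+ l.+1 < e.
  have [||N hN] := @geometric_small R 1 (e / 2) 3^-1 _ _ (divr_gt0 e0 (ltr0Sn R 1)).
  - by rewrite invr_ge0.
  - by rewrite lef_pV2 ?posrE// ler_nat.
  by exists N; have := hN N.+1 (leqnSn _); rewrite mul1r; lra.
exists (ex_minn exP); case: ex_minnP => l lt_l lmin; split => //.
case: l lt_l lmin => [|l] lt_l lmin; first by rewrite expr0.
by rewrite leNgt; apply/negP => /lmin; rewrite ltnn.
Qed.

Lemma cantor_chain_bounded : chain_bounded cantor_dist 3.
Proof.
move=> r s t r0; have [r1|r1] := ltP r 1; last first.
  by move=> _; rewrite (le_trans _ r1)//; exact: cantor_diff (svalP s) (svalP t).
have [l [l1 l2]] := third_power r0 (ltW r1).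
move=> h; rewrite (le_trans _ (ltW l1))//; apply: cantor_chain.
apply: chain_mono h; rewrite exprS; lra.
Qed.

(** At the largest scale one of the end points [0] and [1] will do, and
    self-similarity gives the smaller scales. *)
Lemma cantor_at_distance l x : C x ->
  exists2 z, C z & 3^-1 ^+ l.+1 <= `|x - z| <= 3^-1 ^+ l.
Proof.
elim: l x => [|l IH] x Cx.
  have /andP[x0 x1] := cantor_itv Cx; rewrite expr1 expr0.
  have [xl|xr] := leP x 2^-1.
    by exists 1; [exact: cantor1|rewrite ler0_norm]; try (apply/andP; split); lra.
  by exists 0; [exact: cantor0 | rewrite ger0_norm; [apply/andP; split|]; lra].
have [u Cu xE] := cantor_cases Cx; have [v Cv uv] := IH u Cu.
have scale b : 3^-1 ^+ l.+2 <= `|(u + b) / 3 - (v + b) / 3| <= 3^-1 ^+ l.+1.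
  have -> : (u + b) / 3 - (v + b) / 3 = 3^-1 * (u - v) by field.
  rewrite normrM ger0_norm ?invr_ge0// [_ ^+ l.+2]exprS [X in _ && (_ <= X)]exprS.
  by rewrite !ler_pM2l ?invr_gt0.
case: xE => ->; last by exists ((v + 2) / 3) => //; exact: cantor_right.
by exists (v / 3); [exact: cantor_left | have := scale 0; rewrite !addr0].
Qed.

Lemma cantor_perfect : perfect_dist cantor_dist 9.
Proof.
move=> s r r0 [t rt].
have r1 : r <= 1 by apply: le_trans rt _; exact: cantor_diff (svalP s) (svalP t).
have [l [l1 l2]] := third_power r0 r1.
have [z Cz /andP[z1 z2]] := cantor_at_distance l.+1 (svalP s).
exists (exist _ z Cz); rewrite /cantor_dist /=; split; last exact: le_lt_trans z2 _.
by apply: le_trans z1; rewrite !exprS; lra.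
Qed.

End Cantor.

(** * Coding a tree of pieces by Cantor intervals *)

Section Coding.
Variable R : realType.
Local Notation stage := (cantor_stage R).
Local Notation C := (ternary_cantor R).
Local Notation third l := ((3^-1 : R) ^+ l).

Lemma third_gt0 l : 0 < third l.
Proof. by rewrite exprn_gt0// invr_gt0. Qed.

Lemma third_le1 l : third l <= 1.
Proof. by rewrite exprn_ile1 ?invr_ge0// invf_le1// ler1n. Qed.

Lemma thirdS l : third l.+1 = third l / 3.
Proof. by rewrite exprSr. Qed.

Lemma third_le l k : (l <= k)%N -> third k <= third l.
Proof. by move=> lk; rewrite ler_wiXn2l ?invr_ge0// invf_le1// ler1n. Qed.

(** The interval of length [3^-l] starting at [a] is one of the basic intervals
    that make up stage [l]. *)
Definition basic_interval (a : R) l :=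
  forall m u, stage m u -> stage (l + m) (a + u * third l).

Lemma basic_interval0 : basic_interval 0 0.
Proof. by move=> m u; rewrite expr0 mulr1 !add0r add0n. Qed.

Lemma basic_interval_left a l : basic_interval a l -> basic_interval a l.+1.
Proof.
move=> h m u um; rewrite addSnnS thirdS.
have -> : u * (third l / 3) = u / 3 * third l by rewrite mulrA mulrAC.
by apply: h; apply/stageS; exists u => //; left.
Qed.

Lemma basic_interval_ones a l r : basic_interval a l ->
  basic_interval (a + third l * (1 - third r)) (l + r).
Proof.
move=> h; elim: r => [|r IH]; first by rewrite expr0 subrr mulr0 addr0 addn0.
move=> m u um; rewrite addnS addSnnS.
have -> : a + third l * (1 - third r.+1) + u * third (l + r).+1 =
    a + third l * (1 - third r) + (u + 2) / 3 * third (l + r).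
  by rewrite !thirdS exprD; field.
by apply: IH; apply/stageS; exists u => //; right.
Qed.

(** The Cantor set is covered by [n] cylinders, coded by the words [1^r 0] with
    [r < n - 1] and by [1^(n - 1)]. *)
Lemma cantor_cover n v : C v -> exists r w,
  [/\ (r < n.+1)%N, C w & v = 1 - third r + w * third (r + (r.+1 != n.+1))].
Proof.
elim: n v => [|n IH] v Cv.
  by exists 0%N, v; rewrite expr0 subrr add0r mulr1.
have [u Cu [->|->]] := cantor_cases Cv.
  by exists 0%N, u; split => //; rewrite expr0 subrr add0r expr1.
have [r [w [rn Cw uE]]] := IH u Cu.
exists r.+1, w; split => //; rewrite uE eqSS addSn !thirdS.
by field.
Qed.

Variables (T : Type) (t0 : T) (P : nat -> T -> T -> Prop).
Variables (F : finType) (lab : nat -> T -> F).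
Hypothesis Psym : forall k x y, P k x y -> P k y x.
Hypothesis Ptrans : forall k x y z, P k x y -> P k y z -> P k x z.
Hypothesis Ppred : forall k x y, P k.+1 x y -> P k x y.

(** Belonging to the same piece of level [k - 1], with one piece at level [-1]. *)
Definition siblings k x y := forall i, k = i.+1 -> P i x y.

Hypothesis lab_eq : forall k x y, P k x y -> lab k x = lab k y.
Hypothesis lab_inj : forall k x y, siblings k x y -> lab k x = lab k y -> P k x y.
Hypothesis Psplit : forall k x, exists2 y, siblings k x y & ~ P k x y.
Implicit Types (k l m : nat) (x y : T).

Lemma siblings_sym k x y : siblings k x y -> siblings k y x.
Proof. by move=> h i /h; exact: Psym. Qed.

Lemma siblings_trans k x y z : siblings k x y -> siblings k y z -> siblings k x z.
Proof. by move=> h h' i ki; apply: Ptrans (h _ ki) (h' _ ki). Qed.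

Lemma P_siblings k x y : P k x y -> siblings k x y.
Proof. by case: k => [|k] xy i // [<-]; exact: Ppred. Qed.

(** The pieces inside the parent of a piece are numbered by the ranks of their
    labels, and the piece of rank [r] gets the word [1^r 0], or [1^r] if it is the
    last one. *)
Definition labels k x : {set F} := [set i | `[< exists2 y, siblings k x y & lab k y = i >]].
Definition rank k x : nat := index (lab k x) (enum (labels k x)).
Definition code_length k x : nat := (rank k x + ((rank k x).+1 != #|labels k x|))%N.
Definition depth k x : nat := (\sum_(i < k) code_length i x)%N.
Definition left_end k x : R := \sum_(i < k) third (depth i x) * (1 - third (rank i x)).

Lemma labels_eq k x y : siblings k x y -> labels k x = labels k y.
Proof.
move=> xy; apply/setP => i; rewrite !inE; apply/asboolP/asboolP => -[z xz <-];
  exists z => //; [apply: siblings_trans xz; exact: siblings_sym|].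
exact: siblings_trans xz.
Qed.

Lemma lab_labels k x y : siblings k x y -> lab k y \in labels k x.
Proof. by move=> xy; rewrite inE; apply/asboolP; exists y. Qed.

Lemma P_refl k x : P k x x.
Proof. by have [y xy _] := Psplit k.+1 x; have := xy k erefl => h; apply: Ptrans h (Psym h). Qed.

Lemma lab_labels_self k x : lab k x \in labels k x.
Proof. exact/lab_labels/P_siblings/P_refl. Qed.

Lemma rank_lt k x : (rank k x < #|labels k x|)%N.
Proof. by rewrite cardE index_mem mem_enum lab_labels_self. Qed.

Lemma card_labels k x : (1 < #|labels k x|)%N.
Proof.
have [y xy nxy] := Psplit k x.
apply/card_gt1P; exists (lab k x), (lab k y); split; [|exact: lab_labels|].
  exact: lab_labels_self.
by apply/eqP => /(lab_inj xy).
Qed.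

Lemma code_length_gt0 k x : (0 < code_length k x)%N.
Proof.
rewrite /code_length; case: (rank k x) => [|//]; rewrite add0n lt0b neq_ltn.
by rewrite card_labels.
Qed.

Lemma code_length_le k x : (code_length k x <= #|F|)%N.
Proof.
apply: (@leq_trans #|labels k x|); last exact: max_card.
rewrite /code_length; have := rank_lt k x; case: eqP => _ /=.
  by rewrite addn0; exact: ltnW.
by rewrite addn1.
Qed.

Lemma depthS k x : depth k.+1 x = (depth k x + code_length k x)%N.
Proof. by rewrite /depth big_ord_recr. Qed.

Lemma left_endS k x :
  left_end k.+1 x = left_end k x + third (depth k x) * (1 - third (rank k x)).
Proof. by rewrite /left_end big_ord_recr. Qed.

Lemma depth_ge k x : (k <= depth k x)%N.
Proof.
elim: k => [//|k IH]; rewrite depthS -addn1 leq_add//.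
exact: code_length_gt0.
Qed.

Lemma siblings_coding k x y : siblings k x y ->
  depth k x = depth k y /\ left_end k x = left_end k y.
Proof.
elim: k => [_|k IH xy]; first by rewrite /depth /left_end !big_ord0.
have Pxy := xy k erefl; have sxy := P_siblings Pxy.
have [dE lE] := IH sxy.
have rE : rank k x = rank k y by rewrite /rank (labels_eq sxy) (lab_eq Pxy).
by rewrite !depthS !left_endS /code_length rE (labels_eq sxy) dE lE.
Qed.

Lemma left_end_basic k x : basic_interval (left_end k x) (depth k x).
Proof.
elim: k => [|k IH]; first by rewrite /left_end /depth !big_ord0; exact: basic_interval0.
rewrite left_endS depthS /code_length addnA.
have h := basic_interval_ones (rank k x) IH.
by case: eqP => _ /=; rewrite ?addn0// addn1; exact: basic_interval_left.
Qed.

Lemma code_exists : exists f : T -> R, forall x k,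
  left_end k x <= f x <= left_end k x + third (depth k x).
Proof.
suff /choice[f fP] : forall x, exists w, forall k,
  left_end k x <= w <= left_end k x + third (depth k x) by exists f.
move=> x; apply: nested_intervals => k.
- rewrite left_endS lerDl mulr_ge0 ?(ltW (third_gt0 _))//.
  by rewrite subr_ge0 third_le1.
- rewrite left_endS depthS -addrA lerD2l exprD.
  have : third (code_length k x) <= third (rank k x) by rewrite third_le// leq_addr.
  by move/(ler_wpM2l (ltW (third_gt0 (depth k x)))); lra.
- by rewrite lerDl ltW// third_gt0.
Qed.

Section Code.
Variable f : T -> R.
Hypothesis fP : forall x k, left_end k x <= f x <= left_end k x + third (depth k x).

Lemma code_cantor x : C (f x).
Proof.
move=> k _; apply: (stage_le (depth_ge k x)).
have /andP[f1 f2] := fP x k; have d0 := third_gt0 (depth k x).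
have := @left_end_basic k x 0 ((f x - left_end k x) / third (depth k x)).
rewrite addn0 divfK ?gt_eqF// [left_end k x + _]addrC subrK; apply; apply/stage0.
by rewrite divr_ge0 ?subr_ge0 ?(ltW d0)//= ler_pdivrMr// mul1r lerBlDl.
Qed.

(** The codes of the children of a piece exhaust the cylinder of the piece. *)
Lemma code_dense t k : C t -> exists x, `|f x - t| <= third k.
Proof.
move=> Ct.
suff [x [v Cv tE]] : exists x, exists2 v, C v & t = left_end k x + v * third (depth k x).
  exists x; have /andP[f1 f2] := fP x k; have /andP[v0 v1] := cantor_itv Cv.
  have d0 := ltW (third_gt0 (depth k x)).
  apply: (@le_trans _ _ (third (depth k x))); last by rewrite third_le// depth_ge.
  have : v * third (depth k x) <= third (depth k x) by rewrite ler_piMl.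
  have : 0 <= v * third (depth k x) by rewrite mulr_ge0.
  by rewrite tE ler_norml => *; apply/andP; split; lra.
elim: k => [|k [x [v Cv tE]]].
  by exists t0, t => //; rewrite /left_end /depth !big_ord0 add0r expr0 mulr1.
have nE : #|labels k x| = #|labels k x|.-1.+1 by rewrite prednK// (ltn_trans _ (card_labels k x)).
have [r [w [rn Cw vE]]] := cantor_cover #|labels k x|.-1 Cv.
rewrite -nE in rn vE.
have r_enum : (r < size (enum (labels k x)))%N by rewrite -cardE.
pose i := nth (lab k x) (enum (labels k x)) r.
have : i \in labels k x by rewrite -mem_enum mem_nth.
rewrite inE => /asboolP[y xy yi].
have ry : rank k y = r.
  by rewrite /rank -(labels_eq xy) yi /i index_uniq// enum_uniq.
exists y, w => //; rewrite left_endS depthS /code_length ry -(labels_eq xy).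
have [<- <-] := siblings_coding xy.
by rewrite tE vE !exprD; ring.
Qed.

Lemma code_close k x y : siblings k x y -> `|f x - f y| <= third (depth k x).
Proof.
move=> /siblings_coding[dE lE]; have /andP[x1 x2] := fP x k.
have := fP y k; rewrite -dE -lE => /andP[y1 y2].
by rewrite ler_norml; apply/andP; split; lra.
Qed.

(** Words of different ranks end in cylinders separated by the middle third of
    the last cylinder that contains both of them. *)
Lemma code_dist k x y : siblings k x y -> ~ P k x y ->
  third (depth k x + #|F|) <= `|f x - f y| <= third (depth k x).
Proof.
move=> xy npxy; have [dE lE] := siblings_coding xy.
rewrite code_close// andbT.
have lE' := labels_eq xy.
have rne : rank k x != rank k y.
  apply/eqP; rewrite /rank -lE' => h; apply: npxy; apply: lab_inj => //.
  rewrite -(@nth_index _ (lab k x) (lab k x) (enum (labels k x))) ?mem_enum ?lab_labels_self//.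
  by rewrite h nth_index// mem_enum lab_labels.
have gap x' y' : labels k x' = labels k y' -> depth k x' = depth k y' ->
    left_end k x' = left_end k y' -> (rank k x' < rank k y')%N ->
    third (depth k x' + #|F|) <= f y' - f x'.
  move=> labE depE leftE rk.
  have rn : ((rank k x').+1 < #|labels k x'|)%N.
    by rewrite labE (leq_ltn_trans rk)// rank_lt.
  have /andP[_ x2] := fP x' k.+1; have /andP[y1 _] := fP y' k.+1.
  move: x2 y1; rewrite !left_endS depthS /code_length -depE -leftE.
  rewrite (ltn_eqF rn) addn1 !exprD => x2 y1.
  have D0 := third_gt0 (depth k x').
  have h1 : third (rank k y') <= third (rank k x').+1 by exact: third_le.
  have h2 : third #|F| <= third (rank k x').+1.
    by rewrite third_le// (leq_trans (ltnW rn))// max_card.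
  move: x2 y1 (ler_wpM2l (ltW D0) h1) (ler_wpM2l (ltW D0) h2); rewrite !thirdS; lra.
case: ltngtP rne => // h _.
  by rewrite distrC (le_trans _ (ler_norm _))//; exact: gap.
by rewrite (le_trans _ (ler_norm _))// dE; apply: gap.
Qed.

End Code.

Theorem piece_coding : exists (f : T -> R) (l : nat -> T -> nat),
  [/\ forall x, C (f x),
      forall t k, C t -> exists x, `|f x - t| <= third k,
      forall x, l 0%N x = 0%N,
      forall k x, (l k x < l k.+1 x <= l k x + #|F|)%N &
      forall k x y, siblings k x y ->
        [/\ l k x = l k y, `|f x - f y| <= third (l k x) &
            ~ P k x y -> third (l k x + #|F|) <= `|f x - f y|]].
Proof.
have [f fP] := code_exists; exists f, depth; split.
- exact: code_cantor.
- by move=> t k; exact: code_dense.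
- by move=> x; rewrite /depth big_ord0.
- move=> k x; rewrite depthS -addn1 !leq_add2l code_length_gt0.
  exact: code_length_le.
- move=> k x y xy; split; [by have [] := siblings_coding xy|exact: code_close|].
  by move=> npxy; have /andP[] := code_dist fP xy npxy.
Qed.

End Coding.

(** * Taming a Cantor set with one additional dimension *)

Section Taming.
Context {R : realType} {n : nat}.
Local Notation E := 'rV[R]_n.+1.
Local Notation C := (ternary_cantor R).
Local Notation third l := ((3^-1 : R) ^+ l).
Variables (T : Type) (a : T -> E).
Hypothesis n1 : (1 <= n)%N.
Hypothesis a_last : forall x, a x 0 ord_max = 0.
Let D x y := enorm (a x - a y).
Variables (c c2 B : R) (x0 y0 : T).
Hypothesis c1 : 1 <= c.
Hypothesis c21 : 1 <= c2.
Hypothesis Dc : chain_bounded D c.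
Hypothesis Dperfect : perfect_dist D c2.
Hypothesis D00 : 0 < D x0 y0.
Hypothesis DB : forall x y, D x y <= B.
Hypothesis attained : forall g : T -> R,
  (forall e, 0 < e -> exists2 dl, 0 < dl &
     forall x y, D x y < dl -> `|g x - g y| <= e) ->
  (forall e, 0 < e -> exists x, g x < e) -> exists x, g x <= 0.

Let closed_image (z : T -> E) :
  (forall e, 0 < e -> exists2 dl, 0 < dl &
     forall x y, D x y < dl -> enorm (z x - z y) <= e) ->
  forall q, (forall e, 0 < e -> exists x, enorm (z x - q) < e) -> exists x, z x = q.
Proof.
move=> zc q zq; have [||x zx] := attained (g := fun x => enorm (z x - q)) => //.
  move=> e e0; have [dl dl0 h] := zc e e0; exists dl => // x y /h {}h.
  rewrite ler_norml; apply/andP; split.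
    by have := enorm_le_via (z x) (z y) q; rewrite (enormB (z y) (z x)); lra.
  by have := enorm_le_via (z y) (z x) q; lra.
exists x; apply/eqP; rewrite -subr_eq0 -enorm_eq0 eq_le enorm_ge0.
by rewrite zx.
Qed.

Let lipschitz_closed (z : T -> E) L (D' : T -> T -> R) :
  (forall e, 0 < e -> exists2 dl, 0 < dl & forall x y, D x y < dl -> D' x y <= e) ->
  (forall x y, 0 <= D' x y) ->
  (forall x y, enorm (z x - z y) <= L * D' x y) ->
  forall q, (forall e, 0 < e -> exists x, enorm (z x - q) < e) -> exists x, z x = q.
Proof.
move=> D'c D'0 zL; apply: closed_image => e e0.
have L0 : 0 < `|L| + 1 by rewrite ltr_wpDl.
have [dl dl0 h] := D'c (e / (`|L| + 1)) (divr_gt0 e0 L0).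
exists dl => // x y /h {}h; rewrite (le_trans (zL x y))//.
rewrite ler_pdivlMr// mulrC in h; apply: le_trans h.
by rewrite ler_wpM2r//; have := ler_norm L; lra.
Qed.

Let coordD (p : pred 'I_n.+1) (s : R) i :
  coord_proj p (s *: delta_mx 0 i : E) = if p i then s *: delta_mx 0 i else 0.
Proof.
apply/rowP => j; rewrite mxE; have [->|ji] := eqVneq j i.
  by case: (p i); rewrite // mxE.
have e0 : (s *: delta_mx 0 i : E) 0 j = 0.
  by rewrite !mxE (negbTE ji) andbF mulr0.
by rewrite e0; case: (p j); case: (p i); rewrite ?e0 ?mxE.
Qed.

Let enorm_delta (s : R) i : enorm (s *: delta_mx 0 i : E) = `|s|.
Proof. by rewrite enormZ -/(vertical i) enorm_vertical mulr1. Qed.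

Let rho := D x0 y0.
Let P lam := piece a c rho lam.

Let c0 : 0 < c. Proof. exact: lt_le_trans c1. Qed.
Let c20 : 0 < c2. Proof. exact: lt_le_trans c21. Qed.
Let Dsym x y : D x y = D y x. Proof. exact: enormB. Qed.

(** A point at distance slightly less than the gap lies in the same piece, but it
    is too far away to lie in the same piece of the next level. *)
Lemma pieces_split lam : 0 < lam -> lam < (c * c2)^-1 -> lam <= 1 ->
  forall k x, exists2 y, siblings (P lam) k x y & ~ P lam k x y.
Proof.
move=> lam0 lam_lt lam1 k x; have rgt0 l := radius_gt0 D00 lam0 l.
have far : exists y, rho / 2 <= D x y.
  have [h|h] := leP (rho / 2) (D x x0); first by exists x0.
  exists y0; have := enorm_le_via (a x) (a x0) (a y0).
  by rewrite (enormB (a x0) (a x)) -/(D x0 y0) -/(D x x0) -/(D x y0) -/rho; move: h; lra.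
case: k => [|k].
  case: far => y xy; exists y => // /(piece_dist D00 lam0 Dc).
  by rewrite /radius expr0 mulr1 -/(D x y) -/rho; move: D00; rewrite -/rho; lra.
have g0 : 0 < gap c rho lam k by exact: gap_gt0.
have [|z [z1 z2]] := Dperfect (x := x) g0.
  case: far => y xy; exists y; apply: le_trans xy.
  apply: (le_trans (gap_le c1 D00 lam0 k)).
  have : lam ^+ k <= 1 by rewrite exprn_ile1// ltW.
  by move/(ler_wpM2l (ltW D00)); rewrite -/rho /radius mulr1; move: D00; rewrite -/rho; lra.
exists z; first by move=> i [<-]; exact: chain_step.
move=> /(piece_dist D00 lam0 Dc); rewrite -/(D x z) => h.
have := le_trans z1 h; apply/negP; rewrite -ltNge /gap.
have -> : radius rho lam k / (8 * c) / c2 = radius rho lam k / 8 * (c * c2)^-1.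
  by field; rewrite !gt_eqF.
have -> : radius rho lam k.+1 / 8 = radius rho lam k / 8 * lam.
  by rewrite /radius exprSr; field.
by rewrite ltr_pM2l// divr_gt0.
Qed.

(** Pieces with the same parent are separated by a bounded number of meshes. *)
Lemma label_modulus lam : 0 < lam -> lam <= (960 * (@colours R n.+1 c)%:R)^-1 ->
  exists m, forall k x y,
  siblings (P lam) k x y ->
  colour x0 a c rho lam m k x = colour x0 a c rho lam m k y -> P lam k x y.
Proof.
move=> lam0 lam_small; have rgt0 l := radius_gt0 D00 lam0 l.
have B0 : 0 <= B by rewrite (le_trans _ (DB x0 x0))// enorm_ge0.
have d0 : 0 < n.+1%:R :> R by rewrite ltr0n.
pose K : R := 16 * c * n.+1%:R * ((8 * lam)^-1 + B / rho).
have K0 : 0 <= K.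
  apply: mulr_ge0; first exact: (mulr_ge0 (mulr_ge0 (ler0n R 16) (ltW c0)) (ltW d0)).
  apply: addr_ge0; last by rewrite divr_ge0// ltW.
  by rewrite invr_ge0 mulr_ge0// ltW.
exists (Num.bound K) => k x y xy ceq.
apply: (colour_piece ord0 c1 D00 lam0 ceq).
apply: (@le_trans _ _ (K * @mesh R n.+1 c rho lam k)); last first.
  apply: ler_wpM2r (ltW (archi_boundP K0)); apply: ltW.
  exact: (mesh_gt0 ord0 c1 D00 lam0 k).
have -> : K * @mesh R n.+1 c rho lam k =
    (8 * lam)^-1 * radius rho lam k + B / rho * radius rho lam k.
  rewrite /K /mesh /gap; field; rewrite !gt_eqF//.
have Bk : 0 <= B / rho * radius rho lam k.
  by rewrite mulr_ge0 ?divr_ge0 ?(ltW (rgt0 _))// ltW.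
case: k xy {ceq} Bk => [_ _|k xy Bk].
  apply: (le_trans (DB _ _)); rewrite /radius expr0 mulr1 divfK ?gt_eqF//.
  by rewrite lerDr mulr_ge0 ?invr_ge0 ?mulr_ge0// ltW.
apply: (@le_trans _ _ ((8 * lam)^-1 * radius rho lam k.+1)); last by rewrite lerDl.
have -> : (8 * lam)^-1 * radius rho lam k.+1 = radius rho lam k / 8.
  by rewrite /radius exprS; field; rewrite gt_eqF.
apply: (piece_dist D00 lam0 Dc).
have up z : P lam k z (repr x0 a c rho lam k.+1 z).
  by apply: (piece_pred c1 D00 lam0 lam_small); exact: reprP.
apply: chain_trans (piece_sym (up x)) _; apply: chain_trans (up y).
exact: xy.
Qed.

(** The composite of the map for the Cantor set, two shears, and the inverse of
    the map for [a T]. *)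
Theorem taming : exists (f : T -> R) (G : E -> E),
  [/\ forall x, C (f x), forall t, C t -> exists x, f x = t, power_qs G &
      forall x, G (f x *: delta_mx 0 ord0) = a x].
Proof.
(* The first bound separates the pieces, the second one makes them split. *)
pose lam := Num.min (960 * (@colours R n.+1 c)%:R)^-1 ((c * c2)^-1 / 2).
have cc0 : 0 < (c * c2)^-1 by rewrite invr_gt0 mulr_gt0.
have p960 : 0 < 960 :> R by rewrite ltr0n.
have col1 c' : 1 <= (@colours R n.+1 c')%:R :> R.
  by rewrite ler1n; apply/card_gt0P; exists [ffun=> ord0].
have col0 c' : 0 < 960 * (@colours R n.+1 c')%:R :> R.
  exact: (mulr_gt0 p960 (lt_le_trans ltr01 (col1 c'))).
have lam0 : 0 < lam.
  by rewrite /lam lt_min divr_gt0// andbT invr_gt0; exact: col0.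
have lam_small : lam <= (960 * (@colours R n.+1 c)%:R)^-1 by rewrite ge_min lexx.
have lam_lt : lam < (c * c2)^-1.
  by rewrite /lam gt_min; apply/orP; right; lra.
have lam1 : lam <= 1.
  by rewrite (le_trans (ltW lam_lt))// invf_le1 ?mulr_gt0// mulr_ege1.
have [m mP] := label_modulus lam0 lam_small.
have P_pred k x y : P lam k.+1 x y -> P lam k x y.
  exact: (piece_pred c1 D00 lam0 lam_small).
have [f [l [fC fd l0 lS fl]]] := @piece_coding R T x0 (P lam) _
  (fun k x => colour x0 a c rho lam m k x)
  (fun k x y => @piece_sym _ _ _ a c rho lam k x y)
  (fun k x y z xy yz => chain_trans xy yz) P_pred
  (fun k x y => @colour_eq _ _ _ x0 a c rho lam m k x y) mP
  (pieces_split lam0 lam_lt lam1).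
set N := #|_| in lS fl.
have l_ge k x : (k <= l k x)%N.
  by elim: k => [|k IH]; rewrite ?l0//; have /andP[h _] := lS k x; apply: leq_ltn_trans h.
have third0 : 0 <= (3^-1 : R) by rewrite invr_ge0.
have third1 : (3^-1 : R) <= 2^-1 by rewrite lef_pV2 ?posrE// ler_nat.
have f_uc e : 0 < e -> exists2 dl, 0 < dl &
    forall x y, D x y < dl -> `|f x - f y| <= e.
  move=> e0; have [K hK] := geometric_small 1 third0 third1 e0.
  exists (gap c rho lam K); first exact: (gap_gt0 c1 D00 lam0).
  move=> x y dxy; have sxy : siblings (P lam) K.+1 x y.
    by move=> i [<-]; exact: chain_step.
  have [_ h _] := fl _ _ _ sxy; apply: (le_trans h); have := hK K (leqnn _).
  by rewrite mul1r; apply: le_trans; apply: third_le; apply: leq_trans (l_ge _ x).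
have f_onto t : C t -> exists x, f x = t.
  move=> Ct; have [||x] := attained (g := fun x => `|f x - t|).
  - move=> e /f_uc[dl dl0 h]; exists dl => // x y /h; apply: le_trans.
    by rewrite (le_trans (ler_dist_dist _ _))// opprB addrA subrK.
  - move=> e e0; have e2 : 0 < e / 2 by rewrite divr_gt0.
    have [K hK] := geometric_small 1 third0 third1 e2.
    have [x hx] := fd t K Ct; exists x; apply: (le_lt_trans hx).
    by have := hK K (leqnn _); rewrite mul1r; lra.
  - by rewrite normr_le0 subr_eq0 => /eqP xt; exists x.
pose lam' := (960 * (@colours R n.+1 3)%:R : R)^-1.
have lam'0 : 0 < lam' by rewrite invr_gt0; exact: col0.
have lam'96 : lam' <= 96^-1.
  by rewrite /lam' lef_pV2 ?posrE ?ltr0n; [have := col1 3; lra | exact: col0 |].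
have lam32c : 0 < (32 * c)^-1 * lam by rewrite mulr_gt0// invr_gt0 mulr_gt0.
have [K hK] := geometric_small 1 third0 third1 lam32c.
(* The weights [3 ^- (alpha * l)] decrease fast enough if [alpha] is at least [K],
   and those of the Cantor set if it is at least [2]. *)
pose alpha := maxn K 2; have al0 : (0 < alpha)%N by rewrite /alpha leq_max orbT.
have al2 : (2 <= alpha)%N by rewrite leq_maxr.
have theta_le : third alpha <= (32 * c)^-1 * lam.
  by have := hK alpha (leq_maxl _ _); rewrite mul1r.
pose Sa x y := `|f x - f y| ^+ alpha.
have Sa0 x y : f x = f y -> Sa x y = 0.
  by move=> fxy; rewrite /Sa fxy subrr normr0 expr0n gtn_eqF.
(* The set [a T] is mapped to a set whose distances are comparable to those of
   the Cantor set raised to the power [alpha]. *)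
pose I2 : pred 'I_n.+1 := predC1 ord_max.
have I2a x : coord_proj I2 (a x) = a x.
  apply/rowP => i; rewrite mxE /I2 /=; case: eqP => [->|//].
  by rewrite a_last.
have DD : forall e, 0 < e -> exists2 dl, 0 < dl & forall x y, D x y < dl -> D x y <= e.
  by move=> e e0; exists e => // x y /ltW.
pose tau k x := third (alpha * l k x).
have tauE k x j : third (alpha * (l k x + j)) = tau k x * third j ^+ alpha.
  by rewrite mulnDr exprD -!exprM [(j * _)%N]mulnC.
have kapX0 : 0 < third (alpha * N) / lam by rewrite divr_gt0 ?third_gt0.
have tau0 x : tau 0%N x = 1 by rewrite /tau l0 muln0 expr0.
have tau_ge k x : third (alpha * N) / lam * lam * tau k x <= tau k.+1 x.
  rewrite divfK ?gt_eqF//; have /andP[_ h] := lS k x.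
  rewrite /tau -exprD third_le//.
  by rewrite -mulnDr leq_mul2l addnC h orbT.
have tau_le k x : tau k.+1 x <= (32 * c)^-1 * lam * tau k x.
  rewrite (le_trans _ (ler_wpM2r (ltW (third_gt0 _ _)) theta_le))//.
  rewrite /tau -exprD third_le// -mulnS leq_mul2l.
  by have /andP[->] := lS k x; rewrite orbT.
have tau_eq k x y : P lam k x y -> tau k.+1 x = tau k.+1 y.
  by move=> xy; rewrite /tau; have [|-> _ _] := @fl k.+1 x y; [move=> i [<-]|].
have I2max : I2 ord_max = false by rewrite /I2 /= eqxx.
have X_closed (z : T -> E) L := @lipschitz_closed z L D DD (fun x y => enorm_ge0 _).
have [GX GXqs [cX [CX [cX0 CX0 GXP]]]] := weighted_embedding x0 I2max I2a c1 D00 lam0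
  Dc lam_small DB X_closed kapX0 tau0 tau_ge tau_le tau_eq.
pose zX x := GX (a x).
have [cX' [CX' [cX'0 CX'0 zXP]]] : exists c' C', [/\ 0 < c', 0 < C' &
    forall x y, c' * Sa x y <= enorm (coord_proj I2 (zX x - zX y)) /\
                enorm (zX x - zX y) <= C' * Sa x y].
  exists cX, (CX / third N ^+ alpha); split=> // [|x y].
    by rewrite divr_gt0// exprn_gt0// third_gt0.
  have [all_pieces|[k [sxy npxy]]] := first_split a c rho lam x y.
    have sib k : siblings (P lam) k x y by move=> i _; exact: all_pieces.
    have fxy : f x = f y.
      apply/eqP; rewrite -subr_eq0 -normr_le0.
      apply: (@ler_addgeo _ _ _ 1 _ 0 third0 third1) => k _; rewrite add0r mul1r.
      by have [_ h _] := fl k x y (sib k); rewrite (le_trans h)// third_le.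
    have axy : a x = a y.
      apply/eqP; rewrite -subr_eq0 -enorm_eq0 eq_le enorm_ge0 andbT.
      have lam2 : lam <= 2^-1.
        rewrite (le_trans (@ratio_le32 R n.+1 c lam lam_small))//.
        by rewrite lef_pV2 ?posrE// ler_nat.
      apply: (@ler_addgeo _ _ _ (rho / 8) _ 0 (ltW lam0) lam2) => k _; rewrite add0r.
      by have := piece_dist D00 lam0 Dc (all_pieces k); rewrite /radius mulrAC.
    by rewrite Sa0// /zX axy subrr !mulr0 enorm0 enorm_ge0.
  have [lo hi] := GXP k x y sxy npxy; have [_ f1 /(_ npxy) f2] := fl k x y sxy.
  have S1 : Sa x y <= tau k x.
    by rewrite /tau mulnC exprM lerXn2r ?nnegrE ?normr_ge0// exprn_ge0.
  have S2 : tau k x * third N ^+ alpha <= Sa x y.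
    by rewrite -tauE mulnC exprM lerXn2r ?nnegrE ?normr_ge0// exprn_ge0.
  split; first by rewrite (le_trans _ lo)// ler_wpM2l// ltW.
  by rewrite (le_trans hi)// -mulrA ler_wpM2l ?(ltW CX0)// mulrC ler_pdivlMr.
(* So is the Cantor set, placed on the last coordinate axis. *)
pose I1 : pred 'I_n.+1 := pred1 ord_max.
pose b x : E := f x *: delta_mx 0 ord_max.
have I1b x : coord_proj I1 (b x) = b x by rewrite coordD /I1 /= eqxx.
have bE x y : enorm (b x - b y) = `|f x - f y| by rewrite /b -scalerBl enorm_delta.
have bc : chain_bounded (fun x y => enorm (b x - b y)) 3.
  apply: (@chain_bounded_map _ _ _ _ (@cantor_dist R) (fun x => exist _ (f x) (fC x)) 3).
    by move=> x y; rewrite bE.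
  exact: cantor_chain_bounded.
have b_le1 x y : enorm (b x - b y) <= 1.
  by rewrite bE; exact: cantor_diff.
have b_uc e : 0 < e -> exists2 dl, 0 < dl & forall x y, D x y < dl -> enorm (b x - b y) <= e.
  by move=> /f_uc[dl dl0 h]; exists dl => // x y /h; rewrite bE.
have b_closed (z : T -> E) L :=
  @lipschitz_closed z L (fun x y => enorm (b x - b y)) b_uc (fun x y => enorm_ge0 _).
pose tau' k (x : T) := lam' ^+ (alpha * k).
have kapC0 : 0 < lam' ^+ alpha.-1 by rewrite exprn_gt0.
have le13 : 1 <= 3 :> R by rewrite ler1n.
have tau'0 x : tau' 0%N x = 1 by rewrite /tau' muln0 expr0.
have tau'S k x : tau' k.+1 x = lam' ^+ alpha.-1 * lam' * tau' k x.
  by rewrite -exprSr prednK// /tau' mulnS exprD.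
have tau'_ge k x : lam' ^+ alpha.-1 * lam' * tau' k x <= tau' k.+1 x by rewrite tau'S.
have tau'_gt0 k x : 0 < tau' k x by rewrite exprn_gt0.
have lam'1 : lam' <= 1 by rewrite (le_trans lam'96)// invf_le1 ?ltr0n// ler1n.
have tau'_le k x : tau' k.+1 x <= (32 * 3)^-1 * lam' * tau' k x.
  rewrite tau'S ler_wpM2r ?(ltW (tau'_gt0 _ _))// ler_wpM2r ?(ltW lam'0)//.
  have -> : 32 * 3 = 96 :> R by rewrite -natrM.
  apply: le_trans lam'96; apply: ler_iXnr => //; last exact: ltW.
  by rewrite -ltnS prednK.
have tau'_eq k x y : piece b 3 1 lam' k x y -> tau' k.+1 x = tau' k.+1 y by [].
have I1_0 : I1 ord0 = false.
  by rewrite /I1 /= -val_eqE /= eq_sym; apply/negbTE; rewrite -lt0n.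
have [GC GCqs [cC [CC [cC0 CC0 GCP]]]] := weighted_embedding x0 I1_0 I1b le13 ltr01 lam'0
  bc (lexx _) b_le1 b_closed kapC0 tau'0 tau'_ge tau'_le tau'_eq.
pose zC x := GC (b x).
have [cC' [CC' [cC'0 CC'0 zCP]]] : exists c' C', [/\ 0 < c', 0 < C' &
    forall x y, c' * Sa x y <= enorm (coord_proj I1 (zC x - zC y)) /\
                enorm (zC x - zC y) <= C' * Sa x y].
  exists (cC * lam' ^+ alpha), (CC * 24 ^+ alpha); split=> [||x y].
  - by rewrite mulr_gt0 ?exprn_gt0.
  - by rewrite mulr_gt0 ?exprn_gt0.
  have lam'2 : lam' <= 2^-1.
    by rewrite (le_trans lam'96)// lef_pV2 ?posrE ?ltr0n// ler_nat.
  have [all_pieces|[k [sxy npxy]]] := first_split b 3 1 lam' x y.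
    have fxy : f x = f y.
      apply/eqP; rewrite -subr_eq0 -normr_le0 -bE.
      apply: (@ler_addgeo _ _ _ (1 / 8) _ 0 (ltW lam'0) lam'2) => k _; rewrite add0r.
      by have := piece_dist ltr01 lam'0 bc (all_pieces k); rewrite /radius mulrAC.
    by rewrite Sa0// /zC /b fxy subrr !mulr0 enorm0 enorm_ge0.
  have [lo hi] := GCP k x y sxy npxy.
  have tE : tau' k x = (lam' ^+ k) ^+ alpha by rewrite /tau' mulnC exprM.
  have S1 : lam' ^+ alpha * Sa x y <= tau' k x.
    rewrite tE -exprMn; apply: lerXn2r; rewrite ?nnegrE ?mulr_ge0 ?exprn_ge0 ?(ltW lam'0)//.
    rewrite -bE; case: k sxy {npxy lo hi tE} => [_|k sxy].
      by rewrite expr0 mulr_ile1 ?enorm_ge0// ltW.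
    rewrite exprS ler_wpM2l ?(ltW lam'0)//.
    have := piece_dist ltr01 lam'0 bc (sxy k erefl); rewrite /radius mul1r => h.
    by rewrite (le_trans h)// ler_piMr ?exprn_ge0 ?(ltW lam'0)// invf_le1 ?ltr0n// ler1n.
  have S2 : tau' k x <= 24 ^+ alpha * Sa x y.
    rewrite tE -exprMn; apply: lerXn2r; rewrite ?nnegrE ?mulr_ge0 ?exprn_ge0 ?(ltW lam'0)//.
    have := not_piece npxy; rewrite bE /gap /radius mul1r -natrM ler_pdivrMr ?ltr0n//.
    by rewrite mulrC.
  split; first by rewrite (le_trans _ lo)// -mulrA ler_wpM2l// ltW.
  by rewrite (le_trans hi)// -mulrA ler_wpM2l// ltW.
(* Two shears exchange the coordinates of [zC] for those of [zX]. *)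
pose w x := coord_proj I1 (zC x) + coord_proj I2 (zX x).
have proj12 u : coord_proj I1 u + coord_proj I2 u = u :> E.
  by apply/rowP => i; rewrite !mxE /I1 /I2 /=; case: eqP => _; rewrite ?addr0 ?add0r.
have proj_idem (p : pred 'I_n.+1) u : coord_proj p (coord_proj p u) = coord_proj p u :> E.
  by apply/rowP => i; rewrite !mxE; case: (p i).
have proj_12 u : coord_proj I1 (coord_proj I2 u) = 0 :> E.
  by apply/rowP => i; rewrite !mxE /I1 /I2 /=; case: eqP.
have proj_21 u : coord_proj I2 (coord_proj I1 u) = 0 :> E.
  by apply/rowP => i; rewrite !mxE /I1 /I2 /=; case: eqP.
have w1 x : coord_proj I1 (zC x) = coord_proj I1 (w x).
  by rewrite /w coord_projD proj_idem proj_12 addr0.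
have w2 x : coord_proj I2 (w x) = coord_proj I2 (zX x).
  by rewrite /w coord_projD proj_idem proj_21 add0r.
have w_le x y : enorm (w x - w y) <= (CC' + CX') * Sa x y.
  have -> : w x - w y = coord_proj I1 (zC x - zC y) + coord_proj I2 (zX x - zX y).
    by rewrite /w !coord_projB opprD addrACA.
  rewrite (le_trans (enormD _ _))// mulrDl lerD// (le_trans (enorm_coord_proj _ _))//.
    by have [] := zCP x y.
  by have [] := zXP x y.
have diff_le (u v : T -> E) (Cu Cv c' : R) (p : pred 'I_n.+1) : 0 < c' ->
    (forall x y, enorm (u x - u y) <= Cu * Sa x y) ->
    (forall x y, enorm (v x - v y) <= Cv * Sa x y) -> 0 < Cu + Cv ->
    (forall x y, c' * Sa x y <= enorm (coord_proj p (u x - u y))) ->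
    forall x y, enorm ((v x - u x) - (v y - u y)) <=
      (Cu + Cv) / c' * enorm (coord_proj p (u x - u y)).
  move=> c'0 hu hv Cuv hl x y.
  have -> : v x - u x - (v y - u y) = (v x - v y) - (u x - u y).
    by rewrite !opprB addrACA [RHS]addrACA; congr (_ + _); rewrite addrC.
  apply: (@le_trans _ _ ((Cu + Cv) * Sa x y)).
    rewrite (le_trans (enormD _ _))// enormN mulrDl addrC lerD//.
  rewrite -mulrA ler_wpM2l ?(ltW Cuv)// ler_pdivlMl//.
have lowC x y : cC' * Sa x y <= enorm (coord_proj I1 (zC x - zC y)) by have [] := zCP x y.
have lowX x y : cX' * Sa x y <= enorm (coord_proj I2 (w x - w y)).
  by rewrite coord_projB !w2 -coord_projB; have [] := zXP x y.
have hiC x y : enorm (zC x - zC y) <= CC' * Sa x y by have [] := zCP x y.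
have hiX x y : enorm (zX x - zX y) <= CX' * Sa x y by have [] := zXP x y.
have [H1 H1qs H1P] := power_qs_shear x0 w1
  (diff_le zC w CC' (CC' + CX') cC' I1 cC'0 hiC w_le (addr_gt0 CC'0 (addr_gt0 CC'0 CX'0)) lowC).
have [H2 H2qs H2P] := power_qs_shear x0 w2
  (diff_le w zX (CC' + CX') CX' cX' I2 cX'0 w_le hiX (addr_gt0 (addr_gt0 CC'0 CX'0) CX'0) lowX).
(* The Cantor set had to be on the last axis because its image must be determined
   by the coordinate complementary to those of [a T]. *)
pose b0 x : E := f x *: delta_mx 0 ord0.
pose I0 : pred 'I_n.+1 := pred1 ord0.
have I00 : I0 ord0 by rewrite /I0 /=.
have I0max : I0 ord_max = false by rewrite /I0 /= eq_sym -[RHS]I1_0 /I1.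
have I1max : I1 ord_max by rewrite /I1 /=.
have b0E p x : coord_proj p (b0 x) = if p ord0 then b0 x else 0 by exact: coordD.
have bmE p x : coord_proj p (b x) = if p ord_max then b x else 0 by exact: coordD.
have b0_dist x y : enorm (b0 x - b0 y) = `|f x - f y|.
  by rewrite /b0 -scalerBl enorm_delta.
have [||HA HAqs HAP] := @power_qs_shear R n.+1 T x0 b0 (fun x => b0 x + b x) I0 1.
- by move=> x; rewrite coord_projD b0E bmE I00 I0max addr0.
- move=> x y; have bb z : b0 z + b z - b0 z = b z by rewrite addrC addKr.
  by rewrite !bb bE mul1r coord_projB !b0E I00 b0_dist.
have [||HB HBqs HBP] := @power_qs_shear R n.+1 T x0 (fun x => b0 x + b x) b I1 1.
- by move=> x; rewrite coord_projD b0E bmE I1_0 I1max add0r.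
- move=> x y; have bb z : b z - (b0 z + b z) = - b0 z by rewrite addrC opprD addrNK.
  rewrite !bb -opprD enormN b0_dist mul1r coord_projB !coord_projD !b0E !bmE.
  by rewrite I1_0 I1max !add0r bE.
have [[GX' GXK GXK'] _] := GXqs.
exists f, (GX' \o (H2 \o (H1 \o (GC \o (HB \o HA))))); split=> // [|x].
  apply: power_qs_comp; first exact: power_qs_inv GXqs.
  by do ![apply: power_qs_comp => //].
by rewrite /= HAP HBP -/(zC x) H1P H2P GXK.
Qed.

End Taming.

(** * Metric reformulations of the two geometric conditions *)

Section SubsetDistance.
Context {R : realType} {M : metricType R}.
Variable X : set M.
Let T := {x : M | X x}.

Definition subset_dist (x y : T) : R := mdist (sval x) (sval y).

Lemma subset_dist_le_diam (x y : T) : ((subset_dist x y)%:E <= diam X)%E.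
Proof.
apply: ereal_sup_ubound; exists (sval x, sval y) => //.
by split; [exact: svalP x | exact: svalP y].
Qed.

Lemma lt_diam_exists (r : R) : (r%:E < diam X)%E -> exists x y : T, r < subset_dist x y.
Proof.
move=> /ereal_sup_gt[_ [[x y] [/= Xx Xy] <-]]; rewrite lte_fin => h.
by exists (exist _ x Xx), (exist _ y Xy).
Qed.

(** A short chain cannot leave the cluster of its starting point.  The factor [8]
    covers the radii that are not smaller than a quarter of the diameter. *)
Lemma uniformly_disconnected_chain : uniformly_disconnected X ->
  exists2 c, 1 <= c & chain_bounded subset_dist c.
Proof.
move=> [c c1 ud]; have c0 : 0 < c by apply: lt_le_trans c1.
exists (8 * c); first by lra.
move=> r x y r0 xy.
have r80 : 0 < r / 8 by rewrite divr_gt0.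
have [small|big] := ltP ((r / 8)%:E)%E ((4^-1)%:E * diam X)%E; last first.
  have : ((4^-1)%:E * (subset_dist x y)%:E <= (r / 8)%:E)%E.
    apply: le_trans big; apply: lee_wpmul2l; rewrite ?lee_fin ?invr_ge0//.
    exact: subset_dist_le_diam.
  by rewrite -EFinM lee_fin; lra.
have [A [AX Ax dA sA]] := ud (sval x) (r / 8) (svalP x) r80 small.
have Ay : A (sval y).
  apply: (xy (fun z => A (sval z))) => // u v Au uv.
  apply: contrapT => nAv; move: uv; apply/negP; rewrite -leNgt.
  have -> : r / (8 * c) = r / 8 / c by field; rewrite gt_eqF.
  rewrite -lee_fin; apply: (le_trans sA); apply: ereal_inf_lbound.
  by exists (sval u, sval v) => //; split => //=; split => //; exact: (svalP v).
have : ((subset_dist x y)%:E <= (r / 8)%:E)%E.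
  apply: le_trans dA; apply: ereal_sup_ubound.
  by exists (sval x, sval y).
rewrite lee_fin; lra.
Qed.

(** The points reached by short chains form the required cluster. *)
Lemma chain_uniformly_disconnected c : 1 <= c -> chain_bounded subset_dist c ->
  uniformly_disconnected X.
Proof.
move=> c1 Dc; exists c => // x r Xx r0 _.
pose x' : T := exist _ x Xx.
pose A := [set z | exists2 z' : T, sval z' = z & chain subset_dist (r / c) x' z'].
have Dsym u v : subset_dist u v = subset_dist v u by exact: metric_sym.
exists A; split.
- by move=> _ [z' <- _]; exact: (svalP z').
- by exists x' => //; exact: chain_refl.
- apply: ge_ereal_sup => _ [[_ _] [/= [u <- xu] [v <- xv]] <-].
  rewrite lee_fin; apply: Dc => //.
  by apply: chain_trans xv; exact: chain_sym.
- apply: le_ereal_inf_tmp => _ [[_ v] [/= [u <- xu] [Xv nAv]] <-].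
  rewrite lee_fin leNgt; apply/negP => uv; apply: nAv.
  exists (exist _ v Xv) => //; apply: chain_trans xu _; exact: chain_step.
Qed.

Lemma uniformly_perfect_dist : uniformly_perfect X ->
  exists2 c, 1 <= c & perfect_dist subset_dist c.
Proof.
move=> [_ _ [c c1 up]]; have c0 : 0 < c by apply: lt_le_trans c1.
exists (2 * c); first by lra.
move=> x r r0 [y xy]; have r20 : 0 < r / 2 by rewrite divr_gt0.
have [|z [Xz [zr zrc]]] := up (sval x) (r / 2) (svalP x) r20.
  apply: lt_le_trans (subset_dist_le_diam x y); rewrite lte_fin.
  by apply: lt_le_trans xy; lra.
exists (exist _ z Xz); move: zr zrc; rewrite !ballEmdist /= => zr /negP.
rewrite -leNgt => zrc; rewrite /subset_dist /=; split; last by lra.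
by have -> : r / (2 * c) = r / 2 / c by field; rewrite gt_eqF.
Qed.

Lemma dist_uniformly_perfect c : 1 <= c -> closed X ->
  (exists x y : T, sval x != sval y) -> perfect_dist subset_dist c ->
  uniformly_perfect X.
Proof.
move=> c1 clX [x0 [y0 xy0]] Dp; have c0 : 0 < c by apply: lt_le_trans c1.
split => //; first by exists (sval x0), (sval y0); split => //; exact: svalP.
exists (2 * c); first by lra.
move=> x r Xx r0 /lt_diam_exists[u [v uv]].
have r20 : 0 < r / 2 by rewrite divr_gt0.
pose x' : T := exist _ x Xx.
have far : exists y, r / 2 <= subset_dist x' y.
  have [h|h] := leP (r / 2) (subset_dist x' u); first by exists u.
  exists v; have := metric_triangle (sval u) x (sval v).
  rewrite (metric_sym (sval u) x) -/(subset_dist x' u) -/(subset_dist x' v).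
  by rewrite -/(subset_dist u v); lra.
have [z [z1 z2]] := Dp x' (r / 2) r20 far.
exists (sval z); split; first exact: (svalP z).
rewrite !ballEmdist /=; split; first by apply: (lt_trans z2); lra.
apply/negP; rewrite -leNgt.
by have -> : r / (2 * c) = r / 2 / c by field; rewrite gt_eqF.
Qed.

(** A cluster point of the sublevel sets of [g] is a minimum. *)
Lemma compact_attained (g : T -> R) : compact X ->
  (forall e, 0 < e -> exists2 dl, 0 < dl &
     forall x y, subset_dist x y < dl -> `|g x - g y| <= e) ->
  (forall e, 0 < e -> exists x, g x < e) -> exists x, g x <= 0.
Proof.
move=> cX gc gi.
pose A e := [set z | exists2 x : T, sval x = z & g x < e].
pose F := filter_from [set e : R | 0 < e] A.
have FF : ProperFilter F.
  apply: filter_from_proper; last by move=> e /gi[x gx]; exists (sval x), x.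
  apply: filter_from_filter; first by exists 1; rewrite /= ltr01.
  move=> e1 e2 /= e10 e20; exists (Num.min e1 e2); first by rewrite /= lt_min e10.
  by move=> _ [x <-]; rewrite lt_min => /andP[? ?]; split; exists x.
have FX : F X by exists 1; [rewrite /= ltr01 | move=> _ [x <- _]; exact: (svalP x)].
have [p [Xp clp]] := cX F FF FX.
exists (exist _ p Xp); apply/ler_addgt0Pr => e e0; rewrite add0r.
have e20 : 0 < e / 2 by rewrite divr_gt0.
have [dl dl0 h] := gc _ e20.
have [_ [[x <- gx] px]] := clp (A (e / 2)) (ball p dl)
  (ex_intro2 _ _ (e / 2) e20 (@subset_refl _ _)) (nbhsx_ballx _ _ dl0).
move: px; rewrite ballEmdist /= => px.
have := h (exist _ p Xp) x px; rewrite ler_norml; lra.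
Qed.

(** The function [1 / (1 + d x0)] would have infimum [0] on an unbounded set. *)
Lemma compact_bounded (x0 : T) : compact X -> exists B, forall x y, subset_dist x y <= B.
Proof.
move=> cX; pose g x := (1 + subset_dist x0 x)^-1.
have D0 x : 0 < 1 + subset_dist x0 x by rewrite ltr_pwDl// mdist_ge0.
have [h|h] := pselect (exists2 e, 0 < e & forall x, e <= g x).
  have [e e0 ge] := h.
  have D_le x : subset_dist x0 x <= e^-1.
    apply: (@le_trans _ _ (1 + subset_dist x0 x)); first by rewrite lerDr.
    by rewrite -[leLHS]invrK lef_pV2 ?posrE ?invr_gt0//; exact: ge.
  exists (e^-1 + e^-1) => x y.
  have := metric_triangle (sval x) (sval x0) (sval y).
  rewrite (metric_sym (sval x) (sval x0)) => /le_trans; apply.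
  by apply: lerD; exact: D_le.
have [||x] := @compact_attained g cX.
- move=> e e0; exists e => // x y xy; rewrite /g.
  have -> : (1 + subset_dist x0 x)^-1 - (1 + subset_dist x0 y)^-1 =
    (subset_dist x0 y - subset_dist x0 x) /
    ((1 + subset_dist x0 x) * (1 + subset_dist x0 y)).
    by field; rewrite !gt_eqF.
  have ge1 z : 1 <= 1 + subset_dist x0 z by rewrite lerDl mdist_ge0.
  rewrite normrM normfV ler_pdivrMr; last by rewrite normr_gt0 gt_eqF// mulr_gt0.
  apply: (@le_trans _ _ e); last first.
    rewrite ler_peMr ?(ltW e0)// ger0_norm ?mulr_ege1//.
    by rewrite mulr_ge0// ltW.
  apply: le_trans (ltW xy); rewrite ler_norml /subset_dist.
  have := metric_triangle (sval x0) (sval x) (sval y).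
  have := metric_triangle (sval x0) (sval y) (sval x).
  rewrite (metric_sym (sval y) (sval x)) => h1 h2.
  by apply/andP; split; lra.
- move=> e e0; apply: contrapT => ne; apply: h; exists e => // x.
  by rewrite leNgt; apply/negP => gx; apply: ne; exists x.
- by rewrite leNgt invr_gt0 D0.
Qed.

End SubsetDistance.

(** * Distance conditions under quasisymmetric maps *)

Section Transfer.
Variables (R : realType) (T : Type) (d d' : T -> T -> R) (eta : R -> R).
Hypothesis d_ge0 : forall x y, 0 <= d x y.
Hypothesis d_sym : forall x y, d x y = d y x.
Hypothesis d_tri : forall y x z, d x z <= d x y + d y z.
Hypothesis d'_sym : forall x y, d' x y = d' y x.
Hypothesis d'_tri : forall y x z, d' x z <= d' x y + d' y z.
Hypothesis d'_ge0 : forall x y, 0 <= d' x y.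
Hypothesis d'0 : forall x y, d x y = 0 -> d' x y = 0.
Hypothesis eta_qs : forall x u v, 0 < d x v -> d' x u <= eta (d x u / d x v) * d' x v.
Hypothesis eta_bounded : forall m, exists2 K, 1 <= K &
  forall t, 0 <= t -> t <= m -> eta t <= K.
Hypothesis eta_small : exists2 dl, 0 < dl &
  forall t, 0 <= t -> t <= dl -> eta t <= 2^-1.

(** A chain from [x] to [y] has to leave the cluster of [x] at the scale
    [d x y / 2].  The step that leaves it is comparable to this scale in the
    source, so that its image is comparable to [d' x y]. *)
Lemma chain_bounded_transfer c : 1 <= c -> chain_bounded d c ->
  exists2 c', 1 <= c' & chain_bounded d' c'.
Proof.
move=> c1 dc; have c0 : 0 < c by apply: lt_le_trans c1.
have [K K1 KP] := eta_bounded (3 * c); have K0 : 0 < K by apply: lt_le_trans K1.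
exists (4 * K); first by lra.
move=> r x y r0 xy; rewrite leNgt; apply/negP => ry.
have dxy : 0 < d x y.
  rewrite lt_def d_ge0 andbT; apply/eqP => /d'0 h; move: ry; rewrite h; lra.
pose s := d x y / 2; have s0 : 0 < s by rewrite divr_gt0.
have sc0 : 0 < s / c by rewrite divr_gt0.
have near z : chain d (s / c) x z -> d x z <= s by move=> h; exact: dc s0 h.
suff /near : chain d (s / c) x y by rewrite /s; lra.
apply: (xy (chain d (s / c) x)) => [|u v xu uv]; first exact: chain_refl.
apply: contrapT => nv.
have duv : s / c <= d u v.
  by rewrite leNgt; apply/negP => h; apply: nv; apply: chain_trans xu _; exact: chain_step.
have duv0 : 0 < d u v by apply: lt_le_trans duv.
have dxu := near _ xu.
have est z : d u z <= 3 * s -> d' u z <= r / 4.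
  move=> uz; apply: (le_trans (eta_qs z duv0)).
  apply: (@le_trans _ _ (K * (r / (4 * K)))); last first.
    by rewrite le_eqVlt; apply/orP; left; apply/eqP; field; rewrite gt_eqF.
  apply: (@le_trans _ _ (K * d' u v)); last by rewrite ler_wpM2l ?(ltW K0)// ltW.
  rewrite ler_wpM2r//; apply: KP; first by rewrite divr_ge0.
  rewrite ler_pdivrMr// (le_trans uz)//.
  have -> : 3 * s = 3 * c * (s / c) by field; rewrite gt_eqF.
  by rewrite ler_wpM2l// mulr_ge0// ltW.
have h1 : d' u x <= r / 4 by apply: est; rewrite d_sym; move: s0; lra.
have h2 : d' u y <= r / 4.
  apply: est; have := d_tri x u y; rewrite (d_sym u x) => h; apply: (le_trans h).
  by move: dxu; rewrite /s; lra.
by have := d'_tri u x y; rewrite (d'_sym x u); move: ry; lra.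
Qed.

(** Moving toward [x] by a bounded factor in the source moves the image toward
    the image of [x] by a factor between two fixed bounds smaller than [1]. *)
Lemma perfect_transfer c : 1 <= c -> perfect_dist d c ->
  exists2 c', 1 <= c' & perfect_dist d' c'.
Proof.
move=> c1 dc; have c0 : 0 < c by apply: lt_le_trans c1.
have [dl0 dl0_gt0 dl0P] := eta_small.
pose dl := Num.min 1 dl0; have dl_gt0 : 0 < dl by rewrite lt_min ltr01.
have dl1 : dl <= 1 by rewrite ge_min lexx.
have dlP t : 0 <= t -> t <= dl -> eta t <= 2^-1.
  by move=> t0 tdl; apply: dl0P => //; apply: le_trans tdl _; rewrite ge_min lexx orbT.
have [K K1 KP] := eta_bounded (c / dl); have K0 : 0 < K by apply: lt_le_trans K1.
exists K => // x r r0 [y ry].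
have [n hn] : exists n, d' x y < 2 ^+ n * r.
  have q0 : 0 <= d' x y / r by rewrite divr_ge0// ltW.
  exists (Num.bound (d' x y / r)); rewrite -ltr_pdivrMr//.
  apply: (lt_trans (archi_boundP q0)).
  by rewrite -natrX ltr_nat ltn_expl.
elim: n y ry hn => [|n IH] y ry hn; first by move: hn; rewrite mul1r ltNge ry.
have dxy : 0 < d x y.
  rewrite lt_def d_ge0 andbT; apply/eqP => /d'0 h; move: ry; rewrite h; lra.
have [||z [z1 z2]] := dc x (dl * d x y); first by rewrite mulr_gt0.
  by exists y; rewrite ler_piMl// ltW.
have dxz : 0 < d x z by apply: lt_le_trans z1; rewrite !mulr_gt0 ?invr_gt0.
have half : d' x z <= d' x y / 2.
  rewrite (le_trans (eta_qs z dxy))// mulrC ler_wpM2l//.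
  by apply: dlP; [rewrite divr_ge0 | rewrite ler_pdivrMr// ltW].
have back : d' x y <= K * d' x z.
  rewrite (le_trans (eta_qs y dxz))// ler_wpM2r//.
  apply: KP; first by rewrite divr_ge0.
  rewrite ler_pdivrMr//; apply: (@le_trans _ _ (c / dl * (dl * d x y / c))).
    by rewrite le_eqVlt; apply/orP; left; apply/eqP; field; rewrite !gt_eqF.
  by rewrite ler_wpM2l// divr_ge0// ltW.
have [zr|rz] := ltP (d' x z) r.
  by exists z; split => //; rewrite ler_pdivrMr// mulrC (le_trans ry).
by apply: (IH z rz); move: hn; rewrite exprS; lra.
Qed.

End Transfer.

(** * Homeomorphisms of the half-line *)

Section HalfLine.
Context {R : realType}.
Variable eta : R -> R.
Hypothesis homeo : homeomorphism_on (`[0, +oo[ : set R) (`[0, +oo[ : set R) eta.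

Let cont : {within (`[0, +oo[ : set R), continuous eta}.
Proof. by case: homeo => g [_ _ _ _ []]. Qed.

Let sub (u v : R) : 0 <= u -> {within `[u, v], continuous eta}.
Proof.
move=> u0; apply: continuous_subspaceW cont => x /=; rewrite !in_itv /= andbT.
by move=> /andP[ux _]; exact: le_trans ux.
Qed.

Lemma half_line_ge0 t : 0 <= t -> 0 <= eta t.
Proof.
case: homeo => g [h _ _ _ _] t0.
by have := h t; rewrite /= !in_itv /= !andbT; apply.
Qed.

Lemma half_line_inj s t : 0 <= s -> 0 <= t -> eta s = eta t -> s = t.
Proof.
case: homeo => g [_ _ gK _ _] s0 t0 st.
by rewrite -(gK s) ?inE/= ?in_itv/= ?s0// st gK// inE/= in_itv/= t0.
Qed.

Lemma half_line_surj y : 0 <= y -> exists2 t, 0 <= t & eta t = y.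
Proof.
case: homeo => g [_ h _ gK _] y0; exists (g y).
  by have := h y; rewrite /= !in_itv /= !andbT; apply.
by rewrite gK// inE/= in_itv/= y0.
Qed.

Lemma half_line_bounded m : exists2 K, 1 <= K &
  forall t, 0 <= t -> t <= m -> eta t <= K.
Proof.
have [m0|m0] := leP 0 m; last by exists 1 => // t t0 tm; lra.
have [c _ hc] := EVT_max m0 (@sub 0 m (lexx 0)).
exists (Num.max 1 (eta c)); first by rewrite le_max lexx.
by move=> t t0 tm; rewrite le_max hc ?orbT// in_itv/= t0.
Qed.

(** Otherwise the positive preimage of [0] and a preimage of a value larger than
    [eta 0] would enclose a second preimage of [eta 0]. *)
Lemma half_line0 : eta 0 = 0.
Proof.
have [t0 t00 et0] := half_line_surj (lexx 0).
have e0 := half_line_ge0 (lexx 0).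
have [|t1 t10 et1] := @half_line_surj (eta 0 + 1); first lra.
have [t0E|t0ne] := eqVneq t0 0; first by move: et0; rewrite t0E.
have t0_gt0 : 0 < t0 by rewrite lt_def t0ne.
have t1_gt0 : 0 < t1.
  by rewrite lt_def t10 andbT; apply/eqP => h; move: et1; rewrite h; lra.
have no_preimage u v : 0 < u -> u <= v ->
    Num.min (eta u) (eta v) <= eta 0 <= Num.max (eta u) (eta v) -> False.
  move=> u0 uv /(IVT uv (@sub u v (ltW u0)))[c]; rewrite in_itv /= => /andP[uc _].
  have c_gt0 := lt_le_trans u0 uc.
  by move=> /(half_line_inj (ltW c_gt0) (lexx 0)) h; move: c_gt0; rewrite h ltxx.
exfalso; have [t01|/ltW t10'] := leP t0 t1.
  apply: (no_preimage t0 t1) => //.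
  by rewrite et0 et1 ge_min le_max e0 /=; apply/orP; right; rewrite lerDl.
apply: (no_preimage t1 t0) => //.
by rewrite et0 et1 ge_min le_max e0 orbT /=; apply/orP; left; rewrite lerDl.
Qed.

Lemma half_line_small : exists2 dl, 0 < dl &
  forall t, 0 <= t -> t <= dl -> eta t <= 2^-1.
Proof.
have [_ /cvgrPdist_le lim0] := (continuous_within_itvcyP 0 eta).1 cont.
have h2 : 0 < 2^-1 :> R by rewrite invr_gt0.
have /nbhs_ballP[dl /= dl0 h] := lim0 _ h2.
exists (dl / 2) => [|t t0 tdl]; first by rewrite divr_gt0.
have [->|tne] := eqVneq t 0; first by rewrite half_line0 invr_ge0.
have t_gt0 : 0 < t by rewrite lt_def tne.
have := h t _ t_gt0; rewrite half_line0 sub0r normrN => /(_ _) le2.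
rewrite (le_trans (ler_norm _))// le2//.
by rewrite /ball /= sub0r normrN gtr0_norm//; lra.
Qed.

End HalfLine.

(** * Power quasisymmetric maps of Euclidean space are quasisymmetric *)

Section Quasisymmetric.
Context {R : realType} {n : nat}.
Local Notation E := (euclidean R n.+1).

(** Compare the displacement of [a] near [x] with that of one fixed point [b]. *)
Lemma power_qs_continuous (G : E -> E) : power_qs G -> continuous G.
Proof.
move=> [bG [C [K [C1 K0 h]]]] x.
have C0 : 0 < C by apply: lt_le_trans C1.
pose b : 'rV[R]_n.+1 := (x : 'rV[R]_n.+1) + delta_mx 0 ord0.
have xb1 : enorm ((x : 'rV[R]_n.+1) - b) = 1.
  by rewrite /b opprD addNKr enormN; exact: enorm_vertical.
have xb : (x : 'rV[R]_n.+1) != b.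
  by rewrite -subr_eq0 -enorm_eq0 xb1 oner_eq0.
set Lb := enorm ((G x : 'rV[R]_n.+1) - G b).
have Lb0 : 0 < Lb by rewrite enorm_gt0 subr_eq0 (bij_eq bG).
apply/(@metricType_numDomainType.cvgrPdist_lt _ E E (nbhs x) _ G (G x)) => e e0.
pose e' := e / 2 / Lb; have e'0 : 0 < e' by rewrite !divr_gt0.
pose dl := Num.min 1 ((e' / C) ^+ K).
have dl0 : 0 < dl by rewrite lt_min ltr01 exprn_gt0// divr_gt0.
apply/nbhs_ballP; exists dl => // a; rewrite ballEmdist /= mdist_enorm => xa.
have := h x a b xb; set t := dist_ratio _ _ _; set u := dist_ratio _ _ _.
have tE : t = enorm ((x : 'rV[R]_n.+1) - a) by rewrite /t /dist_ratio xb1 divr1.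
have t0 : 0 <= t by exact: dist_ratio_ge0.
have u0 : 0 <= u by exact: dist_ratio_ge0.
have t1 : t <= 1 by rewrite tE (le_trans (ltW xa))// ge_min lexx.
have tdl : t <= (e' / C) ^+ K by rewrite tE (le_trans (ltW xa))// ge_min lexx orbT.
move=> /(power_distortion_le1 t0 u0 C1 K0 t1) uK.
have ue : u <= e'.
  rewrite -(@ler_pXn2r _ K)// ?nnegrE ?(ltW e'0)//.
  rewrite (le_trans uK)// -[e'](divfK (lt0r_neq0 C0)) mulrC exprMn.
  by rewrite ler_wpM2r// exprn_ge0// ltW.
rewrite mdist_enorm; move: ue; rewrite /u /dist_ratio /e' ler_pM2r ?invr_gt0//.
by move/le_lt_trans; apply; rewrite ltr_pdivrMr// ltr_pMr// ltr1n.
Qed.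

Lemma power_qs_quasisymmetric (G : E -> E) : power_qs G -> quasisymmetric G.
Proof.
move=> Gqs; have [bG [C [K [C1 K0 h]]]] := Gqs.
have KK : (K <= 2 ^ K)%N by rewrite ltnW// ltn_expl.
have CK1 : 1 <= C ^+ (2 ^ K) by apply: exprn_ege1.
exists (gauge (C ^+ (2 ^ K)) K); split.
  by apply: gauge_homeo; apply: lt_le_trans CK1.
split; last first.
  move=> x a b xb; rewrite !mdist_enorm.
  apply: gauge_ge; rewrite ?divr_ge0 ?enorm_ge0//; first by apply: le_trans CK1.
  by apply: (power_distortion_mono _ _ C1 K0 KK (h x a b xb)); exact: dist_ratio_ge0.
case: (bG) => G' GK G'K; exists G'; split => //.
split; apply: continuous_subspaceT; apply: power_qs_continuous => //.
exact: power_qs_inv Gqs.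
Qed.

End Quasisymmetric.

(** * Zero padding *)

Section Padding.
Variable R : realType.

Lemma mdist_embed (m k : nat) (x y : euclidean R m) : (m <= k)%N ->
  mdist (embed k x) (embed k y) = mdist x y.
Proof.
move=> mk; rewrite !mdist_enorm; congr Num.sqrt.
pose G (j : nat) : R := oapp (fun i : 'I_m => ((x : 'rV_m) 0 i - (y : 'rV_m) 0 i) ^+ 2) 0
  (insub j).
transitivity (\sum_(j < k) G j).
  apply: eq_bigr => j _; rewrite !mxE /G; case: insub => [i|] //=.
  by rewrite subrr expr0n.
transitivity (\sum_(i < m) G i); last first.
  by apply: eq_bigr => i _; rewrite /G valK /= !mxE.
rewrite (big_ord_widen k G mk) [RHS]big_mkcond /=; apply: eq_bigr => j _.
by rewrite /G; case: ifP => // /negbT jm; rewrite insubN.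
Qed.

Lemma embed_last (n : nat) (x : euclidean R n) :
  (embed n.+1 x : 'rV[R]_n.+1) 0 ord_max = 0.
Proof. by rewrite mxE insubN//= -leqNgt. Qed.

Lemma embed_line (n : nat) (t : R) :
  embed n.+1 (const_mx t : euclidean R 1) = t *: delta_mx 0 ord0 :> 'rV[R]_n.+1.
Proof.
apply/rowP => j; rewrite !mxE eqxx /=; have [->|j0] := eqVneq j ord0.
  by rewrite (@insubT _ _ _ 0%N) //= mxE mulr1.
rewrite insubN ?mulr0//= -leqNgt lt0n.
by apply: contra j0 => /eqP j0; apply/eqP/val_inj.
Qed.

End Padding.

Section Directions.
Context {R : realType} {n : nat}.
Local Notation E := (euclidean R n.+1).
Variable X : set (euclidean R n).

Lemma quasisymmetric_image_conditions (F : E -> E) : (1 <= n)%N -> compact X ->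
  quasisymmetric F -> F @` (embed n.+1 @` cantor_line R) = embed n.+1 @` X ->
  uniformly_perfect X /\ uniformly_disconnected X.
Proof.
move=> n1 cX [eta [heta [[F' [_ _ FK _ _]] Feta]]] FX.
have Finj : injective F by apply: can_inj => x; apply: FK; rewrite inE.
pose axis (s : R) : E := embed n.+1 (const_mx s : euclidean R 1).
have axis_dist s t : mdist (axis s) (axis t) = `|s - t|.
  rewrite mdist_enorm /axis !embed_line -scalerBl enormZ.
  by rewrite -/(vertical _) enorm_vertical mulr1.
pose d' (s t : cantor_point R) := mdist (F (axis (sval s))) (F (axis (sval t))).
have axis_image (s : cantor_point R) : exists2 x, X x & embed n.+1 x = F (axis (sval s)).
  have : (F @` (embed n.+1 @` cantor_line R)) (F (axis (sval s))).
    exists (axis (sval s)) => //; exists (const_mx (sval s)) => //.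
    by exists (sval s) => //; exact: svalP s.
  by rewrite FX => -[x Xx xE]; exists x.
have /choice[g gP] (x : {x | X x}) : exists s : cantor_point R,
    F (axis (sval s)) = embed n.+1 (sval x).
  have : (embed n.+1 @` X) (embed n.+1 (sval x)).
    by exists (sval x) => //; exact: svalP x.
  by rewrite -FX => -[_ [_ [s Cs <-] <-] <-]; exists (exist _ s Cs).
have dE x y : subset_dist x y = d' (g x) (g y).
  by rewrite /d' !gP mdist_embed.
have d_ge0 (s t : cantor_point R) : 0 <= cantor_dist s t by exact: normr_ge0.
have d_sym (s t : cantor_point R) : cantor_dist s t = cantor_dist t s by exact: distrC.
have d_tri (t s u : cantor_point R) : cantor_dist s u <= cantor_dist s t + cantor_dist t u.
  exact: ler_distD.
have d'_sym s t : d' s t = d' t s by exact: metric_sym.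
have d'_tri t s u : d' s u <= d' s t + d' t u by exact: metric_triangle.
have d'_ge0 s t : 0 <= d' s t by exact: mdist_ge0.
have d'0 s t : cantor_dist s t = 0 -> d' s t = 0.
  move=> /eqP; rewrite normr_eq0 subr_eq0 => /eqP st.
  by rewrite /d' st mdistxx.
have qs s u v : 0 < cantor_dist s v ->
    d' s u <= eta (cantor_dist s u / cantor_dist s v) * d' s v.
  rewrite /cantor_dist -!axis_dist mdist_gt0 => sv.
  by rewrite -ler_pdivrMr ?Feta// mdist_gt0 (inj_eq Finj).
have [c' c'1 ud] := chain_bounded_transfer d_ge0 d_sym d_tri d'_sym d'_tri d'_ge0 d'0 qs
  (half_line_bounded heta) (ler1n _ 3) (@cantor_chain_bounded R).
have [c'' c''1 up] := perfect_transfer d_ge0 d'_ge0 d'0 qs (half_line_bounded heta)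
  (half_line_small heta) (ler1n _ 9) (@cantor_perfect R).
split; last first.
  apply: (chain_uniformly_disconnected c'1).
  exact: chain_bounded_map dE ud.
apply: (dist_uniformly_perfect c''1).
- exact: compact_closed (@metric_hausdorff _ _) cX.
- have C1 : ternary_cantor R 1 by exact: cantor1.
  have [x Xx xE] := axis_image (exist _ 0 (@cantor0 R)).
  have [y Xy yE] := axis_image (exist _ 1 C1).
  exists (exist _ x Xx), (exist _ y Xy) => /=; apply/eqP => xy.
  move: xE; rewrite xy yE => /Finj/(congr1 (mdist (axis 0))).
  by rewrite !axis_dist /= subrr sub0r normrN normr0 normr1 => /eqP; rewrite oner_eq0.
- move=> x r r0 [y xy]; have [|s [s1 s2]] := up (g x) r r0.
    by exists (g y); rewrite -dE.
  have [z Xz zE] := axis_image s; exists (exist _ z Xz).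
  have -> : subset_dist x (exist _ z Xz) = d' (g x) s.
    by rewrite /d' gP -zE mdist_embed.
  by [].
Qed.

Lemma taming_quasisymmetric : (1 <= n)%N -> compact X ->
  uniformly_perfect X -> uniformly_disconnected X ->
  exists F : E -> E, quasisymmetric F /\
    F @` (embed n.+1 @` cantor_line R) = embed n.+1 @` X.
Proof.
move=> n1 cX up ud.
have [_ [x0 [y0 [Xx0 Xy0 xy0]]] _] := up.
have [c c1 Dc] := uniformly_disconnected_chain ud.
have [c2 c21 Dp] := uniformly_perfect_dist up.
have [B DB] := compact_bounded (exist _ x0 Xx0) cX.
have at_inf g := @compact_attained _ _ X g cX.
pose a (x : {x | X x}) : 'rV[R]_n.+1 := embed n.+1 (sval x).
have DE : (fun x y => enorm (a x - a y)) = @subset_dist _ _ X.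
  by apply/funext => x; apply/funext => y; rewrite -mdist_enorm mdist_embed.
have D00 : 0 < enorm (a (exist _ x0 Xx0) - a (exist _ y0 Xy0)).
  by have /(congr1 (fun D => D (exist _ x0 Xx0) (exist _ y0 Xy0))) /= -> := DE;
    rewrite mdist_gt0.
rewrite -DE in Dc Dp DB at_inf.
have [f [G [fC f_onto Gqs GP]]] := taming n1 (fun x => embed_last (sval x))
  c1 c21 Dc Dp D00 DB at_inf.
exists G; split; first exact: power_qs_quasisymmetric.
apply/seteqP; split => [_ [_ [_ [t Ct <-] <-] <-]|_ [x Xx <-]].
  have [x <-] := f_onto t Ct; rewrite embed_line GP.
  by exists (sval x) => //; exact: svalP x.
exists (embed n.+1 (const_mx (f (exist _ x Xx)) : euclidean R 1)).
  exists (const_mx (f (exist _ x Xx))) => //.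
  by exists (f (exist _ x Xx)).
by rewrite embed_line GP.
Qed.

End Directions.

Theorem theorem1 (R : realType) (n : nat) (X : set (euclidean R n)) :
  (1 <= n)%N -> compact X ->
  (exists F : euclidean R n.+1 -> euclidean R n.+1,
      quasisymmetric F /\
      F @` (embed n.+1 @` cantor_line R) = embed n.+1 @` X) <->
  (uniformly_perfect X /\ uniformly_disconnected X).
Proof.
move=> n1 cX; split=> [[F [Fqs FX]]|[up ud]].
  exact: quasisymmetric_image_conditions FX.
exact: taming_quasisymmetric.
Qed.
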